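(* Let $Q$ be a probability measure on $\mathbb{R}_+$, $\lambda,\alpha>0$, and $(H_\Delta)_{\Delta\in\mathcal{S}_{bp}}$ a family of Hamiltonians (as in the context) such that $\lambda\exp(-H_{\{X\}}(\{X\}\mid\omega))\le\alpha$ for all $X\in S$ and $\omega\in\Omega$ with $X\notin\omega$. Let $\Delta\in\mathcal{S}_{bp}$ and $\gamma\in\Omega_{\Delta^c}$. Define the dependent single point thinning probability of $X\in\Delta$ given a configuration $\omega'\subseteq\,]-\infty,X[$ by $$p^{s}_{\Delta,\gamma}(X\mid\omega'):=-\frac{1}{\alpha}\frac{\partial}{\partial X}\Big(\lambda Q^\star([X,\infty[)+\log Z(\lambda,[X,\infty[,\gamma\cup\omega')\Big),$$ and, for configurations $\omega',\omega\in\Omega_\Delta$, the joint thinning probability by $$p^{j}_{\Delta,\gamma}(\omega'\mid\omega):=\mathbf{1}_{\{\omega'\subseteq\omega\}}\Big(\prod_{Y\in\omega'}p^{s}_{\Delta,\gamma}(Y\mid\omega'_{]-\infty,Y[})\Big)\Big(\prod_{W\in\omega\setminus\omega'}\big(1-p^{s}_{\Delta,\gamma}(W\mid\omega'_{]-\infty,W[})\big)\Big).$$ Then: (i) the single point thinning probability equals $$p^{s}_{\Delta,\gamma}(X\mid\omega')=\frac{\lambda}{\alpha}\,e^{-H_{\{X\}}(\{X\}\mid\gamma\cup\omega')}\,\frac{Z(\lambda,\,]X,\infty[,\,\gamma\cup\omega'\cup\{X\})}{Z(\lambda,\,[X,\infty[,\,\gamma\cup\omega')};$$ (ii) the measure $$P^{thin}_{\Delta,\gamma,\alpha,Q}(d(\omega^1,\omega^2)):=p^{j}_{\Delta,\gamma}(\omega^1\mid\omega^2)\,P^{poi}_{\Delta,\alpha,Q}(d\omega^2)$$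 on $(\Omega_\Delta^2,\mathcal{F}_\Delta^{\otimes2})$ (i.e. $\xi^2$ has law $P^{poi}_{\Delta,\alpha,Q}$ and, given $\xi^2=\omega^2$, $\xi^1$ equals $\omega^1\subseteq\omega^2$ with probability $p^{j}_{\Delta,\gamma}(\omega^1\mid\omega^2)$) is a thinning from $P^{poi}_{\Delta,\alpha,Q}$ to $P^{gb(\lambda)}_{\Delta,\gamma}$, i.e. a coupling in which $\xi^1$ has law $P^{gb(\lambda)}_{\Delta,\gamma}$, $\xi^2$ has law $P^{poi}_{\Delta,\alpha,Q}$, and $\xi^1\subseteq\xi^2$ almost surely; (iii) the thinning probabilities $p^s_{\Delta,\gamma}$, $p^j_{\Delta,\gamma}$ and the thinning $P^{thin}_{\Delta,\gamma,\alpha,Q}$ are measurable in the boundary condition $\gamma$.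
   Context: Space. $S:=\mathbb{R}^d\times\mathbb{R}_+$ with Borel sets $\mathcal{S}$; $\mathcal{S}_{bp}$ is the collection of Borel sets of $S$ whose projection onto $\mathbb{R}^d$ is a bounded Borel set. $\Omega$ is the set of configurations $\omega\subseteq S$ with $|\omega\cap(\Lambda\times\mathbb{R}_+)|<\infty$ for every bounded $\Lambda\subseteq\mathbb{R}^d$; $\mathcal{F}$ is the $\sigma$-algebra on $\Omega$ generated by the counting variables. For $\Delta\in\mathcal{S}$, $\Omega_\Delta$ is the set of configurations contained in $\Delta$, $\omega_\Delta:=\omega\cap\Delta$, and $\mathcal{F}_\Delta$ is the $\sigma$-algebra generated by the events $\{\omega:\omega_\Delta\in E\}$, $E\in\mathcal{F}$. On $\Omega_\Delta^2$ the canonical variables are $(\xi^1,\xi^2)$. Poisson process. $P^{poi}_{\Delta,\alpha,Q}$ is the law of the Poisson point process on $\Delta$ with intensity measure the restriction to $\Delta$ of $\alpha\,\mathcal{L}\otimes Q$ ($\mathcal{L}$ is Lebesgue measure on $\mathbb{R}^d$). Hamiltonians. For every $\Delta\in\mathcal{S}_{bp}$, $H_\Delta:\Omega_\Delta\times\Omega_{\Delta^c}\to\,]-\infty,\infty]$ is jointly measurable, $H_\Delta(\emptyset\mid\gamma)=0$, and for disjoint $\Delta_1,\Delta_2\in\mathcal{S}_{bp}$, $\omega^1\in\Omega_{\Delta_1}$, $\omega^2\in\Omega_{\Delta_2}$, $\gamma\in\Omega_{(\Delta_1\cup\Delta_2)^c}$, $$H_{\Delta_1\cup\Delta_2}(\omega^1\cup\omega^2\mid\gamma)=H_{\Delta_1}(\omega^1\mid\gamma\cup\omega^2)+H_{\Delta_2}(\omega^2\mid\gamma).$$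 Consequently $H_\Delta(\omega\mid\gamma)=H_{\widetilde\Delta}(\omega\mid\gamma)$ if $\omega\in\Omega_{\widetilde\Delta}$, $\widetilde\Delta\subseteq\Delta$, $\gamma\in\Omega_{\Delta^c}$. Gibbs specification. For $\Delta\in\mathcal{S}_{bp}$ and $\gamma\in\Omega_{\Delta^c}$, $$P^{gb(\lambda)}_{\Delta,\gamma}(d\omega)=\frac{e^{-H_\Delta(\omega\mid\gamma)}}{Z(\lambda,\Delta,\gamma)}P^{poi}_{\Delta,\lambda,Q}(d\omega),\qquad Z(\lambda,\Delta,\gamma)=\int e^{-H_\Delta(\omega\mid\gamma)}P^{poi}_{\Delta,\lambda,Q}(d\omega).$$ Order. Each $x\in\mathbb{R}_+$ is identified with its binary digit sequence $b(x)=(\iota_n)_{n\in\mathbb{Z}}$, $x=\sum_n\iota_n2^n$, choosing the expansion that is not eventually all $1$s as $n\to-\infty$. For $x=(x_0,\dots,x_{m-1})\in\mathbb{R}_+^m$ let $B(x)\in\mathbb{R}_+$ be the number whose $n$-th binary digit is $b(x_{n\bmod m})_{\lfloor n/m\rfloor}$ (interleaving of digits). With $m=d+1$, and after translating $\Delta$ in the $\mathbb{R}^d$-direction so that $\Delta\subseteq\mathbb{R}_+^{d+1}$, $\Delta$ carries the measurable total order $X\preccurlyeq Y\Leftrightarrow B(X)\le B(Y)$. All intervals are with respect to $\preccurlyeq$ and restricted to $\Delta$: e.g. $[X,\infty[\,=\{Y\in\Delta:X\preccurlyeq Y\}$, $]X,\infty[\,=[X,\infty[\setminus\{X\}$, $]-\infty,X[\,=\Delta\setminus[X,\infty[$.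 $Q^\star$ denotes $\mathcal{L}\otimes Q$ on $\Delta$ (equivalently, its image under $B$); it is diffuse. Derivative. For $Q^\star$-a.e. $X\in\Delta$ there exist $\varepsilon>0$ and $X_\varepsilon^+\in\Delta$ with $X\preccurlyeq X_\varepsilon^+$ and $Q^\star([X,X_\varepsilon^+])=\varepsilon$. For $f:\Delta\to\mathbb{R}$, the one-sided derivative at $X$ is $\frac{\partial f}{\partial X}(X):=\lim_{\varepsilon\to0}\frac{f(X_\varepsilon^+)-f(X)}{\varepsilon}$, whenever this limit exists.
   Formalization: Part (i) is asserted for Q*-almost every X (for fixed γ, ω'), since it can fail at single points where H is altered without changing Z; S_bp is read as Borel sets with bounded projection (the projection itself need not be Borel), so that it contains the intervals [X,∞[. *)

(* Defs.v *)
From HB Require Import structures.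
From mathcomp Require Import all_boot all_order all_algebra.
From mathcomp Require Import all_classical all_reals all_analysis.
From mathcomp Require Import measurable_realfun.
Import Order.TTheory GRing.Theory Num.Theory.
Import numFieldNormedType.Exports.

Set Implicit Arguments.
Unset Strict Implicit.
Unset Printing Implicit Defensive.

Local Open Scope classical_set_scope.
Local Open Scope ring_scope.

Section nonneg_pointed.
Variable R : realType.
Definition nonnegR : Type := {nonneg R}.
HB.instance Definition _ := Choice.on nonnegR.
HB.instance Definition _ := isPointed.Build nonnegR (0%:nng : {nonneg R}).
End nonneg_pointed.

Definition nonneg_val (R : realType) (x : nonnegR R) : measurableTypeR R :=
  (x : {nonneg R})%:num.

(* R_+ with its Borel sets, i.e. the traces of the Borel sets of R. *)
Definition mark (R : realType) := g_sigma_algebra_preimageType (@nonneg_val R).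

Definition mark_val (R : realType) (u : mark R) : R := nonneg_val u.

Notation position d R := (d.-tuple (measurableTypeR R)).

Notation marked d R := (position d R * mark R)%type.

(* Lebesgue measure on (the Borel sets of) R^d, as an iterated product. *)
Fixpoint lebesgue_space (R : realType) (d : nat) : set (position d R) -> \bar R :=
  match d with
  | 0 => fun A => dirac [tuple] A
  | d'.+1 => fun A =>
      (@lebesgue_measure R \x @lebesgue_space R d')%E
        [set p : measurableTypeR R * position d' R | A (cons_tuple p.1 p.2)]
  end.

Definition Qstar (R : realType) (d : nat) (Q : set (mark R) -> \bar R) :
    set (marked d R) -> \bar R :=
  (@lebesgue_space R d \x Q)%E.

Definition bounded_space (R : realType) (d : nat) (L : set (position d R)) :=
  exists M : R, forall x, L x -> forall i, `|tnth x i : R| <= M.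

(* Borel sets with bounded projection.  The projection of a Borel set need not
   be Borel; it is only required to be included in a bounded Borel set, so that
   the class is stable under Borel subsets, in particular the order intervals
   below. *)
Definition Sbp (R : realType) (d : nat) : set (set (marked d R)) :=
  [set D | measurable D /\ bounded_space (fst @` D)].

Record config0 (R : realType) (d : nat) := Config {
  pts :> set (marked d R) ;
  _ : forall L : set (position d R), bounded_space L ->
        finite_set (pts `&` L `*` setT) }.

Section config_operations.
Variables (R : realType) (d : nat).
Implicit Types (w : config0 R d).

Lemma config_finite w (L : set (position d R)) : bounded_space L ->
  finite_set (w `&` L `*` setT).
Proof. by case: w => w; exact. Qed.

Definition config_empty : config0 R d.
Proof.
by refine (@Config R d set0 _) => L bL; rewrite set0I; exact: finite_set0.
Defined.

Definition config_single (X : marked d R) : config0 R d.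
Proof.
refine (@Config R d [set X] _) => L bL.
by apply: (@sub_finite_set _ _ [set X]) => //; exact: subIsetl.
Defined.

Definition config_union (w1 w2 : config0 R d) : config0 R d.
Proof.
refine (@Config R d (w1 `|` w2) _) => L bL.
by rewrite setIUl finite_setU; split; exact: config_finite.
Defined.

Definition config_restrict w (A : set (marked d R)) : config0 R d.
Proof.
refine (@Config R d (w `&` A) _) => L bL.
apply: (sub_finite_set _ (config_finite w bL)).
by apply: setSI; exact: subIsetl.
Defined.

HB.instance Definition _ := gen_eqMixin (config0 R d).
HB.instance Definition _ := gen_choiceMixin (config0 R d).
HB.instance Definition _ := isPointed.Build (config0 R d) config_empty.

End config_operations.

Definition count_points (R : realType) (d : nat) (A : set (marked d R))
  (w : config0 R d) : \bar R := counting (w `&` A).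

Definition counting_events (R : realType) (d : nat) : set (set (config0 R d)) :=
  [set U | exists A (n : nat),
     Sbp A /\ U = [set w | count_points A w = n%:R%:E]].

(* Omega with the sigma-algebra F generated by the counting variables. *)
Definition config (R : realType) (d : nat) :=
  g_sigma_algebraType (@counting_events R d).

(* Omega_D, as an event of Omega.  Measures on Omega_D and functions on
   Omega_D x Omega_(D^c) are represented by measures on Omega carried by this
   event and by functions that are only considered on the product of these
   events. *)
Definition config_in (R : realType) (d : nat) (D : set (marked d R)) :
    set (config R d) :=
  [set w | pts w `<=` D].

(* [poisson_prob] is used rather than [poisson_pmf] because the latter is not
   the mass function of the Poisson law of parameter 0; the second argument of
   [poisson_prob] is not used by the library. *)
Definition is_poisson_process (R : realType) (d : nat)
    (mu : set (marked d R) -> \bar R) (P : set (config R d) -> \bar R) :=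
  forall (n : nat) (A : 'I_n -> set (marked d R)) (k : 'I_n -> nat),
    (forall i, measurable (A i)) -> (forall i, (mu (A i) < +oo)%E) ->
    trivIset setT A ->
    P [set w | forall i, count_points (A i) w = (k i)%:R%:E] =
    (\prod_(i < n) poisson_prob (fine (mu (A i))) 0 [set k i])%E.

Definition poisson_law (R : realType) (d : nat) (mu : set (marked d R) -> \bar R) :
    probability (config R d) R :=
  get [set P : pprobability (config R d) R | is_poisson_process mu P].

Definition Ppoi (R : realType) (d : nat) (Q : set (mark R) -> \bar R)
    (D : set (marked d R)) (a : R) : probability (config R d) R :=
  poisson_law (fun A => a%:E * Qstar Q (A `&` D))%E.

Notation hamiltonian_family R d :=
  (set (marked d R) -> config R d -> config R d -> \bar R).

Definition is_hamiltonian (R : realType) (d : nat)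
    (H : hamiltonian_family R d) :=
  [/\ forall D, Sbp D ->
        measurable_fun (config_in D `*` config_in (~` D))
          (fun p : config R d * config R d => H D p.1 p.2),
      forall D w g, Sbp D -> config_in D w -> config_in (~` D) g ->
        (-oo < H D w g)%E,
      forall D g, Sbp D -> config_in (~` D) g ->
        H D (@config_empty R d) g = 0%E &
      forall D1 D2 w1 w2 g, Sbp D1 -> Sbp D2 -> D1 `&` D2 = set0 ->
        config_in D1 w1 -> config_in D2 w2 ->
        config_in (~` (D1 `|` D2)) g ->
        H (D1 `|` D2) (config_union w1 w2) g =
        (H D1 w1 (config_union g w2) + H D2 w2 g)%E].

Definition Zgb (R : realType) (d : nat) (Q : set (mark R) -> \bar R)
    (H : hamiltonian_family R d) (lam : R) (D : set (marked d R)) (g : config R d)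
    : \bar R :=
  (\int[Ppoi Q D lam]_(w in config_in D) expeR (- H D w g))%E.

Definition Pgb (R : realType) (d : nat) (Q : set (mark R) -> \bar R)
    (H : hamiltonian_family R d) (lam : R) (D : set (marked d R)) (g : config R d)
    : set (config R d) -> \bar R :=
  fun E => (\int[Ppoi Q D lam]_(w in config_in D `&` E)
    (expeR (- H D w g) * ((fine (Zgb Q H lam D g))^-1)%:E))%E.

(* n-th binary digit of x >= 0, in the expansion that is not eventually all 1s
   as n tends to -oo. *)
Definition digit (R : realType) (x : R) (n : int) : nat :=
  odd `|Num.floor (x / 2%:R ^ n)|%N.

(* The n-th digit of the result is the digit of index floor(n / m) of
   x_(n mod m), with m = d + 1.  The family is summable, since the digits of
   large index are 0. *)
Definition interleave (R : realType) (d : nat) (x : 'I_d.+1 -> R) : R :=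
  fine (\esum_(n in [set: int])
    ((digit (x (inord `|(n %% d.+1)%Z|%N)) (n %/ d.+1)%Z)%:R * 2%:R ^ n)%:E)%E.

(* The point of R_+^(d+1) obtained from X by translating its R^d-component by
   v; the mark is the last coordinate. *)
Definition coordinates (R : realType) (d : nat) (v : position d R) (X : marked d R)
    (i : 'I_d.+1) : R :=
  if unlift ord_max i is Some j then (tnth X.1 j : R) + tnth v j
  else mark_val X.2.

Definition prec (R : realType) (d : nat) (v : position d R) (X Y : marked d R) : Prop :=
  interleave (coordinates v X) <= interleave (coordinates v Y).

(* The intervals [X, oo[, ]X, oo[, ]-oo, X[ and [X, Y], all restricted to D. *)
Definition prec_ge (R : realType) (d : nat) (v : position d R) (D : set (marked d R))
  (X : marked d R) : set (marked d R) := [set Y | D Y /\ prec v X Y].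

Definition prec_gt (R : realType) (d : nat) (v : position d R) (D : set (marked d R))
  (X : marked d R) : set (marked d R) := prec_ge v D X `\ X.

Definition prec_lt (R : realType) (d : nat) (v : position d R) (D : set (marked d R))
  (X : marked d R) : set (marked d R) := D `\` prec_ge v D X.

Definition prec_cc (R : realType) (d : nat) (v : position d R) (D : set (marked d R))
  (X Y : marked d R) : set (marked d R) := [set W | [/\ D W, prec v X W & prec v W Y]].

(* The filter of the points Y = X_e^+ with e = Q*([X, Y]) > 0 tending to 0. *)
Definition right_nbhs (R : realType) (d : nat) (Q : set (mark R) -> \bar R)
    (v : position d R) (D : set (marked d R)) (X : marked d R) : set_system (marked d R) :=
  filter_from [set e : R | 0 < e]
    (fun e => [set Y | [/\ D Y, prec v X Y &
                          (0 < Qstar Q (prec_cc v D X Y) < e%:E)%E]]).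

Definition diff_quotient (R : realType) (d : nat) (Q : set (mark R) -> \bar R)
    (v : position d R) (D : set (marked d R)) (f : marked d R -> R) (X Y : marked d R) : R :=
  (f Y - f X) / fine (Qstar Q (prec_cc v D X Y)).

Definition derivable_right (R : realType) (d : nat)
    (Q : set (mark R) -> \bar R) (v : position d R) (D : set (marked d R))
    (f : marked d R -> R) (X : marked d R) : Prop :=
  cvg (diff_quotient Q v D f X Y @[Y --> right_nbhs Q v D X]).

(* Meaningful only where [derivable_right] holds and [right_nbhs] is proper,
   which is the case almost everywhere for the functions considered below. *)
Definition derive_right (R : realType) (d : nat) (Q : set (mark R) -> \bar R)
    (v : position d R) (D : set (marked d R)) (f : marked d R -> R) (X : marked d R) : R :=
  lim (diff_quotient Q v D f X Y @[Y --> right_nbhs Q v D X]).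

Section thinning.
Variables (R : realType) (d : nat) (Q : set (mark R) -> \bar R).
Variables (H : hamiltonian_family R d) (lam a : R).
Variables (v : position d R) (D : set (marked d R)).
Implicit Types (g w : config R d) (X : marked d R).

(* Used with g in Omega_(D^c) and w' in Omega_(]-oo, X[). *)
Definition potential g w' X : R :=
  lam * fine (Qstar Q (prec_ge v D X)) +
  ln (fine (Zgb Q H lam (prec_ge v D X) (config_union g w'))).

Definition p_single g X w' : R :=
  - (1 / a) * derive_right Q v D (potential g w') X.

Definition p_joint g w' w : R :=
  (`[< pts w' `<=` pts w >])%:R *
  (\big[*%R/1]_(Y \in pts w')
     p_single g Y (config_restrict w' (prec_lt v D Y))) *
  (\big[*%R/1]_(W \in pts w `\` pts w')
     (1 - p_single g W (config_restrict w' (prec_lt v D W)))).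

(* p_joint g w1 w2 * Ppoi(dw2): integration over w2 and summation over the
   (finitely many) w1 included in w2. *)
Definition Pthin g : set (config R d * config R d) -> \bar R :=
  fun A => (\int[Ppoi Q D a]_(w2 in config_in D)
    (\sum_(w1 \in [set w1 : config R d | pts w1 `<=` pts w2 /\ A (w1, w2)])
       p_joint g w1 w2)%:E)%E.

End thinning.

(* P, a law on Omega_D^2, is a thinning from P2 to P1. *)
Definition is_thinning (R : realType) (d : nat) (D : set (marked d R))
    (P : probability (config R d * config R d)%type R)
    (P2 P1 : set (config R d) -> \bar R) :=
  [/\ P (config_in D `*` config_in D) = 1%E,
      forall E, measurable E -> P (E `*` setT) = P1 E,
      forall E, measurable E -> P (setT `*` E) = P2 E &
      {ae P, forall w, pts w.1 `<=` pts w.2}].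

(* Main.v *)
From HB Require Import structures.
Require Import Defs.
From mathcomp Require Import all_boot all_order all_algebra.
From mathcomp Require Import all_classical all_reals all_analysis.
From mathcomp Require Import measurable_realfun.
From mathcomp Require Import ring lra zify.
Import Order.TTheory GRing.Theory Num.Theory.
Import numFieldNormedType.Exports.

Local Open Scope classical_set_scope.
Local Open Scope ring_scope.
Set Implicit Arguments.
Unset Strict Implicit.
Unset Printing Implicit Defensive.

(* Interleaving binary digits turns the marked points of D into real numbers, so that configurations are explored in
   increasing order.  Write Z(t, g) for the partition function of the part of D above the level t.  Removing the first
   point of a configuration (Mecke's formula for the unnormalised Poisson measure) gives
     Z(t, g) = 1 + int_(x > t) exp(-H_x(x | g)) Z(x, g + x) dx,
   an integral in the level variable; Lebesgue's differentiation theorem then yields the derivative of log Z, hence the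
   single point thinning probability.  Conversely, integrating the logarithmic derivative between consecutive points of
   a configuration telescopes, and the product of the keeping probabilities with exp(- total rate) is the Gibbs density:
   this is the first marginal.  The second one is the fact that a sequential selection has total probability 1. *)

(** The obstacle is the dependence of null sets on boundary conditions. The closed form of the
    thinning probability holds for almost every point, with an exceptional set that depends on the
    boundary condition, while the exploration changes the boundary condition from point to point. As
    a configuration has finitely many points in D, its past below any rank is also its past below a
    rational rank, so countably many exceptional sets suffice; the splitting form of Mecke's formula
    then covers all ways of keeping a part of a configuration. A second difficulty is that the
    derivative is a choice of limit along a filter, yet has to be measurable in the boundary
    condition everywhere, even where it has no meaning. Monotonicity of log Z replaces the filter by
    a single sequence, and limits of sequences are measurable together with their default value.
    Integrals against the order are computed without a substitution rule: both sides of the expected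
    identity have increments that agree to second order in a continuous mass, and repeated bisection
    makes the difference vanish. *)

Section measure_constructions.
Local Open Scope ereal_scope.
Context d (T : measurableType d) (R : realType).

Definition mkmeasure (mu : set T -> \bar R) (h0 : mu set0 = 0)
    (hge : forall A, 0 <= mu A) (hs : semi_sigma_additive mu) :
    {measure set T -> \bar R} :=
  HB.pack_for (measure T R) mu (isMeasure.Build _ _ _ mu h0 hge hs).

Definition mksigma_finite (mu : {measure set T -> \bar R}) (h : sigma_finite setT mu) :
    {sigma_finite_measure set T -> \bar R} :=
  let H1 := isSFinite.Build _ _ _ _ (sfinite_measure_sigma_finite h) in
  let H2 := isSigmaFinite.Build _ _ _ _ h in
  HB.pack_for (SigmaFiniteMeasure.type T R) (Measure.sort mu) H1 H2.

Lemma fin_num_fun_setT (mu : {measure set T -> \bar R}) :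
  mu setT < +oo -> fin_num_fun mu.
Proof.
move=> h A mA; rewrite ge0_fin_numE ?measure_ge0//.
by apply: le_lt_trans h; rewrite le_measure ?inE.
Qed.

Let finite_sigma_finite (mu : {measure set T -> \bar R}) :
  fin_num_fun mu -> sigma_finite setT mu.
Proof. by move=> h; apply: fin_num_fun_sigma_finite; rewrite ?measure0. Qed.

Definition mkfinite (mu : {measure set T -> \bar R}) (h : mu setT < +oo) :
    {finite_measure set T -> \bar R} :=
  let h' := fin_num_fun_setT h in
  let H1 := isFinite.Build _ _ _ _ h' in
  let h'' := finite_sigma_finite h' in
  let H2 := isSFinite.Build _ _ _ _ (sfinite_measure_sigma_finite h'') in
  let H3 := isSigmaFinite.Build _ _ _ _ h'' in
  HB.pack_for (FiniteMeasure.type T R) (Measure.sort mu) H1 H2 H3.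

End measure_constructions.

Section probability_of_measure.
Context d (T : measurableType d) (R : realType) (mu : {measure set T -> \bar R}).

Definition probability_of (h : mu setT = 1%E) : set T -> \bar R := mu.

Variable h : mu setT = 1%E.
HB.instance Definition _ := Measure.copy (probability_of h) (Measure.sort mu).
HB.instance Definition _ := Measure_isProbability.Build _ _ _ (probability_of h) h.

Definition mkprobability : probability T R := probability_of h.
End probability_of_measure.

Section integrals.
Local Open Scope ereal_scope.
Context d d' (T : measurableType d) (T' : measurableType d') (R : realType).

Section image.
Variables (m : {measure set T -> \bar R}) (f : T -> T').
Hypothesis mf : measurable_fun [set: T] f.

Let mpre A : measurable A -> measurable (f @^-1` A).
Proof. by move=> mA; rewrite -[X in measurable X]setTI; exact: mf. Qed.

Let im0 : pushforward m f set0 = 0.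
Proof. by rewrite /pushforward preimage_set0 measure0. Qed.

Let im_ge0 A : 0 <= pushforward m f A.
Proof. exact: measure_ge0. Qed.

Let im_sigma : semi_sigma_additive (pushforward m f).
Proof.
move=> F mF tF mUF; rewrite /pushforward preimage_bigcup.
apply: measure_semi_sigma_additive => [n||].
- exact: mpre.
- apply/trivIsetP => /= i j _ _ ij; rewrite -preimage_setI.
  by move/trivIsetP : tF => /(_ _ _ _ _ ij) ->//; rewrite preimage_set0.
- by rewrite -preimage_bigcup; exact: mpre.
Qed.

Definition image_measure : {measure set T' -> \bar R} := mkmeasure im0 im_ge0 im_sigma.

End image.

Lemma ge0_integral_image (m : {measure set T -> \bar R}) (f : T -> T')
    (mf : measurable_fun setT f) (g : T' -> \bar R) :
  measurable_fun setT g -> (forall x, 0 <= g x) ->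
  \int[image_measure m mf]_y g y = \int[m]_x g (f x).
Proof. by move=> mg g0; exact: ge0_integral_pushforward. Qed.

Definition density (m : {measure set T -> \bar R}) (h : T -> \bar R)
  (A : set T) : \bar R := \int[m]_(x in A) h x.

Section density.
Variables (m : {measure set T -> \bar R}) (h : T -> \bar R).
Hypotheses (mh : measurable_fun setT h) (h0 : forall x, 0 <= h x).

Let d0 : density m h set0 = 0.
Proof. by rewrite /density integral_set0. Qed.

Let d_ge0 A : 0 <= density m h A.
Proof. by apply: integral_ge0 => x _. Qed.

Let d_sigma : semi_sigma_additive (density m h).
Proof.
move=> F mF tF mUF; rewrite /density ge0_integral_bigcup//; last exact: measurable_funTS.
by apply: is_cvg_ereal_nneg_natsum => n _; exact: integral_ge0.
Qed.

Definition density_measure : {measure set T -> \bar R} := mkmeasure d0 d_ge0 d_sigma.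

End density.
End integrals.

(** * Binary expansions of nonnegative reals *)

Section binary_expansion.
Variable R : realType.
Implicit Types (b : int -> bool) (x : R) (n k N : int).

Definition eventually0 b := exists N : int, forall n, N <= n -> b n = false.
Definition cofinally0 b := forall k, exists2 n, n < k & b n = false.

Definition low_sum b k : \bar R :=
  \esum_(n in [set n : int | n < k]) ((b n)%:R * 2%:R ^ n)%:E.

Definition binary_value b : R :=
  fine (\esum_(n in [set: int]) ((b n)%:R * 2%:R ^ n : R)%:E).

Lemma low_sum_term_ge0 b n : (0 <= ((b n)%:R * 2%:R ^ n : R)%:E)%E.
Proof. by rewrite lee_fin mulr_ge0 ?exprz_ge0. Qed.

Lemma low_sum_ge0 b k : (0 <= low_sum b k)%E.
Proof. by apply: esum_ge0 => n _; exact: low_sum_term_ge0. Qed.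

Lemma exp2z_gt0 n : (0 : R) < 2%:R ^ n.
Proof. by rewrite exprz_gt0. Qed.

Lemma exp2zS n : 2%:R ^ (n + 1) = 2%:R * (2%:R : R) ^ n.
Proof. by rewrite expfzDr ?pnatr_eq0// mulrC. Qed.

Lemma low_sumS b k :
  low_sum b (k + 1) = (low_sum b k + ((b k)%:R * 2%:R ^ k)%:E)%E.
Proof.
rewrite /low_sum (esumID [set k]); last by move=> *; exact: low_sum_term_ge0.
rewrite addeC; congr (_ + _)%E.
  congr esum; apply/seteqP; split=> n /=.
    by move=> [nk /eqP]; rewrite -lezD1 lerD2r le_eqVlt in nk; case/orP: nk => [->|].
  by move=> nk; rewrite (lt_trans nk) ?ltrDl//; split => // nE; rewrite nE ltxx in nk.
rewrite (_ : _ `&` _ = [set k]) ?esum_set1 ?low_sum_term_ge0//.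
by apply/seteqP; split=> [n [_ ->]//|n /= ->]; rewrite ltrDl.
Qed.

Lemma low_sum_le b k : (low_sum b k <= (2%:R ^ k)%:E)%E.
Proof.
have bij : set_bij [set: nat] [set n : int | n < k] (fun j : nat => k - j.+1%:Z).
  split.
  - by move=> j _ /=; rewrite ltrBlDr ltrDl.
  - by move=> i j _ _ /addrI /oppr_inj [].
  - move=> n /= nk; exists (absz (k - n - 1)%R) => //=.
    by rewrite -addn1 PoszD gez0_abs; [ring | rewrite subr_ge0 -gtz0_ge1 subr_gt0].
rewrite /low_sum (reindex_esum _ _ _ _ bij).
rewrite -nneseries_esumT; last by move=> *; exact: low_sum_term_ge0.
have := @cvg_geometric_eseries_half R (2%:R ^ k) 0.
rewrite expr0 divr1 => /cvg_lim <- //.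
apply: lee_nneseries => [*|j _]; first exact: low_sum_term_ge0.
rewrite lee_fin expfzDr ?pnatr_eq0// -exprnN addn1 natrX.
by rewrite -[leRHS]mul1r ler_wpM2r ?divr_ge0 ?exprn_ge0 ?exprz_ge0//; case: (b _).
Qed.

Lemma low_sum_fin_num b k : low_sum b k \is a fin_num.
Proof.
by rewrite ge0_fin_numE ?low_sum_ge0// (le_lt_trans (low_sum_le _ _))// ltry.
Qed.

(** A zero digit at [j] leaves the sum below [j + 1] at most [2 ^ j], half of its bound. Adding the
    higher digits one at a time preserves the strict inequality. *)
Lemma low_sum_lt b k : cofinally0 b -> (low_sum b k < (2%:R ^ k)%:E)%E.
Proof.
move=> /(_ k)[j jk bj]; have -> : k = j + 1 + (absz (k - j - 1)%R)%:Z.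
  by rewrite gez0_abs; [ring | rewrite subr_ge0 -gtz0_ge1 subr_gt0].
elim: (absz _) => [|m ih].
  rewrite addr0 low_sumS bj mul0r adde0 (le_lt_trans (low_sum_le _ _))//.
  by rewrite lte_fin exp2zS ltr_pMl ?exp2z_gt0 ?ltr1n.
rewrite -addn1 PoszD addrA low_sumS exp2zS (_ : forall p : R, 2%:R * p = p + p); last by move=> p; ring.
move: ih; rewrite -(fineK (low_sum_fin_num b _)) -EFinD !lte_fin => ih.
by rewrite ltr_leD// -[leRHS]mul1r ler_wpM2r ?exprz_ge0//; case: (b _).
Qed.

Lemma binary_valueE b (N : int) : (forall n, N <= n -> b n = false) ->
  binary_value b = fine (low_sum b N).
Proof.
move=> bN; rewrite /binary_value /low_sum; congr fine.
rewrite (esumID [set n : int | n < N]); last by move=> *; exact: low_sum_term_ge0.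
rewrite setTI [X in (_ + X)%E]esum1 ?adde0// => n [_ /= /negP].
by rewrite -leNgt => /bN ->; rewrite mul0r.
Qed.

Lemma binary_value_ge0 b : 0 <= binary_value b.
Proof. by apply: fine_ge0; apply: esum_ge0 => n _; exact: low_sum_term_ge0. Qed.

(* [M k] is the integer int_part of x / 2^k, when [b] are the digits of x. *)
Lemma binary_value_split b (M : int -> nat) (N : int) :
  (forall n, N <= n -> b n = false) -> (forall n, N <= n -> M n = 0%N) ->
  (forall k, M k = (2 * M (k + 1)%R + b k)%N) ->
  forall k, binary_value b = fine (low_sum b k) + (M k)%:R * 2%:R ^ k.
Proof.
move=> bN MN MS k.
have [Nk|kN] := leP N k.
  by rewrite (MN _ Nk) mul0r addr0 (@binary_valueE _ k)// => n kn; rewrite bN// (le_trans Nk).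
have -> : k = N - (absz (N - k)%R)%:Z.
  by rewrite gez0_abs; [ring | rewrite subr_ge0 ltW].
elim: (absz _) => [|m ih]; first by rewrite subr0 (MN _ (lexx _)) mul0r addr0 (binary_valueE bN).
rewrite ih; set j := (N - m.+1%:Z).
have -> : N - m%:Z = j + 1 by rewrite /j -addn1 PoszD; ring.
rewrite low_sumS fineD ?low_sum_fin_num//= (MS j) natrD natrM exp2zS.
ring.
Qed.

Definition int_part x k : nat := `|Num.floor (x / 2%:R ^ k)|%N.

Definition digitb x n : bool := odd (int_part x n).

Lemma part_itv x k : 0 <= x ->
  (int_part x k)%:R * 2%:R ^ k <= x < (int_part x k).+1%:R * 2%:R ^ k.
Proof.
move=> x0; have f0 : 0 <= Num.floor (x / 2%:R ^ k).
  by rewrite floor_ge0 divr_ge0 ?exprz_ge0.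
have /andP[] := floor_itv (x / 2%:R ^ k).
rewrite -ler_pdivlMr ?exp2z_gt0// -ltr_pdivrMr ?exp2z_gt0//.
by rewrite -[(int_part x k).+1%:R]natr1 /int_part natr_absz ger0_norm// intrD => -> ->.
Qed.

Lemma part_unique x k m :
  m%:R * 2%:R ^ k <= x < m.+1%:R * 2%:R ^ k -> int_part x k = m.
Proof.
move=> /andP[]; rewrite -ler_pdivlMr ?exp2z_gt0// -ltr_pdivrMr ?exp2z_gt0// => h1 h2.
rewrite /int_part (_ : Num.floor _ = m%:Z)//; apply: floor_def.
by rewrite intrD -!pmulrn natr1 h1.
Qed.

Lemma partS x k : 0 <= x -> int_part x k = (2 * int_part x (k + 1)%R + digitb x k)%N.
Proof.
move=> x0; suff h : int_part x (k + 1) = (int_part x k)./2.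
  by rewrite h /digitb mul2n addnC odd_double_half.
apply: part_unique; have /andP[h1 h2] := part_itv k x0.
rewrite exp2zS !mulrA -!natrM; apply/andP; split.
  apply: le_trans h1; rewrite ler_wpM2r ?exprz_ge0// ler_nat muln2.
  by rewrite -{2}(odd_double_half (int_part x k)) leq_addl.
apply: (lt_le_trans h2); rewrite ler_wpM2r ?exprz_ge0// ler_nat muln2 doubleS.
by rewrite -{1}(odd_double_half (int_part x k)) -addSn; case: odd; rewrite ?add1n ?leqnSn.
Qed.

Lemma part_eq0 x : 0 <= x -> exists N : int, forall n, N <= n -> int_part x n = 0%N.
Proof.
move=> x0; pose N := `|Num.floor x|.+1; exists N%:Z => n Nn.
apply: part_unique; rewrite mul0r mul1r x0 /=.
apply: (@lt_le_trans _ _ (2%:R ^ N%:Z)); last by rewrite ler_eXz2l// ltr1n.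
have : x < N%:R.
  have := floorD1_gt x; rewrite /N -[(absz _).+1%:R]natr1 natr_absz ger0_norm ?floor_ge0//.
  by rewrite intrD.
by move=> /lt_trans; apply; rewrite -exprnP -natrX ltr_nat ltn_expl.
Qed.

Lemma digitb_eventually0 x : 0 <= x -> eventually0 (digitb x).
Proof. by move=> /part_eq0[N h]; exists N => n /h; rewrite /digitb => ->. Qed.

Lemma exp2z_small (e : R) k : 0 < e -> exists2 n : int, n < k & 2%:R ^ n < e.
Proof.
move=> e0; pose m := (`|k|%N + `|Num.floor e^-1|.+1)%N; exists (- m%:Z - 1).
  by rewrite /m; lia.
rewrite -(invrK e) -ltf_pV2 ?posrE ?invr_gt0 ?exp2z_gt0 ?invr_gt0// !invrK.
rewrite -opprD -PoszD addn1 -exprnN invrK.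
have : e^-1 < `|Num.floor e^-1|.+1%:R.
  have := floorD1_gt e^-1; rewrite -[(absz _).+1%:R]natr1 natr_absz ger0_norm ?floor_ge0 ?invr_ge0 ?(ltW e0)//.
  by rewrite intrD.
move=> /lt_trans; apply; rewrite -natrX ltr_nat.
apply: leq_trans (ltn_expl _ (isT : 1 < 2)%N); rewrite /m; lia.
Qed.

Lemma digitb_value x : 0 <= x -> binary_value (digitb x) = x.
Proof.
move=> x0; have [N hN] := part_eq0 x0.
have hsplit := binary_value_split (fun n h => congr1 odd (hN n h)) hN (fun k => partS k x0).
(* Both numbers lie in the closed dyadic interval of length [2 ^ n] that starts at
   [int_part x n * 2 ^ n], and [n] can be taken arbitrarily negative. *)
have close n : `|binary_value (digitb x) - x| <= 2%:R ^ n.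
  rewrite (hsplit n); have /andP[h1 h2] := part_itv n x0.
  have l0 : 0 <= fine (low_sum (digitb x) n) by rewrite fine_ge0 ?low_sum_ge0.
  have l1 : fine (low_sum (digitb x) n) <= 2%:R ^ n.
    by rewrite -lee_fin fineK ?low_sum_fin_num ?low_sum_le.
  rewrite -[(int_part x n).+1%:R]natr1 mulrDl mul1r in h2.
  by rewrite ler_norml; apply/andP; split; lra.
apply/eqP; rewrite -subr_eq0 -normr_le0; rewrite leNgt; apply/negP => /(exp2z_small 0)[n _].
by rewrite ltNge close.
Qed.

(** If all digits below [k] were 1, the right end of the dyadic interval of [x] would be the same at
    every scale below [k]. Then [x] would be within [2 ^ n] of it for every such [n], although it
    stays strictly below it. *)
Lemma digitb_cofinally0 x : 0 <= x -> cofinally0 (digitb x).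
Proof.
move=> x0 k; apply: contrapT => /forall2NP h.
have all1 n : n < k -> digitb x n by move=> nk; case: (h n) => // /eqP; rewrite eqbF_neg negbK.
have cst (m : nat) : (int_part x (k - m%:Z)).+1%:R * 2%:R ^ (k - m%:Z) = (int_part x k).+1%:R * 2%:R ^ k :> R.
  elim: m => [|m <-]; first by rewrite subr0.
  have -> : k - m%:Z = (k - m.+1%:Z) + 1 by rewrite -addn1 PoszD; ring.
  rewrite (partS (k - m.+1%:Z))// all1 ?ltrBlDr ?ltrDl// exp2zS mulrA; congr (_ * _).
  by rewrite -natrM; congr (_%:R); lia.
have /andP[_ h2] := part_itv k x0.
rewrite -subr_gt0 in h2; have [n nk] := exp2z_small k h2.
have nE : n = k - (absz (k - n)%R)%:Z by rewrite gez0_abs; [ring | rewrite subr_ge0 ltW].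
have /andP[h3 _] := part_itv n x0.
have := cst (absz (k - n)%R); rewrite -nE -[(int_part x n).+1%:R]natr1 mulrDl mul1r; lra.
Qed.

Lemma digitb_binary_value b : eventually0 b -> cofinally0 b ->
  digitb (binary_value b) = b.
Proof.
move=> [N bN] cb; apply/funext => k.
(* [Mf j] reads the [j] digits just below [N] as an integer, by Horner's rule. [M n] is then the
   integer quotient by [2 ^ n] of the number to be reached, the candidate for [int_part]. *)
pose Mf (j : nat) : nat := iteri j (fun i m => (2 * m + b (N - i.+1%:Z)%R)%N) 0%N.
pose M n : nat := if N <= n then 0%N else Mf (absz (N - n)%R).
have M0 n : N <= n -> M n = 0%N by rewrite /M => ->.
have MS n : M n = (2 * M (n + 1)%R + b n)%N.
  rewrite /M; case: (leP N n) => Nn.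
    by rewrite (le_trans Nn) ?lerDl// bN.
  have -> : (absz (N - n)%R) = (absz (N - (n + 1))%R).+1 by lia.
  rewrite /Mf /= -/Mf; congr (2 * _ + b _)%N; last by lia.
  case: ifPn => // h; rewrite (_ : n = N - 1); last by lia.
  by rewrite subrK subrr.
have hsplit := binary_value_split bN M0 MS.
suff -> : digitb (binary_value b) k = odd (M k).
  by rewrite MS oddD mul2n odd_double; case: (b k).
congr odd; apply: part_unique; rewrite (hsplit k) -[(M k).+1%:R]natr1 mulrDl mul1r.
have := low_sum_ge0 b k; have := low_sum_lt k cb.
rewrite -(fineK (low_sum_fin_num b k)) lte_fin lee_fin => h1 h2.
by apply/andP; split; lra.
Qed.

Lemma esum_int_measurable d (T : measurableType d) (f : int -> T -> \bar R) :
  (forall n, measurable_fun setT (f n)) -> (forall n t, (0 <= f n t)%E) ->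
  measurable_fun setT (fun t => \esum_(n in [set: int]) f n t).
Proof.
move=> mf f0.
pose e (m : nat) : int := if odd m then Negz m./2 else Posz m./2.
have bij : set_bij [set: nat] [set: int] e.
  split => //.
  - move=> i j _ _; rewrite /e => eij; rewrite -(odd_double_half i) -(odd_double_half j).
    by move: eij; case: (odd i); case: (odd j) => // -[->].
  - case=> n _; first by exists n.*2 => //; rewrite /e odd_double doubleK.
    by exists n.*2.+1 => //; rewrite /e /= odd_double /= uphalf_double.
under eq_fun do rewrite (reindex_esum _ _ _ _ bij) -nneseries_esumT//.
exact: ge0_emeasurable_sum.
Qed.

Lemma measurable_digitb n : measurable_fun [set: R] (fun x => (digitb x n)%:R : R).
Proof.
have mA : measurable [set x : R | digitb x n].
  rewrite (_ : mkset _ = \bigcup_(m in [set m : int | odd `|m|])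
      [set x | m%:~R * 2%:R ^ n <= x < (m + 1)%:~R * 2%:R ^ n]); last first.
    apply/seteqP; split=> x /=.
      move=> ?; exists (Num.floor (x / 2%:R ^ n)) => //=.
      by rewrite -ler_pdivlMr ?exp2z_gt0// -ltr_pdivrMr ?exp2z_gt0// floor_itv.
    move=> [m /= om]; rewrite -ler_pdivlMr ?exp2z_gt0// -ltr_pdivrMr ?exp2z_gt0// => mx.
    by rewrite /digitb /int_part (floor_def mx).
  rewrite bigcup_mkcond; apply: countable_bigcupT_measurable => // m; case: ifPn => // _.
  rewrite (_ : mkset _ = `[m%:~R * 2%:R ^ n, (m + 1)%:~R * 2%:R ^ n[%classic); first exact: measurable_itv.
  by apply/seteqP; split => x /=; rewrite in_itv.
rewrite (_ : (fun _ => _) = \1_[set x : R | digitb x n]).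
  exact: measurable_indic.
by apply/funext => x; rewrite indicE; case: (boolP (digitb x n)) => h;
  [rewrite mem_set | rewrite memNset//; exact/negP].
Qed.

Lemma binary_value_measurable d (T : measurableType d) (b : T -> int -> bool) :
  (forall n, measurable_fun setT (fun t => (b t n)%:R : R)) ->
  measurable_fun setT (fun t => binary_value (b t)).
Proof.
move=> mb; apply: measurableT_comp => //.
apply: esum_int_measurable => [n|n t]; last exact: low_sum_term_ge0.
by apply/measurable_EFinP; apply: measurable_funM.
Qed.

End binary_expansion.

(** * Interleaving of coordinates and the rank of a marked point *)

Section interleaving.
Variables (R : realType) (d : nat).
Implicit Types (x : 'I_d.+1 -> R) (v : position d R) (X Y : marked d R).

Definition interleaved_digits x (n : int) : bool :=
  digitb (x (inord `|(n %% d.+1)%Z|%N)) (n %/ d.+1)%Z.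

Lemma interleaveE x : interleave x = binary_value R (interleaved_digits x).
Proof. by []. Qed.

Lemma interleaved_digitsE x (k : int) (i : 'I_d.+1) :
  interleaved_digits x (k * d.+1%:Z + i%:Z) = digitb (x i) k.
Proof.
have ilt : (0 <= i%:Z < d.+1%:Z) by rewrite lez_nat/= ltz_nat ltn_ord.
rewrite /interleaved_digits divzMDl// modzMDl divz_small ?modz_small// addr0.
by rewrite absz_nat inord_val.
Qed.

Lemma interleaved_eventually0 x : (forall i, 0 <= x i) ->
  eventually0 (interleaved_digits x).
Proof.
move=> x0; have /choice[N hN] : forall i, exists N : int, forall n, N <= n -> digitb (x i) n = false.
  by move=> i; have [N hN] := digitb_eventually0 (x0 i); exists N.
pose M := (\sum_i absz (N i))%N; exists (M%:Z * d.+1%:Z) => n Mn.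
apply: hN; apply: (@le_trans _ _ M%:Z); last by rewrite lez_divRL.
apply: (@le_trans _ _ (absz (N (inord `|(n %% d.+1)%Z|)))%:Z); first lia.
by rewrite lez_nat /M (bigD1 (inord `|(n %% d.+1)%Z|%N))//= leq_addr.
Qed.

(** One coordinate suffices: the zero digits of coordinate 0 reappear in the interleaved sequence at
    multiples of [d.+1]. *)
Lemma interleaved_cofinally0 x : (forall i, 0 <= x i) ->
  cofinally0 (interleaved_digits x).
Proof.
move=> x0 k; have [j jk xj] := digitb_cofinally0 (x0 ord0) (k %/ d.+1)%Z.
exists (j * d.+1%:Z + (ord0 : 'I_d.+1)%:Z); last by rewrite interleaved_digitsE.
rewrite addr0; apply: (@lt_le_trans _ _ ((k %/ d.+1)%Z * d.+1%:Z)).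
  by rewrite ltr_pM2r.
by rewrite -lez_divRL.
Qed.

Definition deinterleave (y : R) (i : 'I_d.+1) : R :=
  binary_value R (fun k => digitb y (k * d.+1%:Z + i%:Z)).

Lemma interleaveK x : (forall i, 0 <= x i) -> deinterleave (interleave x) = x.
Proof.
move=> x0; apply/funext => i; rewrite /deinterleave interleaveE.
rewrite digitb_binary_value; [|exact: interleaved_eventually0|exact: interleaved_cofinally0].
under eq_fun do rewrite interleaved_digitsE.
exact: digitb_value.
Qed.

Lemma measurable_deinterleave i : measurable_fun setT (deinterleave ^~ i).
Proof. by apply: binary_value_measurable => n; exact: measurable_digitb. Qed.

Lemma measurable_mark_val : measurable_fun setT (@mark_val R).
Proof. by move=> _ B mB; rewrite setTI; exists B => //; rewrite setTI. Qed.

Lemma mark_val_inj : injective (@mark_val R).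
Proof. by move=> x y xy; exact: val_inj. Qed.

Lemma measurable_to_mark d' (T : measurableType d') (f : T -> mark R) :
  measurable_fun setT (fun t => mark_val (f t)) -> measurable_fun setT f.
Proof. by move=> mf _ _ [B mB <-]; rewrite setTI; exact: mf. Qed.

Definition rank v X : R := interleave (coordinates v X).

Lemma measurable_coordinates v i : measurable_fun setT (fun X => coordinates v X i).
Proof.
rewrite /coordinates; case: unliftP => [j _|_].
  apply: measurable_funD => //.
  by apply: (measurableT_comp (measurable_tnth j)).
exact: (measurableT_comp measurable_mark_val).
Qed.

Lemma measurable_rank v : measurable_fun setT (rank v).
Proof.
apply: binary_value_measurable => n.
apply: (@measurableT_comp _ _ _ _ _ _ (fun x : R => (digitb x (n %/ d.+1)%Z)%:R : R)).
  exact: measurable_digitb.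
exact: measurable_coordinates.
Qed.

(** A measurable left inverse of [rank v] on [D]. It later turns a function of the points into a
    function of a real variable, to which differentiation theorems apply. *)
Definition unrank v (y : R) : marked d R :=
  ([tuple (deinterleave y (lift ord_max j) - tnth v j : measurableTypeR R) | j < d],
   NngNum (binary_value_ge0 R (fun k => digitb y (k * d.+1%:Z + (ord_max : 'I_d.+1)%:Z)))).

Lemma measurable_unrank v : measurable_fun setT (unrank v).
Proof.
apply: measurable_fun_pair => /=.
  apply/measurable_fun_tnthP => j /=.
  rewrite (_ : _ \o _ = fun y => deinterleave y (lift ord_max j) - tnth v j).
    by apply: measurable_funB => //; exact: measurable_deinterleave.
  by apply/funext => y /=; rewrite tnth_mktuple.
apply: measurable_to_mark; exact: (measurable_deinterleave ord_max).
Qed.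

Definition nonneg_shift v (D : set (marked d R)) :=
  forall X, D X -> forall i, 0 <= (tnth X.1 i : R) + tnth v i.

Lemma rankK v D X : nonneg_shift v D -> D X -> unrank v (rank v X) = X.
Proof.
move=> hv DX; have c0 i : 0 <= coordinates v X i.
  by rewrite /coordinates; case: unliftP => [j _|_]; [exact: hv|rewrite /mark_val /nonneg_val].
case: X DX c0 => x u DX c0; congr pair.
  apply: eq_from_tnth => j; rewrite tnth_mktuple interleaveK//.
  by rewrite /coordinates liftK addrK.
apply: mark_val_inj; rewrite /mark_val /nonneg_val /=.
rewrite -[LHS]/(deinterleave (interleave (coordinates v (x, u))) ord_max) interleaveK//.
by rewrite /coordinates unlift_none.
Qed.

Lemma rank_inj v D X Y : nonneg_shift v D -> D X -> D Y -> rank v X = rank v Y -> X = Y.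
Proof. by move=> hv DX DY e; rewrite -(rankK hv DX) e (rankK hv DY). Qed.

Lemma bounded_nonneg_shift D : bounded_space (fst @` D) -> exists v, nonneg_shift v D.
Proof.
move=> [M hM]; exists [tuple (M : measurableTypeR R) | j < d] => X DX i.
have /(_ i) := hM X.1 (ex_intro2 _ _ X DX erefl).
by rewrite tnth_mktuple ler_norml => /andP[]; rewrite -subr_ge0 opprK.
Qed.

End interleaving.

(** * The reference measure: finite on bounded sets, and diffuse *)

Section reference_measure.
Variable R : realType.

Definition cube d (n : nat) : set (position d R) := [set x | forall i, `|tnth x i : R| <= n%:R].

Lemma measurable_cube d n : measurable (@cube d n).
Proof.
rewrite (_ : cube _ = \bigcap_(i in [set: 'I_d]) 
      (fun x : position d R => tnth x i) @^-1` `[- n%:R, n%:R]%classic).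
  apply: fin_bigcap_measurable => // i _.
  rewrite -[X in measurable X]setTI.
  by apply: (measurable_tnth i measurableT).
by apply/seteqP; split => [x h i _|x h i] /=; last have := h i I; rewrite /= in_itv/= -ler_norml.
Qed.

Lemma cube_cover d : \bigcup_n @cube d n = setT.
Proof.
apply/seteqP; split=> // x _; exists (\sum_(i < d) (absz (Num.floor `|tnth x i : R|)).+1)%N => //= i.
apply: (@le_trans _ _ (absz (Num.floor `|tnth x i : R|)).+1%:R); last first.
  by rewrite ler_nat (bigD1 i)//= leq_addr.
apply: ltW; have := floorD1_gt `|tnth x i : R|.
by rewrite -[(absz _).+1%:R]natr1 natr_absz [X in _ < X%:~R + _]ger0_norm ?floor_ge0// intrD.
Qed.

Lemma cube_sigma_finite d (m : {measure set (position d R) -> \bar R}) :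
  (forall n, (m (cube n) < +oo)%E) -> sigma_finite setT m.
Proof.
move=> mc; exists (@cube d); first by rewrite cube_cover.
by move=> n; split => //; exact: measurable_cube.
Qed.

Lemma measurable_position1 d (x : position d R) : measurable [set x].
Proof.
rewrite (_ : [set x] = \bigcap_(i in [set: 'I_d]) [set y : position d R | tnth y i = tnth x i]).
  apply: fin_bigcap_measurable => // i _.
  rewrite -[X in measurable X]setTI.
  exact: (measurable_tnth i measurableT (measurable_set1 (tnth x i))).
by apply/seteqP; split => [y -> //|y h]; apply: eq_from_tnth => i; exact: h.
Qed.

Definition cons_position d (p : measurableTypeR R * position d R) : position d.+1 R :=
  cons_tuple p.1 p.2.

Lemma measurable_cons_position d : measurable_fun setT (@cons_position d).
Proof. exact: (measurable_cons measurable_fst measurable_snd). Qed.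

(** Finiteness on cubes is carried through the induction because it gives the sigma-finiteness that
    the next product measure requires. Points are null as soon as one coordinate follows Lebesgue
    measure, but not in dimension 0, where the measure is a Dirac mass. *)
Lemma lebesgue_space_measure d : exists m : {sigma_finite_measure set (position d R) -> \bar R},
  [/\ @lebesgue_space R d = m, forall n, (m (cube n) < +oo)%E &
    (0 < d)%N -> forall x, m [set x] = 0%E].
Proof.
elim: d => [|d [m [mE mc _]]].
  exists [the {sigma_finite_measure set (position 0 R) -> \bar R} of @dirac _ (position 0 R) [tuple] R].
  by split => // n; rewrite /= diracE ltry.
pose pm : {measure set (measurableTypeR R * position d R) -> \bar R} := (@lebesgue_measure R \x m)%E.
pose mu := image_measure pm (@measurable_cons_position d).
have muc n : (mu (cube n) < +oo)%E.
  rewrite /= /pushforward (_ : _ @^-1` _ = `[- n%:R, n%:R]%classic `*` cube n).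
    rewrite product_measure1E//; last exact: measurable_cube.
    by rewrite lte_mul_pinfty//= lebesgue_measure_itv/=; case: ifP.
  apply/seteqP; split => -[a x] /= h.
    split; first by have := h ord0; rewrite in_itv/= -ler_norml tnth0.
    by move=> i; have := h (lift ord0 i); rewrite tnthS.
  move=> i; case: (unliftP ord0 i) => [j ->|->]; rewrite ?tnthS ?tnth0; first exact: h.2.
  by have := h.1; rewrite in_itv/= -ler_norml.
exists (mksigma_finite (cube_sigma_finite muc)); split => //.
  by apply/funext => A; rewrite /= mE.
move=> _ x; rewrite /= /pushforward.
rewrite (_ : _ @^-1` _ = [set thead x] `*` [set [tuple of behead x]]).
  rewrite product_measure1E//; last exact: measurable_position1.
  by rewrite /= lebesgue_measure_set1 mul0e.
apply/seteqP; split => -[a y] /= => [<-|[-> ->]].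
  by rewrite theadE; split => //; apply: val_inj.
by rewrite [RHS]tuple_eta; exact: val_inj.
Qed.

Lemma measurable_mark1 (u : mark R) : measurable [set u].
Proof.
exists [set mark_val u]; first exact: measurable_set1.
by rewrite setTI; apply/seteqP; split=> [x /= /mark_val_inj ->|x /= ->].
Qed.

Lemma set1X (S T : Type) (x : S) (u : T) : [set (x, u)] = [set x] `*` [set u].
Proof. by apply/seteqP; split => [_ ->//|[y w] /= [-> ->]]. Qed.

Lemma measurable_marked1 d (X : marked d R) : measurable [set X].
Proof.
case: X => x u; rewrite set1X; apply: measurableX.
  exact: measurable_position1.
exact: measurable_mark1.
Qed.

(** Only the position factor makes [Qstar] diffuse, since [Q] may have atoms; hence the restriction
    to positive dimension. *)
Lemma Qstar_measure d (Q : probability (mark R) R) :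
  exists m : {measure set (marked d R) -> \bar R},
  [/\ @Qstar R d Q = m, forall D, Sbp D -> (m D < +oo)%E &
    (0 < d)%N -> forall X, m [set X] = 0%E].
Proof.
have [m [mE mc m1]] := lebesgue_space_measure d.
pose pm : {measure set (marked d R) -> \bar R} := (m \x Q)%E.
exists pm; split.
- by rewrite /Qstar mE.
- move=> D [mD [M hM]]; pose n := (absz (Num.floor `|M|)).+1.
  apply: (@le_lt_trans _ _ (pm (cube n `*` [set: mark R]))).
    apply: le_measure; rewrite ?inE//.
      by apply: measurableX => //; exact: measurable_cube.
    move=> X DX; split => //= i.
    apply: (le_trans (hM _ _ i)); first by exists X.
    apply: (le_trans (ler_norm _)); apply: ltW; have := floorD1_gt `|M|.
    by rewrite /n -[(absz _).+1%:R]natr1 natr_absz [X in _ < X%:~R + _]ger0_norm ?floor_ge0// intrD.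
  rewrite /= product_measure1E//; last exact: measurable_cube.
  apply: lte_mul_pinfty; rewrite ?ge0_fin_numE ?mc//.
  by apply: (@le_lt_trans _ _ 1%E); [exact: probability_le1|exact: ltry].
- move=> d0 [x u]; rewrite set1X /= product_measure1E//; last exact: measurable_mark1.
    by transitivity (0 * Q [set u])%E; [congr (_ * _)%E; exact: m1|exact: mul0e].
  exact: measurable_position1.
Qed.

End reference_measure.

From mathcomp Require Import finmap.
Import Order.TTheory GRing.Theory Num.Theory.
Import numFieldNormedType.Exports.
Local Open Scope classical_set_scope.
Local Open Scope ring_scope.

(** * Cardinality of finite sets through rational thresholds *)

Section finite_sets.
Variables (R : realType) (T : choiceType).
Implicit Types (X Y : set T) (f : T -> R).

Definition ncard X : nat := #|` fset_set X|.

Lemma counting_ncard X : finite_set X -> counting X = (ncard X)%:R%:E :> \bar R.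
Proof. by move=> fX; rewrite /counting asboolT. Qed.

Lemma ncard0 : ncard set0 = 0%N.
Proof. by rewrite /ncard fset_set0 cardfs0. Qed.

Lemma ncard_eq0 X : finite_set X -> ncard X = 0%N -> X = set0.
Proof. by move=> fX /eqP; rewrite cardfs_eq0 => /eqP /fset_set_set0; exact. Qed.

Lemma ncard1 x : ncard [set x] = 1%N.
Proof. by rewrite /ncard fset_set1 cardfs1. Qed.

Lemma ncardU X Y : finite_set X -> finite_set Y -> X `&` Y = set0 ->
  ncard (X `|` Y) = (ncard X + ncard Y)%N.
Proof.
move=> fX fY XY; rewrite /ncard fset_setU// cardfsU -fset_setI// XY fset_set0.
by rewrite cardfs0 subn0.
Qed.

Lemma ncardU1 X x : finite_set X -> ~ X x -> ncard (X `|` [set x]) = (ncard X).+1.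
Proof.
move=> fX Xx; rewrite ncardU// ?ncard1 ?addn1//.
by apply/seteqP; split => // y [Xy yx]; apply: Xx; rewrite -yx.
Qed.

Lemma ncard_split X Y : finite_set X -> ncard X = (ncard (X `&` Y) + ncard (X `&` ~` Y))%N.
Proof.
move=> fX; rewrite -ncardU -?setIUr ?setUv ?setIT//.
- by apply: sub_finite_set fX; exact: subIsetl.
- by apply: sub_finite_set fX; exact: subIsetl.
- by rewrite setIACA setICr setI0.
Qed.

Lemma le_ncard X Y : finite_set Y -> X `<=` Y -> (ncard X <= ncard Y)%N.
Proof. by move=> fY XY; rewrite (ncard_split X fY) (setIidr XY) leq_addr. Qed.

Lemma finite_set_max f X : finite_set X -> X !=set0 ->
  exists2 x, X x & forall y, X y -> f y <= f x.
Proof.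
move=> /finite_seqP[s ->]; elim: s => [|a s ih]; first by case=> x.
move=> _; have [s0|s0] := pselect ([set` s] !=set0).
  have [x xs hx] := ih s0; have [xa|ax] := leP (f x) (f a).
    exists a; rewrite /= ?mem_head// => y; rewrite inE => /orP[/eqP ->//|ys].
    exact: le_trans (hx _ ys) xa.
  exists x; rewrite /= ?inE ?xs ?orbT// => y; rewrite inE => /orP[/eqP ->|ys].
    exact: ltW.
  exact: hx.
exists a; rewrite /= ?mem_head// => y; rewrite inE => /orP[/eqP ->//|ys].
by exfalso; apply: s0; exists y.
Qed.

Lemma finite_set_lt f X r : finite_set X -> (forall x, X x -> f x < r) ->
  exists2 q : rat, ratr q < r & forall x, X x -> f x < ratr q.
Proof.
move=> fX h; have [X0|X0] := pselect (X !=set0).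
  have [x Xx hx] := finite_set_max f fX X0.
  have [q /itvP qx] := rat_in_itvoo (h _ Xx); exists q; rewrite ?qx// => y /hx /le_lt_trans; apply.
  by rewrite qx.
have r1 : r - 1 < r by rewrite ltrBlDr ltrDl.
have [q /itvP qx] := rat_in_itvoo r1; exists q; rewrite ?qx// => y Xy.
by exfalso; apply: X0; exists y.
Qed.

Lemma finite_set_le_lt f X r : finite_set X -> (forall x, X x -> r < f x) ->
  exists2 q : rat, r < ratr q & forall x, X x -> ratr q < f x.
Proof.
move=> fX h.
have h' x : X x -> - f x < - r by move=> Xx; rewrite ltrN2 h.
have [q qr hq] := finite_set_lt fX h'; exists (- q); rewrite rmorphN/=; first by rewrite ltrNr.
by move=> x /hq; rewrite ltrNl.
Qed.

(** The threshold [q] is put below the largest value of [f] and above all the others. Having [k.+1]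
    points is thus expressed by countably many conditions on fewer points, which drives the
    induction in [measurable_config]. *)
Lemma ncard_geS f X k : finite_set X -> {in X &, injective f} ->
  (k.+1 <= ncard X)%N <->
  exists q : rat, (k <= ncard (X `&` [set x | (f x < ratr q)%R]))%N /\
                  X `&` [set x | ratr q <= f x] !=set0.
Proof.
move=> fX finj; have fXI Y : finite_set (X `&` Y).
  by apply: sub_finite_set fX; exact: subIsetl.
split.
  move=> kX; have X0 : X !=set0.
    by apply/set0P; apply: contraTneq kX => ->; rewrite ncard0.
  have [x Xx hx] := finite_set_max f fX X0.
  have [||q qx hq] := @finite_set_lt f (X `\ x) (f x); first exact: finite_setD.
    move=> y [Xy yx]; rewrite lt_neqAle hx// andbT; apply/eqP => fyx.
    by apply: yx; exact: finj (mem_set Xy) (mem_set Xx) fyx.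
  exists q; split; last by exists x; split => //=; exact: ltW.
  rewrite -ltnS; apply: (leq_trans kX); rewrite -(ncardU1 (x := x))//; last first.
    by move=> [_ /=]; rewrite ltNge (ltW qx).
  apply: le_ncard; first by rewrite finite_setU; split.
  move=> y Xy; have [->|yx] := pselect (y = x); first by right.
  by left; split => //; exact: hq.
move=> [q [kq [y [Xy qy]]]].
rewrite (ncard_split [set x | f x < ratr q] fX) -addn1 leq_add// lt0n.
apply/eqP => /(ncard_eq0 (fXI _)) /seteqP[/(_ y) h _]; apply: h; split => //=.
by apply/negP; rewrite -leNgt.
Qed.

End finite_sets.

(** * Void events generate the sigma-algebra of configurations *)

Section configurations.
Variables (R : realType) (d : nat).
Implicit Types (A D : set (marked d R)) (w : config R d).

Lemma config_ext (w1 w2 : config0 R d) : pts w1 = pts w2 -> w1 = w2.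
Proof.
case: w1 w2 => [p1 h1] [p2 h2] /= e; move: h1 h2; rewrite e => h1 h2.
by congr Config; exact: Prop_irrelevance.
Qed.

Definition void A : set (config R d) := [set w | pts w `&` A = set0].

Lemma bounded_config_finite w A : bounded_space (fst @` A) -> finite_set (pts w `&` A).
Proof.
move=> /(config_finite w); apply: sub_finite_set; apply: setIS => X AX.
by split => //; exists X.
Qed.

Lemma SbpS A D : Sbp D -> measurable A -> A `<=` D -> Sbp A.
Proof.
move=> [_ [M hM]] mA AD; split => //; exists M => x [X /AD DX <-].
by apply: hM; exists X.
Qed.

Lemma SbpI A D : Sbp D -> measurable A -> Sbp (A `&` D).
Proof.
move=> bD mA; apply: (SbpS bD); first exact: measurableI (bD.1).
exact: subIsetr.
Qed.

Lemma Sbp0 : Sbp (set0 : set (marked d R)).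
Proof. by split => //; exists 0 => x [X]. Qed.

Lemma SbpU A D : Sbp A -> Sbp D -> Sbp (A `|` D).
Proof.
move=> [mA [M hM]] [mD [N hN]]; split; first exact: measurableU.
exists (Num.max M N) => x [X [AX|DX] <-] i; rewrite le_max.
  by rewrite hM//; exists X.
by rewrite hN ?orbT//; exists X.
Qed.

Lemma count_void w A : bounded_space (fst @` A) -> count_points A w = 0%E <-> void A w.
Proof.
move=> bA; have fA := bounded_config_finite w bA.
rewrite /count_points counting_ncard// /void /=; split => [[]/eqP|->]; last by rewrite ncard0.
by rewrite pnatr_eq0 => /eqP /(ncard_eq0 fA).
Qed.

(** Unlike the counting events, these are stable under intersection, so a finite measure is
    determined by its values on them. *)
Definition void_events : set (set (config R d)) := [set U | exists A, Sbp A /\ U = void A].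

Lemma void_events_setI : setI_closed void_events.
Proof.
move=> _ _ [A [bA ->]] [B [bB ->]]; exists (A `|` B); split; first exact: SbpU.
by apply/seteqP; split => w; rewrite /void /= setIUr; [move=> [-> ->]; rewrite setU0|
  move/seteqP => -[h _]; split; apply/seteqP; split => // x hx; apply: h; [left|right]].
Qed.

(** A counting event is a difference of two events bounding the count from below. The latter are
    built by induction on the bound: the region is cut at a rational rank, with [k] points below the
    cut and a nonempty part above. *)
Lemma measurable_config : @measurable _ (config R d) = <<s void_events >>.
Proof.
apply/seteqP; split; last first.
  apply: smallest_sub; first exact: sigma_algebra_measurable.
  move=> _ [A [bA ->]]; apply: sub_sigma_algebra; exists A, 0%N; split => //.
  by apply/seteqP; split => w /= /(count_void w bA.2).
apply: smallest_sub; first exact: smallest_sigma_algebra.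
pose T' := g_sigma_algebraType void_events.
suff mge A k : Sbp A -> measurable ([set w | (k <= ncard (pts w `&` A))%N] : set T').
  move=> _ [A [n [bA ->]]].
  rewrite (_ : mkset _ = [set w | (n <= ncard (pts w `&` A))%N] `\`
                         [set w | (n.+1 <= ncard (pts w `&` A))%N]).
    exact: (@measurableD _ T' _ _ (mge A n bA) (mge A n.+1 bA)).
  apply/seteqP; split => w /=; rewrite /count_points (counting_ncard _ (bounded_config_finite w bA.2)).
    by move=> [/eqP]; rewrite eqr_nat => /eqP ->; rewrite leqnn ltnn.
  by move=> [h1 /negP]; rewrite -leqNgt => h2; congr (_%:R%:E); apply/eqP; rewrite eqn_leq h1 h2.
elim: k A => [|k ih] A bA.
  have -> : [set w : config R d | (0 <= ncard (pts w `&` A))%N] = setT by apply/seteqP; split.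
  exact: (@measurableT _ T').
have [v hv] := bounded_nonneg_shift bA.2.
have mI (q : rat) : measurable [set X | (rank v X < ratr q)%R].
  rewrite -[X in measurable X]setTI (_ : [set X | _] = rank v @^-1` `]-oo, ratr q[%classic).
    exact: measurable_rank.
  by apply/seteqP; split=> X; rewrite /= in_itv.
rewrite (_ : mkset _ = \bigcup_(q : rat)
    ([set w | (k <= ncard (pts w `&` (A `&` [set X | (rank v X < ratr q)%R])))%N] `\`
     void (A `&` [set X | ratr q <= rank v X]))).
  apply: (@countable_bigcupT_measurable _ T') => // q.
  apply: (@measurableD _ T'); first by apply: ih; rewrite setIC; exact: SbpI.
  apply: sub_sigma_algebra; exists (A `&` [set X | ratr q <= rank v X]); split => //.
  rewrite setIC; apply: SbpI => //; rewrite (_ : mkset _ = ~` [set X | (rank v X < ratr q)%R]).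
    exact: measurableC.
  by apply/seteqP; split => X /=; rewrite leNgt => /negP.
have finj w : {in pts w `&` A &, injective (rank v)}.
  by move=> X Y /set_mem[_ AX] /set_mem[_ AY]; exact: rank_inj hv AX AY.
apply/seteqP; split => w /=.
  move=> /(ncard_geS k (bounded_config_finite w bA.2) (finj w))[q [h1 h2]].
  exists q => //; split; first by rewrite /= setIA.
  by rewrite /void /= setIA; apply/eqP/set0P.
move=> [q _ [h1]] /eqP/set0P; rewrite setIA => h2.
by apply/(ncard_geS k (bounded_config_finite w bA.2) (finj w)); exists q; rewrite -[X in ncard X]setIA.
Qed.

(** Unbounded sets give no generators, but a configuration avoids a set as soon as it avoids its
    trace on every cube. *)
Lemma measurable_void A : measurable A -> measurable (void A).
Proof.
move=> mA; rewrite (_ : void A = \bigcap_n void (A `&` cube n `*` setT)).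
  apply: bigcapT_measurable => n; rewrite measurable_config; apply: sub_sigma_algebra.
  exists (A `&` cube n `*` setT); split => //; split.
    by apply: measurableI => //; apply: measurableX => //; exact: measurable_cube.
  by exists n%:R => x [X [_ [/= h _]] <-].
apply/seteqP; split => [w h n _|w h].
  by apply/seteqP; split => // X [wX [AX _]]; rewrite -h; split.
apply/seteqP; split => // X [wX AX].
have [n _ Xn] : (\bigcup_n cube n) X.1 by rewrite cube_cover.
by have /seteqP[h' _] := h n I; apply: (h' X); split.
Qed.

Lemma measurable_fun_void d' (T : measurableType d') (f : T -> config R d) :
  (forall A, Sbp A -> measurable (f @^-1` void A)) -> measurable_fun setT f.
Proof.
move=> h; apply: (measurability _ measurable_config) => _ [_ [A [bA ->]] <-].
by rewrite setTI; exact: h.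
Qed.

End configurations.

Lemma countable_bigcapT_measurable d (T : measurableType d) (U : Type) (F : U -> set T) :
  countable [set: U] -> (forall i, measurable (F i)) -> measurable (\bigcap_i F i).
Proof.
move=> cU mF; rewrite -[X in measurable X]setCK setC_bigcap; apply: measurableC.
by apply: countable_bigcupT_measurable => // i; exact: measurableC.
Qed.

Section configuration_maps.
Variables (R : realType) (d : nat).
Implicit Types (A D : set (marked d R)) (w : config R d).

Definition cunion (p : config R d * config R d) : config R d := config_union p.1 p.2.

Lemma measurable_cunion : measurable_fun setT cunion.
Proof.
apply: measurable_fun_void => A [mA _].
rewrite (_ : _ @^-1` _ = (void A) `*` (void A)).
  by apply: measurableX; exact: measurable_void.
apply/seteqP; split => -[w1 w2] /=; rewrite /void /= setIUl.
  by move/seteqP => -[h _]; split; apply/seteqP; split => // x hx; apply: h; [left|right].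
by move=> [-> ->]; rewrite setU0.
Qed.

Definition csingle (X : marked d R) : config R d := config_single X.

Lemma measurable_csingle : measurable_fun setT csingle.
Proof.
apply: measurable_fun_void => A [mA _].
rewrite (_ : _ @^-1` _ = ~` A); first exact: measurableC.
apply/seteqP; split => X /=; rewrite /void /=.
  by move=> /seteqP[h _] AX; apply: (h X).
by move=> h; apply/seteqP; split => // _ [->].
Qed.

Definition crestrict A w : config R d := config_restrict w A.

Lemma measurable_config_in D : measurable D -> measurable (config_in D).
Proof.
move=> mD; rewrite (_ : config_in D = void (~` D)).
  by apply: measurable_void; exact: measurableC.
by apply/seteqP; split => w; rewrite /config_in /void /= ?disjoints_subset setCK.
Qed.

Lemma measurable_ncard A k : Sbp A -> measurable [set w : config R d | ncard (pts w `&` A) = k].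
Proof.
move=> bA; apply: sub_sigma_algebra; exists A, k; split => //.
apply/seteqP; split => w /=; rewrite /count_points (counting_ncard _ (bounded_config_finite w bA.2)).
  by move=> ->.
by move=> [] /eqP; rewrite eqr_nat => /eqP.
Qed.

Definition config_seq (s : seq (marked d R)) : config R d.
Proof.
by refine (@Config R d [set` s] _) => L _; apply: (sub_finite_set _ (finite_seq s)); exact: subIsetl.
Defined.

End configuration_maps.

(** * Enumeration of the points of a configuration by increasing rank *)

Section enumeration.
Variables (R : realType) (d : nat) (D : set (marked d R)) (bD : Sbp D).
Variables (v : position d R) (hv : nonneg_shift v D).
Local Notation rk := (rank v).
Local Notation config := (config R d).
Implicit Types (A : set (marked d R)) (w : config).

Lemma measurable_below t : measurable [set X | rk X < t].
Proof.
rewrite -[X in measurable X]setTI (_ : [set X | _] = rk @^-1` `]-oo, t[%classic).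
  exact: measurable_rank.
by apply/seteqP; split=> X; rewrite /= in_itv.
Qed.

Lemma measurable_above t : measurable [set X | t < rk X].
Proof.
rewrite -[X in measurable X]setTI (_ : [set X | _] = rk @^-1` `]t, +oo[%classic).
  exact: measurable_rank.
by apply/seteqP; split=> X; rewrite /= in_itv/= andbT.
Qed.

Lemma measurable_atleast t : measurable [set X | t <= rk X].
Proof.
rewrite -[X in measurable X]setTI (_ : [set X | _] = rk @^-1` `[t, +oo[%classic).
  exact: measurable_rank.
by apply/seteqP; split=> X; rewrite /= in_itv/= andbT.
Qed.

Definition below t w : config := crestrict (D `&` [set X | rk X < t]) w.

(** Because ranks are compared strictly, a point of [A] below [t] is also below some rational
    [q <= t]. The event becomes a countable combination of rectangles in the level and the
    configuration. *)
Lemma measurable_below_fun : measurable_fun setT (fun p : R * config => below p.1 p.2).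
Proof.
apply: measurable_fun_void => A [mA _].
rewrite (_ : _ @^-1` _ = \bigcap_(q : rat)
   ((`]-oo, ratr q[%classic `*` setT) `|`
    (setT `*` void (A `&` D `&` [set X | rk X < ratr q])))).
  apply: countable_bigcapT_measurable => // q; apply: measurableU.
    by apply: measurableX => //; exact: measurable_itv.
  apply: measurableX => //; apply: measurable_void; apply: measurableI.
    by apply: measurableI => //; exact: bD.1.
  exact: measurable_below.
apply/seteqP; split => -[t w] /=; rewrite /void /=.
  move=> /seteqP[h _] q _; have [tq|qt] := ltP t (ratr q).
    by left; rewrite /= in_itv.
  right; split => //; apply/seteqP; split => // X [wX [[AX DX] Xq]].
  by apply: (h X); split => //; split => //; split => //; exact: lt_le_trans Xq qt.
move=> h; apply/seteqP; split => // X [[wX [DX Xt]] AX].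
have [q /itvP qx] := rat_in_itvoo Xt.
have [[/= qt _]|[_ /seteqP[h' _]]] := h q I.
  by rewrite in_itv/= ltNge (ltW _) ?qx in qt.
by apply: (h' X); split => //; split => //; rewrite /= qx.
Qed.

Definition points w : seq (marked d R) :=
  sort (fun X Y => rk X <= rk Y) (fset_set (pts w `&` D)).

Lemma finite_configD w : finite_set (pts w `&` D).
Proof. exact: bounded_config_finite bD.2. Qed.

Lemma mem_points w X : X \in points w <-> pts w X /\ D X.
Proof.
rewrite mem_sort in_fset_set; last exact: finite_configD.
by split=> [/set_mem|?]; [|apply/mem_set].
Qed.

Lemma points_uniq w : uniq (points w).
Proof. by rewrite sort_uniq; exact: fset_uniq. Qed.

Lemma size_points w : size (points w) = ncard (pts w `&` D).
Proof. by rewrite size_sort. Qed.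

Lemma points_sorted w : sorted (fun X Y => rk X <= rk Y) (points w).
Proof. by apply: sort_sorted => X Y; exact: le_total. Qed.

Definition kth (k : nat) w : marked d R := nth point (points w) k.

Lemma kth_lt w i j : (i < j < size (points w))%N -> rk (kth i w) < rk (kth j w).
Proof.
move=> /andP[ij js]; have is_ := ltn_trans ij js.
rewrite lt_neqAle; apply/andP; split.
  apply/eqP => e; have /mem_points[_ Di] := mem_nth point is_.
  have /mem_points[_ Dj] := mem_nth point js.
  move: (rank_inj hv Di Dj e) => /eqP; rewrite nth_uniq ?points_uniq// => /eqP eij.
  by rewrite eij ltnn in ij.
have trr : transitive (fun X Y : marked d R => rk X <= rk Y) by move=> Y X Z; exact: le_trans.
by apply: (sorted_ltn_nth trr point (points_sorted w)).
Qed.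

Lemma ncard_seq (T : choiceType) (s : seq T) : uniq s -> ncard [set` s] = size s.
Proof.
move=> us; apply: perm_size; apply: uniq_perm => // x.
by rewrite in_fset_set ?finite_seq//; apply/idP/idP => [/set_mem|/mem_set].
Qed.

Lemma ncard_below w t k : (k <= size (points w))%N ->
  (forall i, (i < k)%N -> rk (kth i w) < t) ->
  (forall i, (k <= i < size (points w))%N -> t <= rk (kth i w)) ->
  ncard (pts w `&` (D `&` [set X | rk X < t])) = k.
Proof.
move=> ks h1 h2; rewrite (_ : _ `&` _ = [set` take k (points w)]).
  by rewrite ncard_seq ?take_uniq ?points_uniq// size_takel.
apply/seteqP; split => X /=.
  move=> [wX [DX Xt]]; have Xs : X \in points w by apply/mem_points.
  have is_ : (index X (points w) < size (points w))%N by rewrite index_mem.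
  have ik : (index X (points w) < k)%N.
    rewrite ltnNge; apply/negP => ki.
    by have := h2 (index X (points w)); rewrite ki is_ /kth nth_index// leNgt Xt => /(_ isT).
  by rewrite -(nth_index point Xs) -(nth_take _ ik) mem_nth// size_takel.
move=> Xk; have ik : (index X (take k (points w)) < k)%N by rewrite -{2}(size_takel ks) index_mem.
have XE : X = kth (index X (take k (points w))) w by rewrite /kth -(nth_take _ ik) nth_index.
have /mem_points[wX DX] := mem_take Xk.
by split => //; split => //; rewrite /= XE h1.
Qed.

(* The k-th point lies in a rank interval [q, q'[ which contains no other point. *)
Lemma kth_inP A w k : A `<=` D ->
  (k < size (points w))%N /\ A (kth k w) <->
  exists q q' : rat, [/\ ratr q < ratr q' :> R,
    ncard (pts w `&` (D `&` [set X | rk X < ratr q])) = k,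
    ncard (pts w `&` (D `&` [set X | rk X < ratr q'])) = k.+1 &
    pts w `&` (A `&` ([set X | rk X < ratr q'] `&` [set X | ratr q <= rk X])) !=set0].
Proof.
move=> AD; split.
  move=> [ks Ak]; have /mem_points[wk Dk] := mem_nth point ks.
  have [||q qk hq] := @finite_set_lt _ _ rk (pts w `&` (D `&` [set X | rk X < rk (kth k w)])) (rk (kth k w)).
    by apply: sub_finite_set (finite_configD w); apply: setIS; exact: subIsetl.
    by move=> X [_ []].
  have [||q' qk' hq'] := @finite_set_le_lt _ _ rk (pts w `&` (D `&` [set X | rk (kth k w) < rk X])) (rk (kth k w)).
    by apply: sub_finite_set (finite_configD w); apply: setIS; exact: subIsetl.
    by move=> X [_ []].
  exists q, q'; split.
  - exact: lt_trans qk qk'.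
  - apply: ncard_below; first exact: ltnW.
      move=> i ik; have is_ := ltn_trans ik ks.
      have /mem_points[wi Di] := mem_nth point is_.
      by apply: hq; split => //; split => //; apply: kth_lt; rewrite ik.
    move=> i /andP[]; rewrite leq_eqVlt => /orP[/eqP <- _|ki is_]; first exact: ltW.
    by apply/ltW/(lt_trans qk); apply: kth_lt; rewrite ki.
  - apply: ncard_below => // i.
      rewrite ltnS leq_eqVlt => /orP[/eqP -> //|ik].
      by apply: lt_trans qk'; apply: kth_lt; rewrite ik.
    move=> /andP[ki is_]; have /mem_points[wi Di] := mem_nth point is_.
    by apply/ltW/hq'; split => //; split => //; apply: kth_lt; rewrite ki.
  - by exists (kth k w); split => //; split => //; split => //=; exact: ltW.
move=> [q [q' [qq' hq hq' [X [wX [AX [/= Xq' qX]]]]]]].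
have DX := AD _ AX; have Xs : X \in points w by apply/mem_points.
have is_ : (index X (points w) < size (points w))%N by rewrite index_mem.
suff XE : index X (points w) = k by rewrite -XE /kth nth_index.
set j := index X (points w).
have rX : rk (kth j w) = rk X by rewrite /kth nth_index.
have mono i : (i < size (points w))%N -> (i <= j)%N = (rk (kth i w) <= rk X).
  move=> i_s; rewrite -rX; case: (ltngtP i j) => ij; last by rewrite ij lexx.
    by rewrite ltW// kth_lt// ij.
  by rewrite leNgt kth_lt// ij.
have js (i : nat) : (i <= j)%N -> (i < size (points w))%N by move=> /leq_ltn_trans; apply.
have fI B : finite_set (pts w `&` (D `&` B)).
  by apply: sub_finite_set (finite_configD w); apply: setIS; exact: subIsetl.
apply/eqP; rewrite eqn_leq; apply/andP; split.
  rewrite -ltnS -hq' -[j.+1](@size_takel _ _ (points w))// -ncard_seq ?take_uniq ?points_uniq//.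
  apply: le_ncard => // Y Yj; have /mem_points[wY DY] := mem_take Yj.
  have ij : (index Y (take j.+1 (points w)) <= j)%N by rewrite -ltnS -[X in (_ < X)%N](@size_takel j.+1 _ (points w))// index_mem.
  have YE : Y = kth (index Y (take j.+1 (points w))) w by rewrite /kth -(@nth_take j.+1)// nth_index.
  split => //; split => //=; rewrite YE; apply: le_lt_trans Xq'; rewrite -mono//; exact: js.
rewrite -hq -[X in (_ <= X)%N](@size_takel j _ (points w)) ?(ltnW is_)//.
rewrite -ncard_seq ?take_uniq ?points_uniq//.
apply: le_ncard; first exact: finite_seq.
move=> Y [wY [DY Yq]]; have Ys : Y \in points w by apply/mem_points.
have iY : (index Y (points w) < size (points w))%N by rewrite index_mem.
have ij : (index Y (points w) < j)%N.
  rewrite ltnNge leq_eqVlt negb_or; apply/andP; split.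
    apply/eqP => e; move: Yq => /=; rewrite ltNge -(nth_index point Ys) -e.
    by rewrite -/(kth j w) rX qX.
  apply/negP => ji; move: Yq => /=; rewrite ltNge => /negP; apply.
  apply: (le_trans qX); rewrite -rX -(nth_index point Ys); apply/ltW/kth_lt.
  by rewrite ji.
by rewrite /= -(nth_index point Ys) -(nth_take point ij) mem_nth// size_takel// ltnW.
Qed.

Lemma measurable_size_points k : measurable [set w : config | size (points w) = k].
Proof. by under eq_set do rewrite size_points; exact: measurable_ncard. Qed.

Lemma measurable_size_gt k : measurable [set w : config | (k < size (points w))%N].
Proof.
rewrite (_ : mkset _ = ~` \bigcup_(i in `I_k.+1) [set w : config | size (points w) = i]).
  apply: measurableC; apply: bigcup_measurable => i _; exact: measurable_size_points.
apply/seteqP; split => w /=.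
  by move=> h [i /= ik wi]; rewrite wi ltnNge -ltnS ik in h.
by move=> h; rewrite ltnNge; apply/negP => sk; apply: h; exists (size (points w)).
Qed.

Lemma measurable_kth k : measurable_fun setT (kth k).
Proof.
move=> _ A mA; rewrite setTI.
(* Beyond the last point [kth] returns the default [point], which may belong to [A]; the second
   event accounts for this. *)
rewrite (_ : kth k @^-1` A = [set w | (k < size (points w))%N /\ (A `&` D) (kth k w)] `|`
   (~` [set w : config | (k < size (points w))%N] `&` [set w | A point])).
  apply: measurableU; last first.
    apply: measurableI; first by apply: measurableC; exact: measurable_size_gt.
    have [Ap|Ap] := pselect (A point).
      by rewrite (_ : [set w | _] = setT)//; apply/seteqP; split.
    by rewrite (_ : [set w | _] = set0)//; apply/seteqP; split.
  have AD : A `&` D `<=` D by exact: subIsetr.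
  under eq_set do rewrite (propext (kth_inP _ k AD)).
  rewrite (_ : mkset _ = \bigcup_(q : rat) \bigcup_(q' in [set q' : rat | ratr q < ratr q' :> R])
    ([set w : config | ncard (pts w `&` (D `&` [set X | rk X < ratr q])) = k] `&`
     [set w : config | ncard (pts w `&` (D `&` [set X | rk X < ratr q'])) = k.+1] `&`
     ~` void (A `&` D `&` ([set X | rk X < ratr q'] `&` [set X | ratr q <= rk X])))).
    have bI t : Sbp (D `&` [set X | rk X < t]) by rewrite setIC; apply: SbpI => //; exact: measurable_below.
    apply: countable_bigcupT_measurable => // q; rewrite bigcup_mkcond.
    apply: countable_bigcupT_measurable => // q'; case: ifPn => // _.
    apply: measurableI; first by apply: measurableI; exact: measurable_ncard.
    apply: measurableC; apply: measurable_void; apply: measurableI.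
      by apply: measurableI => //; exact: bD.1.
    by apply: measurableI; [exact: measurable_below|exact: measurable_atleast].
  apply/seteqP; split => w /=.
    move=> [q [q' [qq' hq hq' h]]]; exists q => //; exists q' => //; split => //.
    by rewrite /void /=; apply/eqP/set0P.
  move=> [q _ [q' /= qq' [[hq hq'] h]]]; exists q, q'; split => //.
  by apply/set0P/eqP.
apply/seteqP; split => w /=.
  have [ks|ks] := ltnP k (size (points w)).
    by have /mem_points[_ Dk] := mem_nth point ks; left.
  by rewrite /kth nth_default// => Ap; right; split => //; exact/negP.
by move=> [[_ []]//|[/negP]]; rewrite -leqNgt => ks; rewrite /kth nth_default.
Qed.

(** On each stratum the number of points is constant, so products over points and sums over sets of
    indices become operations of fixed arity. *)
Lemma measurable_by_size d' d'' (T : measurableType d') (U : measurableType d'') (f : config * T -> U) :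
  (forall n, measurable_fun ([set w : config | size (points w) = n] `*` setT) f) ->
  measurable_fun setT f.
Proof.
move=> h; rewrite (_ : setT = \bigcup_n ([set w : config | size (points w) = n] `*` [set: T])).
  apply/measurable_fun_bigcup => // n; apply: measurableX => //; exact: measurable_size_points.
by apply/seteqP; split => // p _; exists (size (points p.1)).
Qed.

Lemma measurable_prod_points d' (T : measurableType d') (f : marked d R * T -> R) :
  measurable_fun setT f ->
  measurable_fun setT (fun p : config * T => \prod_(X <- points p.1) f (X, p.2)).
Proof.
move=> mf; apply: measurable_by_size => n.
apply: (eq_measurable_fun (fun p : config * T => \prod_(i <- iota 0 n) f (kth i p.1, p.2))).
  by move=> p /set_mem[/= <- _]; rewrite [RHS](big_nth point) /index_iota subn0.
apply: measurable_prod => i _; apply: measurable_funTS.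
apply: (measurableT_comp mf); apply/measurable_fun_pair => //.
by apply: (measurableT_comp (measurable_kth i)).
Qed.

(** Parts of a configuration are encoded by sets of indices in the enumeration: they range over a
    finite type and depend measurably on the configuration. *)
Definition subconfig n (J : {set 'I_n}) w : config := config_seq [seq kth i w | i : 'I_n in J].

Lemma measurable_subconfig n (J : {set 'I_n}) : measurable_fun setT (subconfig J).
Proof.
apply: measurable_fun_void => A [mA _].
rewrite (_ : _ @^-1` _ = \bigcap_(i in [set i | i \in J]) (kth i @^-1` ~` A)).
  apply: fin_bigcap_measurable; first exact: finite_finset.
  by move=> i _; rewrite -[X in measurable X]setTI; apply: measurable_kth => //; exact: measurableC.
apply/seteqP; split => w; rewrite /void /=.
  move=> /seteqP[h _] i /= iJ Ai; apply: (h (kth i w)); split => //=.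
  by apply/fintype.imageP; exists i.
move=> h; apply/seteqP; split => // X [/= /fintype.imageP[i iJ ->]]; exact: h.
Qed.

End enumeration.

Section fubini.
Local Open Scope ereal_scope.
Context d1 d2 (T1 : measurableType d1) (T2 : measurableType d2) (R : realType).

Lemma measurable_pairl (x : T1) : measurable_fun setT (fun y : T2 => (x, y)).
Proof. by apply/measurable_fun_pair => //; exact: measurable_id. Qed.

Lemma measurable_pairr (y : T2) : measurable_fun setT (fun x : T1 => (x, y)).
Proof. by apply/measurable_fun_pair => //; exact: measurable_id. Qed.

Lemma measurable_integral_snd (m : {sigma_finite_measure set T2 -> \bar R}) (f : T1 * T2 -> \bar R) :
  measurable_fun setT f -> (forall x, 0 <= f x) ->
  measurable_fun setT (fun x => \int[m]_y f (x, y)).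
Proof. by move=> mf f0; exact: measurable_fun_fubini_tonelli_F. Qed.

Lemma integral_cond (m : {measure set T1 -> \bar R}) (D : set T1) (f g : T1 -> \bar R) :
  measurable D -> m (~` D) = 0 ->
  measurable_fun setT f -> measurable_fun setT g -> (forall x, 0 <= f x) -> (forall x, 0 <= g x) ->
  (forall x, D x -> f x = g x) -> \int[m]_x f x = \int[m]_x g x.
Proof.
move=> mD m0 mf mg f0 g0 fg; apply: ge0_ae_eq_integral => //.
exists (~` D); split => //; first exact: measurableC.
by apply: subsetC => x Dx _; exact: fg.
Qed.

Lemma measure_cond (m : {measure set T1 -> \bar R}) (D A B : set T1) :
  measurable D -> m (~` D) = 0 -> measurable A -> measurable B ->
  A `&` D = B `&` D -> m A = m B.
Proof.
move=> mD m0 mA mB AB.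
have h C : measurable C -> m C = m (C `&` D).
  move=> mC; rewrite [LHS](measureDI m mC mD) -[RHS]add0e; congr (_ + _).
  apply/eqP; rewrite eq_le measure_ge0 andbT -m0 le_measure//; apply/mem_set.
    exact: measurableD.
  exact: measurableC.
by rewrite (h A)// (h B)// AB.
Qed.
End fubini.

(** * The unnormalised Poisson measure *)

Section lebesgue_poisson.
Local Open Scope ereal_scope.
Variables (R : realType) (d : nat) (mu : {finite_measure set (marked d R) -> \bar R}).
Local Notation config := (config R d).

Definition add_point (p : config * marked d R) : config := cunion (p.1, csingle p.2).

Lemma measurable_add_point : measurable_fun setT add_point.
Proof.
apply: (measurableT_comp (@measurable_cunion R d)); apply/measurable_fun_pair => //.
by apply: (measurableT_comp (@measurable_csingle R d)).
Qed.

Lemma add_point_measure_lt (m : {finite_measure set config -> \bar R}) :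
  image_measure (m \x mu) measurable_add_point setT < +oo.
Proof.
rewrite /= /pushforward preimage_setT -setXTT product_measure1E// lte_mul_pinfty//.
  by rewrite fin_num_measure.
by rewrite -ge0_fin_numE// fin_num_measure.
Qed.

Definition add_point_measure (m : {finite_measure set config -> \bar R}) :
  {finite_measure set config -> \bar R} := mkfinite (add_point_measure_lt m).

Lemma integral_add_point_measure m (h : config -> \bar R) :
  measurable_fun setT h -> (forall w, 0 <= h w) ->
  \int[add_point_measure m]_w h w = \int[m]_w \int[mu]_x h (add_point (w, x)).
Proof.
move=> mh h0; rewrite ge0_integral_image//; last exact: measurable_add_point.
rewrite [LHS](@fubini_tonelli1 _ _ _ _ _ m mu (h \o add_point))// => [|x]; last exact: h0.
exact: measurableT_comp mh measurable_add_point.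
Qed.

(** The image of the [n]-fold product of [mu] under the map that forgets the order of the points,
    built by adding one point at a time. *)
Definition nth_poisson (n : nat) : {finite_measure set config -> \bar R} :=
  iter n add_point_measure [the {finite_measure set config -> \bar R} of \d_(config_empty R d : config)].

Lemma inv_fact_ge0 n : (0 <= n`!%:R^-1 :> R)%R.
Proof. by rewrite invr_ge0. Qed.

(** For diffuse [mu] this is the Poisson law of intensity [mu] multiplied by the exponential of the
    total mass of [mu]. Dropping the normalisation removes exponential factors from most identities
    below. *)
Definition lebesgue_poisson : {measure set config -> \bar R} :=
  mseries (fun n => mscale (NngNum (inv_fact_ge0 n)) (nth_poisson n)) 0.

Lemma integral_lebesgue_poisson (h : config -> \bar R) :
  measurable_fun setT h -> (forall w, 0 <= h w) ->
  \int[lebesgue_poisson]_w h w =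
  \sum_(0 <= n <oo) ((n`!%:R^-1)%R%:E * \int[nth_poisson n]_w h w).
Proof.
move=> mh h0; rewrite ge0_integral_measure_series//.
by apply: eq_eseriesr => n _; rewrite ge0_integral_mscale.
Qed.

Lemma eseries_exp (c : R) : (0 <= c)%R ->
  \sum_(0 <= n <oo) ((n`!%:R^-1)%R%:E * (c ^+ n)%R%:E) = (expR c)%:E.
Proof.
move=> c0; rewrite expRE -EFin_lim; last first.
  rewrite /pseries/=; under eq_fun do rewrite mulrC.
  exact: is_cvg_series_exp_coeff.
by apply/congr_lim/funext => n/=; rewrite /pseries/= /series/= -sumEFin.
Qed.

Lemma integral_lebesgue_poisson_exp (h : config -> \bar R) (c : R) : (0 <= c)%R ->
  measurable_fun setT h -> (forall w, 0 <= h w) ->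
  (forall n, \int[nth_poisson n]_w h w = (c ^+ n)%R%:E) ->
  \int[lebesgue_poisson]_w h w = (expR c)%:E.
Proof.
move=> c0 mh h0 hn; rewrite integral_lebesgue_poisson// -eseries_exp//.
by apply: eq_eseriesr => n _; rewrite hn.
Qed.

Lemma fin_mu A : measurable A -> mu A = (fine (mu A))%:E.
Proof. by move=> mA; rewrite fineK// fin_num_measure. Qed.

Lemma integral_nth_poisson0 (h : config -> \bar R) : measurable_fun setT h ->
  \int[nth_poisson 0]_w h w = h (config_empty R d).
Proof. by move=> mh; rewrite [LHS]integral_dirac// diracE mem_set// mul1e. Qed.

Lemma integral_nth_poissonS (h : config -> \bar R) n :
  measurable_fun setT h -> (forall w, 0 <= h w) ->
  \int[nth_poisson n.+1]_w h w = \int[nth_poisson n]_w \int[mu]_x h (add_point (w, x)).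
Proof. by move=> mh h0; rewrite /= integral_add_point_measure. Qed.

Lemma void_add_point A w x : void A (add_point (w, x)) <-> void A w /\ ~ A x.
Proof.
rewrite /void /add_point /= setIUl; split.
  move=> /seteqP[h _]; split; last by move=> Ax; apply: (h x); right.
  by apply/seteqP; split => // y hy; apply: (h y); left.
by move=> [-> Ax]; rewrite set0U; apply/seteqP; split => // _ [->].
Qed.

(** Each of the [n] points avoids [A] independently of the others, which contributes one factor
    equal to the mass of the complement. *)
Lemma nth_poisson_void A n : measurable A ->
  nth_poisson n (void A) = (fine (mu (~` A)) ^+ n)%R%:E.
Proof.
move=> mA; have mv := measurable_void mA; have mAC := measurableC mA.
have mi : measurable_fun setT (fun w : config => (\1_(void A) w)%:E : \bar R).
  exact/measurable_EFinP.
have v0 (w : config) : 0 <= (\1_(void A) w)%:E :> \bar R by rewrite lee_fin.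
rewrite -[void A]setIT -integral_indic//; elim: n => [|n ih].
  rewrite integral_nth_poisson0// indicE mem_set// /void /=.
  by rewrite set0I.
rewrite integral_nth_poissonS//.
transitivity (\int[nth_poisson n]_w ((\1_(void A) w)%:E * (fine (mu (~` A)))%:E)).
  apply: eq_integral => w _.
  rewrite -fin_mu// -[X in _ * mu X]setIT -integral_indic//.
  rewrite -ge0_integralZl_EFin//; last by apply/measurable_EFinP.
  apply: eq_integral => x _; rewrite -EFinM !indicE -natrM mulnb; congr (_%:R%:E : \bar R).
  congr nat_of_bool; apply/idP/andP => [/set_mem/void_add_point[h1 h2]|[/set_mem h1 /set_mem h2]].
    by rewrite !mem_set.
  by apply/mem_set/void_add_point.
rewrite ge0_integralZr//; last by rewrite lee_fin fine_ge0.
by rewrite ih -EFinM exprSr.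
Qed.

Lemma lebesgue_poisson_void A : measurable A ->
  lebesgue_poisson (void A) = (expR (fine (mu (~` A))))%:E.
Proof.
move=> mA; have mv := measurable_void mA.
rewrite -[void A]setIT -integral_indic//.
apply: integral_lebesgue_poisson_exp => //.
- by rewrite fine_ge0.
- exact/measurable_EFinP.
- by move=> n; rewrite integral_indic// setIT; exact: nth_poisson_void.
Qed.

Lemma void0 : void set0 = setT :> set config.
Proof. by apply/seteqP; split => // w _; rewrite /void /= setI0. Qed.

Lemma lebesgue_poissonT : lebesgue_poisson setT = (expR (fine (mu setT)))%:E.
Proof. by rewrite -void0 lebesgue_poisson_void// setC0. Qed.

Lemma lebesgue_poisson_lt : lebesgue_poisson setT < +oo.
Proof. by rewrite lebesgue_poissonT ltry. Qed.

Definition LP : {finite_measure set config -> \bar R} := mkfinite lebesgue_poisson_lt.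

Lemma LP_void A : measurable A -> LP (void A) = (expR (fine (mu (~` A))))%:E.
Proof. exact: lebesgue_poisson_void. Qed.

Lemma config_inE D : config_in D = void (~` D) :> set config.
Proof. by apply/seteqP; split => w; rewrite /config_in /void /= ?disjoints_subset setCK. Qed.

(** Uniqueness of measures on a pi-system; the whole space belongs to it, as the void event of the
    empty set. *)
Lemma measure_eq_void (m1 m2 : {measure set config -> \bar R}) :
  (forall A, Sbp A -> m1 (void A) = m2 (void A)) -> m1 setT < +oo ->
  forall E, measurable E -> m1 E = m2 E.
Proof.
move=> h hT; apply: (measure_unique _ (fun=> setT) (@measurable_config R d) (@void_events_setI R d)).
- by move=> _; exists set0; split; [exact: Sbp0|rewrite void0].
- by rewrite bigcup_const.
- by move=> _ [A [bA ->]]; exact: h.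
- by [].
Qed.

End lebesgue_poisson.
Arguments LP : simpl never.

Section carried.
Local Open Scope ereal_scope.
Variables (R : realType) (d : nat) (mu : {finite_measure set (marked d R) -> \bar R}).
Variables (D : set (marked d R)) (mD : measurable D) (muD : mu (~` D) = 0).
Local Notation config := (config R d).
Local Notation LP := (LP mu).

Lemma mu_carrierE : mu D = mu setT.
Proof.
apply: (measure_cond mD muD) => //.
by rewrite setTI setIid.
Qed.

(** The event of having no point outside [D] has mass [exp(mu(D))], which is already the total mass
    because [mu] is carried by [D]. *)
Lemma LP_config_in : LP (~` config_in D) = 0.
Proof.
have mc := measurable_config_in mD.
rewrite -setTD measureD// ?setTI; last exact: lebesgue_poisson_lt.
transitivity (LP setT - LP setT); last by rewrite subee// fin_num_measure.
congr (_ - _); rewrite config_inE [LHS]LP_void; last exact: measurableC.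
by rewrite setCK mu_carrierE; exact/esym/lebesgue_poissonT.
Qed.
End carried.

(** * Product functionals and numbers of points *)

Section poisson_functionals.
Local Open Scope ereal_scope.
Variables (R : realType) (d : nat) (mu : {finite_measure set (marked d R) -> \bar R}).
Variables (D : set (marked d R)) (bD : Sbp D) (muD : mu (~` D) = 0).
Hypothesis mu1 : forall X, mu [set X] = 0.
Variables (v : position d R) (hv : nonneg_shift v D).
Local Notation config := (config R d).
Local Notation points := (points D v).
Implicit Types (f : marked d R -> R) (c : R) (w : config) (n k : nat).
Let mD : measurable D := bD.1.

Lemma diffuse_finite (Y : set (marked d R)) : finite_set Y -> measurable Y /\ mu Y = 0.
Proof.
move=> /finite_seqP[s ->]; elim: s => [|x s [ms h]].
  by rewrite (_ : [set` [::]] = set0) ?measure0//; apply/seteqP; split.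
have -> : [set` x :: s] = [set x] `|` [set` s].
  apply/seteqP; split => y /=; first by rewrite inE => /orP[/eqP ->|]; [left|right].
  by move=> [->|ys]; rewrite inE ?eqxx ?ys ?orbT.
split; first by apply: measurableU => //; exact: measurable_marked1.
apply/eqP; rewrite eq_le measure_ge0 andbT.
apply: (le_trans (measureU2 _ _ _)) => //; first exact: measurable_marked1.
by rewrite [X in _ + X <= _]h adde0 [leLHS]mu1.
Qed.

Lemma points_add (w : config) X : ~ pts w X -> D X ->
  perm_eq (points (add_point (w, X))) (X :: points w).
Proof.
move=> wX DX; apply: uniq_perm; first exact: points_uniq.
  rewrite /= points_uniq andbT; apply/negP => /(mem_points bD)[].
  by [].
move=> Y; rewrite inE; apply/idP/orP.
  move=> /(mem_points bD)[/= [wY DY|-> _]]; last by left.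
  by right; apply/(mem_points bD).
move=> [/eqP ->|/(mem_points bD)[wY DY]]; apply/(mem_points bD); split => //; first by right.
by left.
Qed.

(* The configurations w with a given point x are null for the diffuse measure mu, so
   that the points of [w] and the added point may be assumed to be distinct. *)
Lemma integral_add_point (w : config) (f g : marked d R -> \bar R) :
  measurable_fun setT f -> measurable_fun setT g ->
  (forall x, 0 <= f x) -> (forall x, 0 <= g x) ->
  (forall x, ~ pts w x -> D x -> f x = g x) ->
  \int[mu]_x f x = \int[mu]_x g x.
Proof.
move=> mf mg f0 g0 fg; have [mY Y0] := diffuse_finite (finite_configD bD w).
apply: (@integral_cond _ _ _ mu (D `&` ~` (pts w `&` D))) => //.
- by apply: measurableI => //; exact: measurableC.
- rewrite [~` (D `&` _)]setCI setCK; apply/eqP; rewrite eq_le measure_ge0 andbT.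
  apply: (le_trans (measureU2 _ _ _)) => //; first exact: measurableC.
  by rewrite [X in X + _ <= _]muD add0e [leLHS]Y0.
- by move=> x [Dx wx]; apply: fg => // wx'; apply: wx.
Qed.

Definition prodp (f : marked d R -> R) (w : config) : R := \prod_(X <- points w) f X.

Lemma measurable_prodp f : measurable_fun setT f -> measurable_fun setT (prodp f).
Proof.
move=> mf; have := measurable_prod_points bD hv (f := fun p : marked d R * unit => f p.1).
move=> /(_ (measurableT_comp mf measurable_fst)) h.
exact: (measurableT_comp h (measurable_pairr tt)).
Qed.

Lemma prodp_ge0 f w : (forall x, (0 <= f x)%R) -> (0 <= prodp f w)%R.
Proof. by move=> f0; apply: prodr_ge0. Qed.

Lemma prodp_add f w X : ~ pts w X -> D X -> prodp f (add_point (w, X)) = (f X * prodp f w)%R.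
Proof. by move=> wX DX; rewrite /prodp (perm_big _ (points_add wX DX)) big_cons. Qed.

Lemma points_empty : points (config_empty R d : config) = [::].
Proof.
apply/eqP; rewrite -size_eq0 size_points -leqn0; apply/eqP.
by rewrite set0I ncard0.
Qed.

Lemma measurable_addpt (w : config) (h : config -> \bar R) : measurable_fun setT h ->
  measurable_fun setT (fun x => h (add_point (w, x))).
Proof.
move=> mh; apply: (measurableT_comp mh).
exact: (measurableT_comp (@measurable_add_point R d) (measurable_pairl w)).
Qed.

(** Up to a null set the added point is new and lies in [D]; it multiplies the product by its own
    factor, whose integral is [c]. *)
Lemma nth_poisson_prod f c n : measurable_fun setT f -> (forall x, (0 <= f x)%R) ->
  \int[mu]_x (f x)%:E = c%:E ->
  \int[nth_poisson mu n]_w (prodp f w)%:E = (c ^+ n)%R%:E.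
Proof.
move=> mf f0 fc; have mp := measurable_prodp mf.
have mp' : measurable_fun setT (fun w : config => (prodp f w)%:E) by exact/measurable_EFinP.
have mf' : measurable_fun setT (fun x => (f x)%:E) by exact/measurable_EFinP.
have p0 w : 0 <= (prodp f w)%:E :> \bar R by rewrite lee_fin prodp_ge0.
have c0 : (0 <= c)%R by rewrite -lee_fin -fc; apply: integral_ge0 => x _; rewrite lee_fin.
elim: n => [|n ih].
  by rewrite integral_nth_poisson0// /prodp points_empty big_nil.
rewrite integral_nth_poissonS//.
transitivity (\int[nth_poisson mu n]_w ((prodp f w)%:E * c%:E)).
  apply: eq_integral => w _; rewrite -fc -ge0_integralZl_EFin ?prodp_ge0// => [|x _]; last by rewrite lee_fin.
  apply: (integral_add_point (w := w)) => //.
  - exact: (measurable_addpt w mp').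
  - by apply/measurable_EFinP; apply: measurable_funM.
  - by move=> x; rewrite -EFinM lee_fin mulr_ge0// prodp_ge0.
  - by move=> x wx Dx; rewrite prodp_add// mulrC EFinM.
by rewrite ge0_integralZr// ih -EFinM exprSr.
Qed.

(** The generating functional of a Poisson process, without its normalisation: the powers of [c] sum
    to the exponential series. *)
Lemma LP_prod f c : measurable_fun setT f -> (forall x, (0 <= f x)%R) ->
  \int[mu]_x (f x)%:E = c%:E ->
  \int[LP mu]_w (prodp f w)%:E = (expR c)%:E.
Proof.
move=> mf f0 fc; apply: integral_lebesgue_poisson_exp => //.
- by rewrite -lee_fin -fc; apply: integral_ge0 => x _; rewrite lee_fin.
- by apply/measurable_EFinP; exact: measurable_prodp.
- by move=> w; rewrite lee_fin prodp_ge0.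
- by move=> n; exact: nth_poisson_prod.
Qed.

Definition size_event k : set config := [set w | size (points w) = k].

(** Under a diffuse measure [n] independent points are almost surely distinct, so the [n]-th term
    lives on configurations of exactly [n] points. *)
Lemma nth_poisson_size n k :
  nth_poisson mu n (size_event k) = if n == k then (fine (mu setT) ^+ n)%R%:E else 0.
Proof.
have mS k' : measurable (size_event k') by exact: measurable_size_points.
rewrite -[size_event k]setIT -integral_indic//.
have mi k' : measurable_fun setT (fun w : config => (\1_(size_event k') w)%:E : \bar R).
  exact/measurable_EFinP.
elim: n k => [|n ih] k.
  rewrite integral_nth_poisson0// indicE; case: k => [|k]; first by rewrite mem_set// /size_event /= points_empty.
  by rewrite memNset// /size_event /= points_empty.
rewrite integral_nth_poissonS//.
case: k => [|k].
  transitivity (\int[nth_poisson mu n]_w 0 : \bar R); last by rewrite integral0.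
  apply: eq_integral => w _; transitivity (\int[mu]_x 0 : \bar R); last by rewrite integral0.
  apply: (integral_add_point (w := w)) => //; first exact: (measurable_addpt w (mi 0%N)).
  move=> x wx Dx; rewrite indicE memNset// /size_event /= => h.
  by have := perm_size (points_add wx Dx); rewrite h.
transitivity (\int[nth_poisson mu n]_w ((\1_(size_event k) w)%:E * mu setT)).
  apply: eq_integral => w _; rewrite -(integral_cst mu measurableT).
  apply: (integral_add_point (w := w)) => //; first exact: (measurable_addpt w (mi k.+1)).

  - by move=> x; rewrite /cst lee_fin.
  - move=> x wx Dx; rewrite /cst !indicE; congr (_%:R%:E); congr nat_of_bool.
    have sz := perm_size (points_add wx Dx).
    apply/idP/idP => /set_mem h; apply/mem_set; rewrite /size_event /= in h *.
      by move: h; rewrite sz => -[].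
    by rewrite sz /= h.
rewrite ge0_integralZr// ih eqSS; case: eqP => _; last by rewrite mul0e.
by rewrite fin_mu// -EFinM exprSr.
Qed.

Lemma LP_size k : LP mu (size_event k) = (fine (mu setT) ^+ k / k`!%:R)%R%:E.
Proof.
have mS k' : measurable (size_event k') by exact: measurable_size_points.
have mi : measurable_fun setT (fun w : config => (\1_(size_event k) w)%:E : \bar R).
  exact/measurable_EFinP.
rewrite -[size_event k]setIT -integral_indic// [LHS]integral_lebesgue_poisson//.
have term n : \int[nth_poisson mu n]_w (\1_(size_event k) w)%:E =
    if n == k then (fine (mu setT) ^+ n)%R%:E else 0.
  by rewrite integral_indic// setIT; exact: nth_poisson_size.
rewrite (@nneseriesD1 _ _ k)//; last first.
  by move=> n _; apply: mule_ge0; [rewrite lee_fin invr_ge0|apply: integral_ge0 => w _; rewrite lee_fin].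
rewrite eseries0 ?adde0; last by move=> n _ /= nk; rewrite term (negPf nk) mule0.
by rewrite term eqxx -EFinM mulrC.
Qed.
End poisson_functionals.

Section products_of_measures.
Local Open Scope ereal_scope.
Context d1 d2 (T1 : measurableType d1) (T2 : measurableType d2) (R : realType).

Lemma product_conull (m1 : {measure set T1 -> \bar R}) (m2 : {sigma_finite_measure set T2 -> \bar R})
    (C1 : set T1) (C2 : set T2) : measurable C1 -> measurable C2 ->
  m1 (~` C1) = 0 -> m2 (~` C2) = 0 -> (m1 \x m2) (~` (C1 `*` C2)) = 0.
Proof.
move=> mC1 mC2 h1 h2; have mC1' := measurableC mC1; have mC2' := measurableC mC2.
rewrite (_ : ~` _ = (~` C1 `*` setT) `|` (setT `*` ~` C2)); last first.
  apply/seteqP; split => -[x y] /=; first by move=> /not_andP[]; [left|right].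
  by move=> [[h _] []|[_ h] []].
apply/eqP; rewrite eq_le measure_ge0 andbT.
have mX1 : measurable (~` C1 `*` [set: T2]) by exact: measurableX.
have mX2 : measurable ([set: T1] `*` ~` C2) by exact: measurableX.
apply: (le_trans (measureU2 _ mX1 mX2)).
by rewrite [X in X + _]product_measure1E// h1 mul0e add0e [leLHS]product_measure1E// h2 mule0.
Qed.

Definition restrict_measure (mu : {finite_measure set T1 -> \bar R}) (A : set T1) (mA : measurable A) :
  {finite_measure set T1 -> \bar R}.
Proof.
refine (@mkfinite _ _ _ [the {measure set T1 -> \bar R} of mrestr mu mA] _).
by rewrite /= /mrestr setTI -ge0_fin_numE// fin_num_measure.
Defined.

End products_of_measures.

(** * Independence over disjoint regions and the joint law of counts *)

Section splitting.
Local Open Scope ereal_scope.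
Variables (R : realType) (d : nat).
Local Notation config := (config R d).
Implicit Types (mu : {finite_measure set (marked d R) -> \bar R}) (A B C D : set (marked d R)).

Lemma void_cunion C : @cunion R d @^-1` void C = void C `*` void C.
Proof.
apply/seteqP; split => -[w1 w2] /=; rewrite /void /= setIUl.
  by move/seteqP => -[h _]; split; apply/seteqP; split => // x hx; apply: h; [left|right].
by move=> [-> ->]; rewrite setU0.
Qed.

(* Both sides have the same void probabilities. *)
Lemma LP_split mu A (mA : measurable A) E : measurable E ->
  LP mu E = (LP (restrict_measure mu mA) \x LP (restrict_measure mu (measurableC mA)))
    (@cunion R d @^-1` E).
Proof.
move=> mE; pose m2 := image_measure (LP (restrict_measure mu mA) \x
  LP (restrict_measure mu (measurableC mA))) (@measurable_cunion R d).
apply: (measure_eq_void (m2 := m2)) => //; last exact: lebesgue_poisson_lt.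
move=> C [mC _]; have mv := measurable_void mC; have mC' := measurableC mC.
have -> : m2 (void C) = (LP (restrict_measure mu mA) \x
  LP (restrict_measure mu (measurableC mA))) (void C `*` void C) by rewrite -void_cunion.
transitivity (LP (restrict_measure mu mA) (void C) * LP (restrict_measure mu (measurableC mA)) (void C)).
  rewrite [LHS]LP_void// !LP_void// -EFinM -expRD.

  have mCA : measurable (~` C `&` A) by exact: measurableI.
  have mCA' : measurable (~` C `&` ~` A) by apply: measurableI => //; exact: measurableC.
  rewrite -fineD ?fin_num_measure//; congr (expR (fine _))%:E.
  rewrite /= /mrestr; by rewrite [LHS](measureDI mu mC' mA) addeC setDE.
exact/esym/product_measure1E.
Qed.

Lemma finite_sub_cube (X : set (marked d R)) : finite_set X -> exists n, X `<=` cube n `*` setT.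
Proof.
move/finite_seqP => [s ->]; elim: s => [|x s [n hn]]; first by exists 0%N.
have [m _ hm] : (\bigcup_n cube n) x.1 by rewrite cube_cover.
exists (maxn n m) => y; rewrite /= inE => /orP[/eqP ->|/hn [h1 _]]; split => // i.
  by apply: (le_trans (hm i)); rewrite ler_nat leq_maxr.
by apply: (le_trans (h1 i)); rewrite ler_nat leq_maxl.
Qed.

Lemma Sbp_cube A n : measurable A -> Sbp (A `&` cube n `*` setT).
Proof.
move=> mA; split.
  by apply: measurableI => //; apply: measurableX => //; exact: measurable_cube.
by exists n%:R => x [X [_ [/= h _]] <-].
Qed.

(** For unbounded [A] the count may be infinite. An infinite set contains [k.+1] points and finitely
    many points fit in a cube, so the cubes detect every count above [k]. *)
Lemma count_le A (w : config) k : measurable A ->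
  (count_points A w <= k%:R%:E) <-> (forall n, (ncard (pts w `&` (A `&` cube n `*` setT)) <= k)%N).
Proof.
move=> mA; have hf n : finite_set (pts w `&` (A `&` cube n `*` setT)).
  by apply: bounded_config_finite; exact: (Sbp_cube n mA).2.
rewrite /count_points; split.
  rewrite /counting; case: asboolP => // fX; rewrite lee_fin ler_nat => h n.
  apply: leq_trans h; apply: le_ncard => //; rewrite setIA; exact: subIsetl.
move=> h; have [fX|iX] := pselect (finite_set (pts w `&` A)).
  rewrite counting_ncard// lee_fin ler_nat; have [n hn] := finite_sub_cube fX.
  by have := h n; rewrite setIA setIidl.
exfalso; have [B BX Bk] := infinite_set_fset k.+1 iX.
have [n hn] := finite_sub_cube (finite_fset B).
have := h n; rewrite leqNgt => /negP; apply; apply: (leq_trans Bk).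
rewrite -[X in (X <= _)%N](_ : ncard [set` B] = _); last by rewrite /ncard set_fsetK.
apply: le_ncard => // x Bx; have [wx Ax] := BX _ Bx.
by split => //; split => //; exact: hn.
Qed.

Lemma measurable_count_points A k : measurable A ->
  measurable ([set w | count_points A w = k%:R%:E] : set config).
Proof.
move=> mA; have mle j : measurable ([set w | count_points A w <= j%:R%:E] : set config).
  under eq_set do rewrite (propext (count_le _ _ mA)).
  rewrite (_ : mkset _ = \bigcap_n ~` \bigcup_m [set w : config |
     ncard (pts w `&` (A `&` cube n `*` setT)) = (j.+1 + m)%N]).
    apply: bigcapT_measurable => n; apply: measurableC; apply: bigcup_measurable => m _.
    by apply: measurable_ncard; exact: Sbp_cube.
  apply/seteqP; split => w /= h n; first by move=> _ [m _ /= e]; have := h n; rewrite e ltnNge leq_addr.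
  rewrite leqNgt; apply/negP => hn; apply: (h n I).
  by exists (ncard (pts w `&` (A `&` cube n `*` setT)) - j.+1)%N => //=; rewrite subnKC.
case: k => [|k].
  rewrite (_ : mkset _ = [set w : config | count_points A w <= 0%:R%:E])//.
  apply/seteqP; split => w /=; first by move=> ->.
  rewrite /count_points /counting; case: asboolP => // _; rewrite lee_fin ler_nat leqn0.
  by move=> /eqP ->.
rewrite (_ : mkset _ = [set w : config | count_points A w <= k.+1%:R%:E] `\`
                       [set w : config | count_points A w <= k%:R%:E]).
  exact: measurableD.
apply/seteqP; split => w /=.
  by move=> ->; split => //; rewrite lee_fin ler_nat ltnn.
rewrite /count_points /counting; case: asboolP => [_|_ []//]; rewrite !lee_fin !ler_nat => -[h1 /negP].
by rewrite -ltnNge => h2; congr (_%:R%:E); apply/eqP; rewrite eqn_leq h1.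
Qed.

Lemma restrict_null mu A (mA : measurable A) D : measurable D -> mu (~` D) = 0 ->
  restrict_measure mu mA (~` (A `&` D)) = 0.
Proof.
move=> mD h; apply: (subset_measure0 (mu := mu) _ _ _ h).
- by apply: measurableI => //; apply: measurableC; exact: measurableI.
- exact: measurableC.
- by move=> x [AD Ax] Dx; apply: AD.
Qed.

Lemma restrict_diffuse mu A (mA : measurable A) :
  (forall X, mu [set X] = 0) -> forall X, restrict_measure mu mA [set X] = 0.
Proof.
move=> h X; apply: (subset_measure0 (mu := mu) _ _ _ (h X)); last exact: subIsetl.
- by apply: measurableI => //; exact: measurable_marked1.
- exact: measurable_marked1.
Qed.

Lemma LP_count mu D A k (mA : measurable A) : Sbp D -> mu (~` D) = 0 -> (forall X, mu [set X] = 0) ->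
  LP (restrict_measure mu mA) [set w | count_points A w = k%:R%:E] =
  (fine (mu A) ^+ k / k`!%:R)%R%:E.
Proof.
move=> bD muD mu1; have mD := bD.1; have bAD := SbpI bD mA.
have [v _] := bounded_nonneg_shift bAD.2.
have nullD := restrict_null mA mD muD.
have -> : fine (mu A) = fine (restrict_measure mu mA setT) by rewrite /= /mrestr setTI.
rewrite -[RHS](LP_size bAD nullD (restrict_diffuse mA mu1) v k).
apply: (measure_cond (measurable_config_in bAD.1) (LP_config_in bAD.1 nullD)).
- exact: measurable_count_points.
- exact: measurable_size_points.
suff h w : config_in (A `&` D) w -> count_points A w = (size (points (A `&` D) v w))%:R%:E :> \bar R.
  apply/seteqP; split => w [/= e cw]; split => //.
    by move: e; rewrite h// => -[] /eqP; rewrite eqr_nat => /eqP.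
  by rewrite /= h// e.
move=> cw; rewrite size_points /count_points.
have -> : pts w `&` A = pts w `&` (A `&` D).
  by rewrite setIA; apply/seteqP; split => [x [wx Ax]|x [[]]//]; have [] := cw _ wx.
by rewrite counting_ncard//; exact: bounded_config_finite bAD.2.
Qed.

Lemma measurable_counts n (A : 'I_n -> set (marked d R)) (k : 'I_n -> nat) :
  (forall i, measurable (A i)) ->
  measurable ([set w | forall i, count_points (A i) w = (k i)%:R%:E] : set config).
Proof.
move=> mA; rewrite (_ : mkset _ =
    \bigcap_(i in setT) [set w : config | count_points (A i) w = (k i)%:R%:E]).
  by apply: fin_bigcap_measurable => // i _; exact: measurable_count_points.
by apply/seteqP; split => w /= h i; [move=> _|]; exact: h.
Qed.

(** By induction on the number of regions: [LP_split] cuts the space along the first region. The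
    first factor sees only the count there, and the other regions, being disjoint from it, are seen
    only by the second factor. *)
Lemma LP_counts n mu D (A : 'I_n -> set (marked d R)) (k : 'I_n -> nat) :
  Sbp D -> mu (~` D) = 0 -> (forall X, mu [set X] = 0) ->
  (forall i, measurable (A i)) -> trivIset setT A ->
  LP mu [set w | forall i, count_points (A i) w = (k i)%:R%:E] =
  (expR (fine (mu (~` \bigcup_i A i))) * \prod_(i < n) (fine (mu (A i)) ^+ k i / (k i)`!%:R))%R%:E.
Proof.
move=> bD; elim: n mu A k => [|n ih] mu A k muD mu1 mA tA.
  rewrite (_ : mkset _ = setT); last by apply/seteqP; split => // w _ [].
  rewrite (_ : \bigcup_i _ = set0); last by apply/seteqP; split => // x [[]].
  by rewrite big_ord0 mulr1 setC0; exact: lebesgue_poissonT.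
set mu1' := restrict_measure mu (mA ord0).
set mu2 := restrict_measure mu (measurableC (mA ord0)).
pose A' (i : 'I_n) := A (lift ord0 i); pose k' (i : 'I_n) := k (lift ord0 i).
have mA' i : measurable (A' i) by exact: mA.
have mE' := measurable_counts k' mA'.
have mE := measurable_counts k mA.
have mu2D : mu2 (~` (~` A ord0 `&` D)) = 0 by exact: restrict_null bD.1 muD.
have mu1D : mu1' (~` (A ord0 `&` D)) = 0 by exact: restrict_null bD.1 muD.
have mu2D' : mu2 (~` D) = 0.
  apply: (subset_measure0 (mu := mu2) _ _ _ mu2D).
  - by apply: measurableC; exact: bD.1.
  - by apply: measurableC; apply: measurableI; [exact: measurableC|exact: bD.1].
  - by move=> x Dx [_ /Dx].
have disj i : A' i `&` ~` A ord0 = A' i.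
  apply/seteqP; split=> [x []//|x Ax]; split => // A0x.
  by move/trivIsetP : tA => /(_ (lift ord0 i) ord0 I I (negbT (lift_eqF _ _))) /seteqP[/(_ x) h _]; apply: h.
have tA' : trivIset setT A'.
  apply/trivIsetP => i j _ _ ij; move/trivIsetP : tA => /(_ (lift ord0 i) (lift ord0 j) I I); apply.
  by rewrite (inj_eq lift_inj).
have IH := ih mu2 A' k' mu2D' (restrict_diffuse _ mu1) mA' tA'.
rewrite (LP_split mu (mA ord0) mE).
(* Almost every pair has its first configuration inside the first region and its second one outside;
   there the counts of the union decouple. *)
pose C := @config_in R d (A ord0 `&` D) `*` @config_in R d (~` A ord0 `&` D).
have mC1 : measurable (@config_in R d (A ord0 `&` D)).
  by apply: measurable_config_in; apply: measurableI => //; exact: bD.1.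
have mC2 : measurable (@config_in R d (~` A ord0 `&` D)).
  by apply: measurable_config_in; apply: measurableI; [exact: measurableC|exact: bD.1].
have C0 : (LP mu1' \x LP mu2) (~` C) = 0.
  apply: product_conull => //.
    by apply: LP_config_in => //; apply: measurableI => //; exact: bD.1.
  by apply: LP_config_in => //; apply: measurableI; [exact: measurableC|exact: bD.1].
pose E1 := [set w : config | count_points (A ord0) w = (k ord0)%:R%:E].
have mE1 : measurable E1 by exact: measurable_count_points.
transitivity ((LP mu1' \x LP mu2) (E1 `*` [set w | forall i, count_points (A' i) w = (k' i)%:R%:E])).
  apply: (measure_cond (measurableX mC1 mC2) C0).
  - by rewrite -[X in measurable X]setTI; apply: measurable_cunion.
  - exact: measurableX.
  have h0 (w1 w2 : config) : C (w1, w2) ->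
      count_points (A ord0) (cunion (w1, w2)) = count_points (A ord0) w1.
    move=> [/= c1 c2]; rewrite /count_points; congr counting.
    rewrite setIUl (_ : pts w2 `&` A ord0 = set0) ?setU0//.
    by apply/seteqP; split => // x [/c2[]].
  have h1 (w1 w2 : config) i : C (w1, w2) ->
      count_points (A' i) (cunion (w1, w2)) = count_points (A' i) w2.
    move=> [/= c1 c2]; rewrite /count_points; congr counting.
    rewrite setIUl (_ : pts w1 `&` A' i = set0) ?set0U//.
    apply/seteqP; split => // x [/c1[A0x _]].
    by rewrite -disj => -[].
  apply/seteqP; split => -[w1 w2] [/= h cw]; split => //.
    by split; [rewrite /E1 /= -(h0 _ _ cw)|move=> i; rewrite -(h1 _ _ _ cw) h].
  move: h => [e1 e2] i; case: (unliftP ord0 i) => [j|] ->; last by rewrite h0.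
  by have := h1 _ _ j cw; rewrite e2.
rewrite product_measure1E//.
transitivity ((fine (mu (A ord0)) ^+ k ord0 / (k ord0)`!%:R)%R%:E *
    (expR (fine (mu2 (~` \bigcup_i A' i))) *
      \prod_(i < n) (fine (mu2 (A' i)) ^+ k' i / (k' i)`!%:R))%R%:E).
  by congr (_ * _); [exact: (LP_count (k ord0) (mA ord0) bD muD mu1)|exact: IH].
rewrite -EFinM; congr EFin.
rewrite big_ord_recl mulrCA; congr (expR _ * (_ * _))%R.
  rewrite /= /mrestr -setCU; congr (fine (mu (~` _))).
  apply/seteqP; split => x.
    by move=> [[i _ Ax]|Ax]; [exists (lift ord0 i)|exists ord0].
  move=> [i _]; case: (unliftP ord0 i) => [j|] -> Ax; last by right.
  by left; exists j.
by apply: eq_bigr => i _; rewrite /= /mrestr disj.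
Qed.

End splitting.

(** * Identification of the Poisson law *)

Section poisson_law.
Local Open Scope ereal_scope.
Variables (R : realType) (d : nat).
Local Notation config := (config R d).

(** At parameter 0 the law is the Dirac mass at 0, which the formula also gives because [0 ^+ 0] is
    1. *)
Lemma poisson_probE (r : R) k : (0 <= r)%R ->
  poisson_prob r 0 [set k] = (r ^+ k / k`!%:R * expR (- r))%R%:E.
Proof.
rewrite /poisson_prob le_eqVlt => /orP[/eqP <-|r0].
  rewrite ltxx oppr0 expR0 mulr1 diracE expr0n; case: k => [|k]; first by rewrite mem_set// fact0 divr1.
  by rewrite memNset//= mul0r.
by rewrite r0 esum_set1 /poisson_pmf ?r0// lee_fin mulr_ge0 ?expR_ge0// divr_ge0// exprn_ge0// ltW.
Qed.

Variables (mu : {finite_measure set (marked d R) -> \bar R}).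
Variables (D : set (marked d R)) (bD : Sbp D) (muD : mu (~` D) = 0).
Hypothesis mu1 : forall X, mu [set X] = 0.

Let c : R := fine (mu setT).
Let ec : {nonneg R} := NngNum (expR_ge0 (- c)).

Let P0T : mscale ec (LP mu) setT = 1.
Proof.
rewrite /mscale /= [X in _ * X](lebesgue_poissonT mu) -EFinM -expRD addNr expR0.
by [].
Qed.

Definition poisson_proba : probability config R := mkprobability P0T.

Lemma poisson_probaP : is_poisson_process mu poisson_proba.
Proof.
move=> n A k mA _ tA.
transitivity ((expR (- c))%:E * LP mu [set w | forall i, count_points (A i) w = (k i)%:R%:E]); first by [].
rewrite (LP_counts k bD muD mu1 mA tA) -EFinM.
transitivity (\prod_(i < n) (fine (mu (A i)) ^+ k i / (k i)`!%:R * expR (- fine (mu (A i))))%R%:E); last first.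
  by apply: eq_bigr => i _; rewrite poisson_probE// fine_ge0.
rewrite prodEFin; congr EFin; rewrite [RHS]big_split/= [LHS]mulrA [LHS]mulrC; congr (_ * _)%R.
rewrite -expRD -expR_sum; congr expR; rewrite sumrN.
have mU : measurable (\bigcup_i A i) by apply: fin_bigcup_measurable.
have cE : c = (fine (mu (~` \bigcup_i A i)) + fine (mu (\bigcup_i A i)))%R.
  rewrite -fineD ?fin_num_measure//; last exact: measurableC.
  rewrite /c; congr fine.
  by have := measureDI mu measurableT mU; rewrite setTD setTI.
rewrite cE opprD addrAC addNr add0r; congr (- _)%R.
rewrite measure_fin_bigcup//; last exact: finite_finset.
rewrite (_ : setT = [set` index_enum 'I_n]); last first.
  by apply/seteqP; split => // i _; rewrite /= mem_index_enum.
rewrite -fsbig_seq ?index_enum_uniq//=.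
transitivity (fine (\sum_(i < n) (fine (mu (A i)))%:E)); last by rewrite sumEFin.
by congr fine; apply: eq_bigr => i _; exact: fin_mu.
Qed.

(** [poisson_law] is a choice among all Poisson processes. Since [poisson_proba] is one of them, the
    chosen law is a Poisson process too, and the void probabilities identify the two. *)
Lemma poisson_lawE E : measurable E -> poisson_law mu E = (expR (- c))%:E * LP mu E.
Proof.
move=> mE; have h : is_poisson_process mu (poisson_law mu).
  by apply: (@getPex _ [set P : pprobability config R | is_poisson_process mu P]); exists poisson_proba; exact: poisson_probaP.
have h0 := poisson_probaP.
apply: (@measure_eq_void _ _ (poisson_law mu) poisson_proba) => //; last first.
  by apply: (le_lt_trans (probability_le1 (poisson_law mu) measurableT)); rewrite ltry.
move=> A bA.
have key (P : probability config R) : is_poisson_process mu P ->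
    P (void A) = poisson_prob (fine (mu A)) 0 [set 0%N].
  move=> /(_ 1%N (fun=> A) (fun=> 0%N)); rewrite big_ord1 => <-; first last.
  - by move=> i j _ _ _; rewrite !ord1.
  - by move=> _; rewrite -ge0_fin_numE// fin_num_measure//; exact: bA.1.
  - by move=> _; exact: bA.1.
  congr (P _); apply/seteqP; split => w; last by move=> /(_ ord0) /(count_void w bA.2).
  by move=> h1 _; apply/(count_void w bA.2).
by rewrite [LHS](key _ h) [RHS](key _ h0).
Qed.

Lemma integral_poisson_law (h : config -> \bar R) :
  measurable_fun setT h -> (forall w, 0 <= h w) ->
  \int[poisson_law mu]_w h w = (expR (- c))%:E * \int[LP mu]_w h w.
Proof.
move=> mh h0; rewrite -[RHS](ge0_integral_mscale _ measurableT ec)//.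
by apply: eq_measure_integral => A mA _; rewrite [LHS]poisson_lawE.
Qed.

End poisson_law.

(** * The intensity measures on D and their Poisson laws *)

Section intensity.
Local Open Scope ereal_scope.
Variables (R : realType) (d : nat) (Q : probability (mark R) R).
Variables (qs : {measure set (marked d R) -> \bar R}) (qsE : Qstar Q = qs).
Hypotheses (qs_fin : forall D, Sbp D -> qs D < +oo) (qs1 : forall X, qs [set X] = 0).
Local Notation config := (config R d).

Variables (D : set (marked d R)) (bD : Sbp D) (a : R) (a0 : (0 <= a)%R).

Lemma intensity_lt : mscale (NngNum a0) (mrestr qs bD.1) setT < +oo.
Proof.
rewrite /mscale /= /mrestr setTI lte_mul_pinfty ?lee_fin//.
by exact: qs_fin.
Qed.

Definition intensity : {finite_measure set (marked d R) -> \bar R} :=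
  @mkfinite _ _ _ [the {measure set _ -> \bar R} of mscale (NngNum a0) (mrestr qs bD.1)] intensity_lt.

Lemma intensityE A : intensity A = a%:E * qs (A `&` D).
Proof. by []. Qed.

Lemma Qstar_fin A : measurable A -> qs (A `&` D) = (fine (qs (A `&` D)))%:E.
Proof. by move=> mA; rewrite fineK// ge0_fin_numE// qs_fin//; exact: SbpI. Qed.

Lemma intensityT : fine (intensity setT) = (a * fine (qs D))%R.
Proof. by rewrite intensityE setTI -{1}[D]setTI Qstar_fin// setTI. Qed.

Lemma intensity_null : intensity (~` D) = 0.
Proof. by rewrite intensityE setICl measure0 mule0. Qed.

Lemma intensity_diffuse X : intensity [set X] = 0.
Proof.
rewrite intensityE; have : qs ([set X] `&` D) = 0.
  apply: (subset_measure0 (mu := qs) _ _ _ (qs1 X)); last exact: subIsetl.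
    by apply: measurableI; [exact: measurable_marked1|exact: bD.1].
  exact: measurable_marked1.
by move=> ->; rewrite mule0.
Qed.

Lemma PpoiE E : measurable E ->
  Ppoi Q D a E = (expR (- (a * fine (qs D))))%:E * LP intensity E.
Proof.
move=> mE; rewrite -intensityT -(poisson_lawE bD intensity_null intensity_diffuse mE).
by rewrite /Ppoi qsE.
Qed.

Lemma integral_Ppoi (h : config -> \bar R) :
  measurable_fun setT h -> (forall w, 0 <= h w) ->
  \int[Ppoi Q D a]_w h w = (expR (- (a * fine (qs D))))%:E * \int[LP intensity]_w h w.
Proof.
move=> mh h0; rewrite -intensityT -(integral_poisson_law bD intensity_null intensity_diffuse mh h0).
by rewrite /Ppoi qsE.
Qed.

End intensity.

Section functional.
Local Open Scope ereal_scope.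
Context d (T : measurableType d) (R : realType) (m : {measure set T -> \bar R}).
Variable L : (T -> \bar R) -> \bar R.
Hypothesis Ladd : forall f g, measurable_fun setT f -> measurable_fun setT g ->
  (forall x, 0 <= f x) -> (forall x, 0 <= g x) -> L (fun x => f x + g x) = L f + L g.
Hypothesis Lscale : forall (k : R) f, (0 <= k)%R -> measurable_fun setT f ->
  (forall x, 0 <= f x) -> L (fun x => k%:E * f x) = k%:E * L f.
Hypothesis Llim : forall (f : (T -> \bar R)^nat), (forall n, measurable_fun setT (f n)) ->
  (forall n x, 0 <= f n x) -> (forall x, {homo f ^~ x : n k / (n <= k)%N >-> n <= k}) ->
  L (fun x => limn (f ^~ x)) = limn (fun n => L (f n)).
Hypothesis Lind : forall A, measurable A -> L (fun x => (\1_A x)%:E) = m A.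

Import HBNNSimple.

Let Lnnsfun (h : {nnsfun T >-> R}) : L (fun x => (h x)%:E) = \int[m]_x (h x)%:E.
Proof.
rewrite integralT_nnsfun sintegralE.
have fin : finite_set (range h) by exact: fimfunP.
rewrite fsbig_finite//=.
have -> : (fun x => (h x)%:E) =
    (fun x => \sum_(r <- fset_set (range h)) (r%:E * (\1_(h @^-1` [set r]) x)%:E)).
  by apply/funext => x; rewrite [in LHS]fimfunE fsbig_finite//= -sumEFin; apply: eq_bigr => r _; rewrite EFinM.
have : forall r, r \in (fset_set (range h) : seq R) -> (0 <= r)%R.
  by move=> r; rewrite in_fset_set// => /set_mem[x _ <-].
elim: (fset_set (range h) : seq R) => [_|r s ih s0].
  rewrite big_nil (_ : (fun _ => _) = (fun x => 0%:E * (\1_set0 x)%:E)).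
    by rewrite Lscale ?mul0e//; exact/measurable_EFinP.
  by apply/funext => x; rewrite big_nil mul0e.
have r0 : (0 <= r)%R by apply: s0; rewrite mem_head.
rewrite big_cons -ih; last by move=> r' r's; apply: s0; rewrite inE r's orbT.
have mA r' : measurable (h @^-1` [set r']) by exact: measurable_funPTI.
have mi r' : measurable_fun setT (fun x => (\1_(h @^-1` [set r']) x)%:E : \bar R) by exact/measurable_EFinP.
rewrite -Lind// -Lscale//.
rewrite -Ladd//.
- by congr L; apply/funext => x; rewrite big_cons.
- exact: measurable_funeM.
- by apply: emeasurable_sum => r'; exact: measurable_funeM.
- by move=> x; rewrite -EFinM lee_fin mulr_ge0.
- move=> x; rewrite big_seq; apply: sume_ge0 => r' r's.
  by rewrite -EFinM lee_fin mulr_ge0// s0// inE r's orbT.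
Qed.

(** By approximation with simple functions. It identifies functionals for which only the values on
    indicators can be computed directly, such as an integral over splittings that vary with the
    configuration. *)
Lemma functional_integral f : measurable_fun setT f -> (forall x, 0 <= f x) -> L f = \int[m]_x f x.
Proof.
move=> mf f0; pose f_ := nnsfun_approx measurableT mf.
have fE : f = (fun x => limn (fun n => (f_ n x)%:E)).
  by apply/funext => x; apply/esym/cvg_lim => //; apply: cvg_nnsfun_approx.
have nd x : {homo (fun n => (f_ n x)%:E) : n k / (n <= k)%N >-> n <= k}.
  by move=> n k nk; rewrite lee_fin; exact/lefP/nd_nnsfun_approx.
rewrite fE (Llim (f := fun n x => (f_ n x)%:E))//; last 2 first.
  by move=> n; exact/measurable_EFinP/measurable_funP.
  by move=> n x; rewrite lee_fin.
rewrite monotone_convergence//; last 2 first.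
  by move=> n; exact/measurable_EFinP/measurable_funP.
  by move=> n x _; rewrite lee_fin.
by congr (limn _); apply/funext => n; exact: Lnnsfun.
Qed.

End functional.

(** * Splitting a configuration in two *)

Section mecke.
Local Open Scope ereal_scope.
Variables (R : realType) (d : nat) (mu : {finite_measure set (marked d R) -> \bar R}).
Variables (D : set (marked d R)) (bD : Sbp D) (muD : mu (~` D) = 0).
Hypothesis mu1 : forall X, mu [set X] = 0.
Variables (v : position d R) (hv : nonneg_shift v D).
Local Notation config := (config R d).
Local Notation points := (points D v).
Local Notation kth := (kth D v).
Implicit Types (w : config) (phi : config * config -> \bar R).

Definition split_pair n (J : {set 'I_n}) w : config * config :=
  (subconfig D v J w, subconfig D v (~: J) w).

Lemma measurable_split_pair n (J : {set 'I_n}) : measurable_fun setT (split_pair J).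
Proof. by apply/measurable_fun_pair; exact: measurable_subconfig. Qed.

(** The sum of the Dirac masses at all ways of sharing the points of [w] in [D] between two
    configurations. Stating it as a measure makes additivity and monotone convergence available. *)
Definition split_measure w : {measure set (config * config) -> \bar R} :=
  msum (fun i => [the {measure set (config * config) -> \bar R} of
    \d_(split_pair (nth finset.set0 (enum {set 'I_(size (points w))}) i) w)])
  #|{set 'I_(size (points w))}|.

Lemma split_measureE phi w : measurable_fun setT phi -> (forall p, 0 <= phi p) ->
  \int[split_measure w]_p phi p = \sum_(J : {set 'I_(size (points w))}) phi (split_pair J w).
Proof.
move=> mphi phi0; rewrite ge0_integral_measure_sum//.
under eq_bigr => i _ do rewrite integral_dirac// diracE mem_set// mul1e.
rewrite -(big_mkord xpredT (fun i => phi (split_pair (nth finset.set0 (enum {set 'I_(size (points w))}) i) w))).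
by rewrite [in LHS]cardE -(big_nth finset.set0 xpredT (fun J => phi (split_pair J w))) big_enum.
Qed.

Lemma measurable_split_integral phi : measurable_fun setT phi -> (forall p, 0 <= phi p) ->
  measurable_fun setT (fun w => \int[split_measure w]_p phi p).
Proof.
move=> mphi phi0.
apply: (measurableT_comp (f := fun p : config * unit => \int[split_measure p.1]_q phi q) _ (measurable_pairr tt)).
apply: (measurable_by_size bD (v := v)) => n.
apply: (eq_measurable_fun (fun p : config * unit => \sum_(J : {set 'I_n}) phi (split_pair J p.1))).
  by move=> p /set_mem[/= <- _]; rewrite split_measureE.
apply: emeasurable_sum => J; apply: measurable_funTS.
apply: (measurableT_comp mphi).
by apply: (measurableT_comp (measurable_split_pair J)).
Qed.

Definition splitting_measure_fun (A : set (config * config)) : \bar R :=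
  \int[LP mu]_w split_measure w A.

Let measurable_split_measure A : measurable A -> measurable_fun setT (fun w => split_measure w A).
Proof.
move=> mA; rewrite (_ : (fun w => _) = fun w => \int[split_measure w]_p (\1_A p)%:E).
  by apply: measurable_split_integral => [|p]; [exact/measurable_EFinP|rewrite lee_fin].
by apply/funext => w; rewrite integral_indic// setIT.
Qed.

Let spl0 : splitting_measure_fun set0 = 0.
Proof. by rewrite /splitting_measure_fun integral0_eq// => w _; rewrite measure0. Qed.

Let spl_ge0 A : 0 <= splitting_measure_fun A.
Proof. by apply: integral_ge0 => w _. Qed.

Let spl_sigma : semi_sigma_additive splitting_measure_fun.
Proof.
move=> F mF tF mUF.
rewrite [X in _ --> X](_ : _ = \sum_(n <oo) splitting_measure_fun (F n)).
  by apply/cvg_closeP; split; [exact: is_cvg_nneseries|rewrite closeE].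
rewrite -integral_nneseries//; last by move=> n; exact: measurable_split_measure.
apply: eq_integral => w _; apply/esym/cvg_lim => //.
exact: measure_semi_sigma_additive.
Qed.

Definition splitting_measure : {measure set (config * config) -> \bar R} :=
  mkmeasure spl0 spl_ge0 spl_sigma.

Lemma subconfig_void n (J : {set 'I_n}) w A :
  (\1_(void A) (subconfig D v J w) = \prod_(i in J) \1_(~` A) (kth i w) :> R)%R.
Proof.
rewrite indicE; have [h|h] := boolP (subconfig D v J w \in void A).
  rewrite big1// => i iJ; rewrite indicE mem_set// => Ai.
  have /seteqP[h' _] := set_mem h; apply: (h' (kth i w)); split => //=.
  by apply/fintype.imageP; exists i.
have [i iJ Ai] : exists2 i, i \in J & A (kth i w).
  apply: contrapT => hn; move/negP : h; apply; apply/mem_set.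
  apply/seteqP; split => // X [/= /fintype.imageP[i iJ ->] Ai].
  by apply: hn; exists i.
by rewrite (bigD1 i)//= indicE memNset ?mul0r//; exact: contra_not Ai.
Qed.

(** A sum over [J] of products with one factor inside [J] and another outside is the expanded
    product, over all points, of the sum of both factors. [LP_prod] integrates it, and the
    exponential of a sum is a product. *)
Lemma splitting_void A C : measurable A -> measurable C ->
  splitting_measure (void A `*` void C) = LP mu (void A) * LP mu (void C).
Proof.
move=> mA mC; have mA' := measurableC mA; have mC' := measurableC mC.
have mv : measurable (void A `*` void C) by apply: measurableX; exact: measurable_void.
pose f X : R := (\1_(~` A) X + \1_(~` C) X)%R.
have mf : measurable_fun setT f by apply: measurable_funD.
have f0 X : (0 <= f X)%R by rewrite addr_ge0.
transitivity (\int[LP mu]_w (prodp D v f w)%:E).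
  apply: eq_integral => w _; rewrite -[void A `*` void C]setIT -integral_indic//.
  rewrite split_measureE//; last exact/measurable_EFinP.
  rewrite sumEFin; congr EFin; rewrite /prodp (big_nth point) big_mkord.
  rewrite bigA_distr; apply: eq_bigr => J _.
  rewrite indicE in_setX -mulnb natrM -!indicE /split_pair /= !subconfig_void.
  rewrite [in RHS](bigID (mem J))/=; congr (_ * _)%R.
    by apply: eq_bigr => i ->.
  by apply: eq_big => i; rewrite finset.in_setC// => /negPf ->.
rewrite (@LP_prod _ _ _ _ bD muD mu1 v hv f (fine (mu (~` A)) + fine (mu (~` C))))//; last first.
  rewrite /f; under eq_integral do rewrite EFinD.
  rewrite ge0_integralD//; try exact/measurable_EFinP.
  by rewrite !integral_indic// !setIT EFinD -!fin_mu.
by rewrite expRD EFinM !LP_void.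
Qed.

(** One coordinate at a time: with the other coordinate fixed, both sides are finite measures that
    agree on void events. *)
Lemma splitting_product A : measurable A -> splitting_measure A = (LP mu \x LP mu) A.
Proof.
move=> mA; apply/esym/product_measure_unique => // {mA A} A C mA mC.
have vT := @void0 R d; have mT : measurable (set0 : set (marked d R)) by [].
have LPfin B : measurable B -> LP mu B \is a fin_num by move=> mB; exact: fin_num_measure.
have step1 B : Sbp B -> splitting_measure (A `*` void B) = LP mu A * LP mu (void B).
  move=> bB; have mvB := measurable_void bB.1.
  have mX : measurable ([set: config] `*` void B) by exact: measurableX.
  pose m1 := image_measure [the {measure set _ -> \bar R} of mrestr splitting_measure mX] measurable_fst.
  have c0 : (0 <= fine (LP mu (void B)))%R by rewrite fine_ge0.
  pose m2 : {measure set config -> \bar R} := mscale (NngNum c0) (LP mu).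
  have m1E E : m1 E = splitting_measure (E `*` void B).
    by rewrite /= /pushforward /mrestr; congr splitting_measure_fun; apply/seteqP; split => -[x y] /=; tauto.
  have m2E E : m2 E = LP mu E * LP mu (void B).
    by rewrite /= /mscale /= fineK ?LPfin// muleC.
  rewrite -m1E -m2E; apply: measure_eq_void => //.
    by move=> C' bC'; rewrite m1E m2E splitting_void//; [exact: bC'.1|exact: bB.1].
  by rewrite m1E -vT splitting_void//; [rewrite -ge0_fin_numE ?mule_ge0// fin_numM//; apply: LPfin; rewrite ?vT|exact: bB.1].
have mX : measurable (A `*` [set: config]) by exact: measurableX.
pose m1 := image_measure [the {measure set _ -> \bar R} of mrestr splitting_measure mX] measurable_snd.
have c0 : (0 <= fine (LP mu A))%R by rewrite fine_ge0.
pose m2 : {measure set config -> \bar R} := mscale (NngNum c0) (LP mu).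
have m1E E : m1 E = splitting_measure (A `*` E).
  by rewrite /= /pushforward /mrestr; congr splitting_measure_fun; apply/seteqP; split => -[x y] /=; tauto.
have m2E E : m2 E = LP mu A * LP mu E.
  by rewrite /= /mscale /= fineK ?LPfin.
transitivity (m1 C); first by rewrite m1E.
transitivity (m2 C); last by rewrite m2E.
apply: measure_eq_void => //.
  by move=> C' bC'; rewrite m1E m2E step1.
rewrite m1E -vT step1; last exact: Sbp0.
by rewrite -ge0_fin_numE ?mule_ge0// fin_numM//; apply: LPfin; rewrite ?vT.
Qed.

(** For unnormalised measures, colouring the points of one configuration in all possible ways
    amounts to superposing two independent configurations. This turns sums over kept subsets into a
    double integral over kept and discarded points. *)
Lemma mecke phi : measurable_fun setT phi -> (forall p, 0 <= phi p) ->
  \int[LP mu]_w (\sum_(J : {set 'I_(size (points w))}) phi (split_pair J w)) =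
  \int[LP mu \x LP mu]_p phi p.
Proof.
move=> mphi phi0.
transitivity (\int[LP mu]_w \int[split_measure w]_p phi p).
  by apply: eq_integral => w _; rewrite split_measureE.
pose L f := \int[LP mu]_w \int[split_measure w]_p f p.
apply: (@functional_integral _ _ _ _ L) => //.
- move=> f g mf mg f0 g0; rewrite /L -ge0_integralD//; try exact: measurable_split_integral.
  + by apply: eq_integral => w _; rewrite ge0_integralD.
  + by move=> w _; exact: integral_ge0.
  + by move=> w _; exact: integral_ge0.
- move=> k f k0 mf f0; rewrite /L -ge0_integralZl_EFin//; last 2 first.
  + by move=> w _; exact: integral_ge0.
  + exact: measurable_split_integral.
  by apply: eq_integral => w _; rewrite ge0_integralZl_EFin.
- move=> f mf f0 nf; rewrite /L -monotone_convergence//.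
  + by apply: eq_integral => w _; rewrite monotone_convergence.
  + by move=> n; exact: measurable_split_integral.
  + by move=> n w _; exact: integral_ge0.
  + by move=> w _ n k nk; apply: ge0_le_integral => // p _; exact: nf.
- move=> A mA; rewrite -[RHS]splitting_product//.
  by apply: eq_integral => w _; rewrite integral_indic// setIT.
Qed.

End mecke.

(** * Functions controlled by a continuous monotone function *)

Section defect.
Variables (R : realType) (m : R -> R) (C : R).
Hypotheses (mcont : continuous m) (m_ni : {homo m : s t / s <= t >-> t <= s}).
Hypotheses (m_small : forall e, 0 < e -> exists t, m t < e) (C0 : 0 <= C).
Hypothesis m_ge0 : forall t, 0 <= m t.

(* Halving the increments of [m] halves the bound on the increments of [J]. *)
Lemma quadratic_defect (J : R -> R) :
  (forall s t, s <= t -> `|J s - J t| <= C * (m s - m t) ^+ 2) ->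
  (forall t, `|J t| <= C * m t) -> forall t, J t = 0.
Proof.
move=> hJ hm; have bis (k : nat) s t : s <= t -> `|J s - J t| <= C * 2^-1 ^+ k * (m s - m t) ^+ 2.
  elim: k s t => [|k ih] s t st; first by rewrite expr0 mulr1 hJ.
  have mst := m_ni st.
  have [|||r] := @IVT _ m s t ((m s + m t) / 2) => //.
  - exact: continuous_subspaceT.
  - by rewrite ge_min le_max; apply/andP; split; apply/orP; [right|left]; lra.
  rewrite in_itv/= => /andP[sr rt] mr.
  have h1 := ih s r sr; have h2 := ih r t rt.
  have := ler_normD (J s - J r) (J r - J t); rewrite addrA subrK => /le_trans; apply.
  apply: (le_trans (lerD h1 h2)); rewrite mr (exprSr _ k).
  have -> : m s - (m s + m t) / 2 = (m s - m t) / 2 by field.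
  have -> : (m s + m t) / 2 - m t = (m s - m t) / 2 by field.
  by rewrite le_eqVlt; apply/orP; left; apply/eqP; set p := _ ^+ k; field.
have cst s t : s <= t -> J s = J t.
  move=> st; apply/eqP; rewrite -subr_eq0 -normr_le0; apply/ler_addgt0Pl => e e0; rewrite addr0.
  have cvg0 : (fun k : nat => (C * (m s - m t) ^+ 2) * 2^-1 ^+ k) @ \oo --> (0 : R).
    rewrite -(mulr0 (C * (m s - m t) ^+ 2)); apply: cvgM; first exact: cvg_cst.
    by apply: cvg_expr; rewrite ger0_norm ?invr_ge0// invf_lt1// ltr1n.
  have /cvgrPdist_lt/(_ e e0)[k _ /(_ k (leqnn k))] := cvg0.
  rewrite sub0r normrN => /ltW h; apply: (le_trans (bis k s t st)); apply: le_trans h.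
  by rewrite mulrAC ler_norm.
move=> t; apply/eqP; rewrite -normr_le0; apply/ler_addgt0Pl => e e0; rewrite addr0.
have Ce : 0 < e / (C + 1) by rewrite divr_gt0// ltr_wpDl.
have [r mr] := m_small Ce; pose q := Num.max t r.
have tq : t <= q by rewrite le_max lexx.
rewrite (cst _ _ tq); apply: (le_trans (hm q)).
have mq : m q <= e / (C + 1) by apply: le_trans (ltW mr); apply: m_ni; rewrite le_max lexx orbT.
apply: (@le_trans _ _ ((C + 1) * m q)).
  by rewrite ler_wpM2r// lerDl.
by rewrite -ler_pdivlMl// 1?mulrC ?ltr_wpDl.
Qed.

(* The generalised inverse of [m]. *)
Definition ginv (u : R) : R := sup [set t | u <= m t].

Lemma ginv_has_sup u : 0 < u -> (exists t, u <= m t) -> has_sup [set t | u <= m t].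
Proof.
move=> u0 hu; split => //; have [t mt] := m_small u0; exists t => s /= us.
by rewrite leNgt; apply/negP => /ltW/m_ni; rewrite leNgt (lt_le_trans mt).
Qed.

Let mcontP t e : 0 < e -> exists2 r, 0 < r & forall s, `|t - s| < r -> `|m t - m s| < e.
Proof.
move=> e0; have : m @ t --> m t by exact: mcont.
by move=> /cvgrPdist_lt/(_ e e0)[r /= r0 hr]; exists r.
Qed.

Lemma m_ginv u : 0 < u -> (exists t, u <= m t) -> m (ginv u) = u.
Proof.
move=> u0 hu; have hs := ginv_has_sup u0 hu; apply/eqP; rewrite eq_le; apply/andP; split.
- rewrite leNgt; apply/negP => h.
  have e0 : 0 < m (ginv u) - u by rewrite subr_gt0.
  have [e e1 he] := mcontP (ginv u) e0.
  have h' : u <= m (ginv u + e / 2).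
    have := he (ginv u + e / 2); rewrite opprD addNKr normrN gtr0_norm ?divr_gt0//.
    by rewrite ltr_pdivrMr// ltr_pMr// ltr1n => /(_ isT); rewrite ltr_norml => /andP[_]; lra.
  have := sup_upper_bound hs h'; rewrite gerDl leNgt divr_gt0//.
- rewrite leNgt; apply/negP => h.
  have e0 : 0 < u - m (ginv u) by rewrite subr_gt0.
  have [e e1 he] := mcontP (ginv u) e0.
  have [t /= ut tg] := sup_adherent e1 hs.
  have tg' : t <= ginv u by exact: sup_upper_bound hs t ut.
  have := he t; rewrite ger0_norm ?subr_ge0//.
  rewrite ltrBlDr -ltrBlDl => /(_ tg); rewrite ltr_norml => /andP[+ _]; lra.
Qed.

Lemma lt_ginv u t : 0 < u -> (exists t, u <= m t) -> t < ginv u -> u <= m t.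
Proof. by move=> u0 hu /ltW /m_ni; rewrite m_ginv. Qed.

Lemma le_ginv u u' : 0 < u -> u <= u' -> (exists t, u' <= m t) -> ginv u' <= ginv u.
Proof.
move=> u0 uu [t ht]; have hu : exists t, u <= m t by exists t; exact: le_trans ht.
apply: sup_le_ub; first by exists t.
by move=> s /= us; apply: sup_upper_bound; [exact: ginv_has_sup|exact: le_trans us].
Qed.

End defect.

(** * The mass above a rank *)

Section rank_tail.
Local Open Scope ereal_scope.
Variables (R : realType) (d : nat) (nu : {finite_measure set (marked d R) -> \bar R}).
Variables (D : set (marked d R)) (bD : Sbp D).
Hypothesis nu1 : forall X, nu [set X] = 0.
Variables (v : position d R) (hv : nonneg_shift v D).
Local Notation rk := (rank v).

Definition above (t : R) : set (marked d R) := D `&` [set X | (t < rk X)%R].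

Definition tail (t : R) : R := fine (nu (above t)).

Lemma measurable_aboveD t : measurable (above t).
Proof. by apply: measurableI; [exact: bD.1|exact: measurable_above]. Qed.

Lemma sub_above s t : (s <= t)%R -> above t `<=` above s.
Proof. by move=> st X [DX tX]; split => //; exact: le_lt_trans st tX. Qed.

Lemma tail_ge0 t : (0 <= tail t)%R.
Proof. by rewrite fine_ge0. Qed.

Lemma tailE t : nu (above t) = (tail t)%:E.
Proof. by apply: fin_mu; exact: measurable_aboveD. Qed.

Lemma tail_ni : {homo tail : s t / (s <= t)%R >-> (t <= s)%R}.
Proof.
move=> s t st; rewrite -lee_fin -!tailE; apply: le_measure; last exact: sub_above.
  by apply/mem_set; exact: measurable_aboveD.
by apply/mem_set; exact: measurable_aboveD.
Qed.

Lemma rank_ge0 X : (0 <= rk X)%R.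
Proof. by rewrite /rank interleaveE; exact: binary_value_ge0. Qed.

Lemma above_neg t : (t < 0)%R -> above t = D.
Proof. by move=> t0; apply/seteqP; split => [X []//|X DX]; split => //=; exact: lt_le_trans t0 (rank_ge0 X). Qed.

Lemma measurable_rank_level t : measurable (D `&` [set X | rk X = t]) /\ nu (D `&` [set X | rk X = t]) = 0.
Proof.
have [[X [DX Xt]]|h] := pselect (D `&` [set X | rk X = t] !=set0).
  rewrite (_ : _ `&` _ = [set X]); first by split; [exact: measurable_marked1|exact: nu1].
  by apply/seteqP; split => [Y [DY Yt]|_ ->//]; apply: (rank_inj hv) => //; rewrite Xt.
rewrite (_ : _ `&` _ = set0) ?measure0//; by apply/seteqP; split => // X hX; apply: h; exists X.
Qed.

(** The strips around [t] decrease to the set of points of rank [t], which has at most one point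
    because ranks are injective on [D], hence is null. *)
Lemma tail_near (t e : R) : (0 < e)%R ->
  exists2 r : R, (0 < r)%R & forall s : R, (`|t - s| < r -> `|tail t - tail s| < e)%R.
Proof.
move=> e0.
pose E (n : nat) := above (t - n.+1%:R^-1) `\` above (t + n.+1%:R^-1).
have mE n : measurable (E n) by apply: measurableD; exact: measurable_aboveD.
have cE : \bigcap_n E n = D `&` [set X | rk X = t].
  apply/seteqP; split => X.
    move=> h; have [[DX _] _] := h 0%N I; split => //=.
    apply/eqP; rewrite eq_le; apply/andP; split; rewrite leNgt; apply/negP => hlt.
      have [n nX] := ltr_add_invr hlt; have [_ h2] := h n I.
      by apply: h2; split.
    have [n nX] := ltr_add_invr hlt; have [[_ /= h1] _] := h n I.
    by move: h1; rewrite ltNge lerBrDr (ltW nX).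
  move=> [DX /= Xt] n _; split; first by split => //=; rewrite Xt ltrBlDr ltrDl invr_gt0.
  by move=> [_ /=]; rewrite Xt ltNge lerDl invr_ge0 ler0n.
have : (nu \o E) n @[n --> \oo] --> nu (\bigcap_n E n).
  apply: nonincreasing_cvg_mu => //.
  - by rewrite -ge0_fin_numE// fin_num_measure.
  - by rewrite cE; have [] := measurable_rank_level t.
  - move=> i j ij; apply/subsetPset => X [h1 h2]; have ij' : (j.+1%:R^-1 <= i.+1%:R^-1 :> R)%R.
      by rewrite lef_pV2 ?posrE// ler_nat.
    split; first by apply: sub_above h1; rewrite lerB.
    by apply: contra_not h2; apply: sub_above; rewrite lerD2l.
rewrite cE (measurable_rank_level t).2 => /fine_cvgP[_ /cvgrPdist_lt/(_ e e0)[n _ /(_ n (leqnn n))]].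
rewrite /= sub0r normrN => hn.
have {}hn : (tail (t - n.+1%:R^-1) - tail (t + n.+1%:R^-1) < e)%R.
  apply: le_lt_trans hn; apply: le_trans (ler_norm _).
  rewrite -lee_fin EFinB -!tailE fineK ?fin_num_measure//.
  have le1 : (t - n.+1%:R^-1 <= t + n.+1%:R^-1)%R by rewrite lerD2l -subr_ge0 opprK addr_ge0.
  rewrite /E measureD//.
  - by rewrite (setIidr (sub_above le1)).
  - exact: measurable_aboveD.
  - exact: measurable_aboveD.
  - by rewrite -ge0_fin_numE// fin_num_measure//; exact: measurable_aboveD.
exists n.+1%:R^-1%R => /=; first by rewrite invr_gt0.
move=> s; rewrite ltr_norml => /andP[h1 h2].
have i0 : (0 < n.+1%:R^-1 :> R)%R by rewrite invr_gt0.
move: (n.+1%:R^-1)%R i0 h1 h2 hn => i i0 h1 h2 hn.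
have l1 : (t - i <= s)%R by move: h2; lra.
have l2 : (s <= t + i)%R by move: h1; lra.
have l3 : (t - i <= t)%R by lra.
have l4 : (t <= t + i)%R by lra.
move: (tail_ni l1) (tail_ni l2) (tail_ni l3) (tail_ni l4) hn => *.
by rewrite ltr_norml; apply/andP; split; lra.
Qed.

Lemma tail_continuous : continuous tail.
Proof.
move=> t; apply/cvgrPdist_lt => e e0.
by have [r r0 hr] := tail_near t e0; exists r.
Qed.

(** Every rank is finite, so the sets above [n] decrease to the empty set. *)
Lemma tail_small (e : R) : (0 < e)%R -> exists t, (tail t < e)%R.
Proof.
move=> e0; have : (nu \o (fun n : nat => above n%:R)) n @[n --> \oo] --> nu (\bigcap_n above n%:R).
  apply: nonincreasing_cvg_mu => //.
  - by rewrite -ge0_fin_numE// fin_num_measure//; exact: measurable_aboveD.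
  - by move=> n; exact: measurable_aboveD.
  - by apply: bigcapT_measurable => n; exact: measurable_aboveD.
  - by move=> i j ij; apply/subsetPset; apply: sub_above; rewrite ler_nat.
rewrite (_ : \bigcap_n _ = set0); last first.
  apply/seteqP; split => // X h; have [_ /=] := h (absz (Num.floor (rk X))).+1 I.
  rewrite ltNge -[(absz _).+1%:R]natr1 natr_absz ger0_norm ?floor_ge0 ?rank_ge0//.
  by rewrite ltW//; have := floorD1_gt (rk X); rewrite intrD.
rewrite measure0 => /fine_cvgP[_ /cvgrPdist_lt/(_ e e0)[n _ /(_ n (leqnn n))]].
rewrite /= sub0r normrN => hn; exists n%:R.
by apply: le_lt_trans hn; exact: ler_norm.
Qed.

Lemma tail_neg t : (t < 0)%R -> tail t = fine (nu D).
Proof. by move=> t0; rewrite /tail above_neg. Qed.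

Lemma tail_le t : (tail t <= fine (nu D))%R.
Proof.
rewrite -lee_fin -tailE -fin_mu; last exact: bD.1.
by apply: le_measure; [apply/mem_set; exact: measurable_aboveD|apply/mem_set; exact: bD.1|exact: subIsetl].
Qed.

End rank_tail.

Lemma ge0_integral_restrict d (T : measurableType d) (R : realType)
    (mu : {measure set T -> \bar R}) (A : set T) (mA : measurable A) (f : T -> \bar R) :
  measurable_fun setT f -> (forall x, 0 <= f x)%E ->
  (\int[mrestr mu mA]_x f x = \int[mu]_(x in A) f x)%E.
Proof.
move=> mf f0; apply/esym.
apply: (functional_integral (m := [the {measure set T -> \bar R} of mrestr mu mA])
  (L := fun f => \int[mu]_(x in A) f x)%E) => //.
- by move=> {mf f0}f g mf mg f0 g0; rewrite ge0_integralD//; exact: measurable_funTS.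
- by move=> k {mf f0}f k0 mf f0; rewrite ge0_integralZl_EFin//; exact: measurable_funTS.
- move=> {mf f0}f mf f0 nd; rewrite monotone_convergence//; first by move=> n; exact: measurable_funTS.
- by move=> B mB; rewrite integral_indic.
Qed.

Section bounded_integral.
Local Open Scope ereal_scope.
Context d (T : measurableType d) (R : realType) (mu : {finite_measure set T -> \bar R}).

Lemma bounded_integral (E : set T) (f : T -> R) (K : R) : measurable E -> measurable_fun setT f ->
  (forall x, E x -> (0 <= f x <= K)%R) ->
  [/\ \int[mu]_(x in E) (f x)%:E = (fine (\int[mu]_(x in E) (f x)%:E))%:E,
    (0 <= fine (\int[mu]_(x in E) (f x)%:E))%R &
    (fine (\int[mu]_(x in E) (f x)%:E) <= K * fine (mu E))%R].
Proof.
move=> mE mf fK; have mf' : measurable_fun E (fun x => (f x)%:E) by apply/measurable_EFinP; exact: measurable_funTS.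
have h0 : 0 <= \int[mu]_(x in E) (f x)%:E.
  by apply: integral_ge0 => x /fK/andP[]; rewrite lee_fin.
have h1 : \int[mu]_(x in E) (f x)%:E <= (K * fine (mu E))%:E.
  rewrite EFinM fineK ?fin_num_measure// -integral_cst//.
  apply: ge0_le_integral => // [x /fK/andP[]|x /fK/andP[]]; rewrite lee_fin//.
have fin : \int[mu]_(x in E) (f x)%:E \is a fin_num.
  by rewrite ge0_fin_numE//; apply: le_lt_trans h1 _; rewrite ltry.
by rewrite fineK//; split => //; [exact: fine_ge0|rewrite -lee_fin fineK].
Qed.

Lemma le_integral_weight (E : set T) (p g : T -> R) (b : R) : measurable E ->
  measurable_fun setT p -> measurable_fun setT g ->
  (forall x, E x -> (0 <= p x)%R) -> (forall x, E x -> (0 <= g x)%R) ->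
  ((forall x, E x -> (p x <= b)%R) ->
    \int[mu]_(x in E) (p x * g x)%:E <= b%:E * \int[mu]_(x in E) (g x)%:E) /\
  ((0 <= b)%R -> (forall x, E x -> (b <= p x)%R) ->
    b%:E * \int[mu]_(x in E) (g x)%:E <= \int[mu]_(x in E) (p x * g x)%:E).
Proof.
move=> mE mp mg p0 g0.
have mg' : measurable_fun E (fun x => (g x)%:E) by apply/measurable_EFinP; exact: measurable_funTS.
have mpg : measurable_fun E (fun x => (p x * g x)%:E).
  by apply/measurable_EFinP; apply: measurable_funTS; exact: measurable_funM.
have zl : (0 <= b)%R -> b%:E * \int[mu]_(x in E) (g x)%:E = \int[mu]_(x in E) (b * g x)%:E.
  move=> b0; rewrite -ge0_integralZl_EFin//.
have mbg : measurable_fun E (fun x => (b * g x)%:E).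
  by apply/measurable_EFinP; apply: measurable_funM => //; exact: measurable_funTS.
split=> [pb|b0 pb].
  have [b0|b0] := leP 0%R b.
    rewrite zl//; apply: ge0_le_integral => // x Ex; rewrite lee_fin ?mulr_ge0 ?p0 ?g0//.
    by rewrite ler_wpM2r ?g0 ?pb.
  have E0 : E = set0.
    apply/seteqP; split => // x Ex.
    by have := lt_le_trans b0 (le_trans (p0 x Ex) (pb x Ex)); rewrite ltxx.
  by rewrite E0 !integral_set0 mule0.
rewrite zl//; apply: ge0_le_integral => // x Ex; rewrite lee_fin ?mulr_ge0 ?p0 ?g0//.
by rewrite ler_wpM2r ?g0 ?pb.
Qed.

End bounded_integral.

(** * A chain rule for masses above a rank *)

Section chain_rule.
Local Open Scope ereal_scope.
Variables (R : realType) (d : nat) (mu : {finite_measure set (marked d R) -> \bar R}).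
Variables (D : set (marked d R)) (bD : Sbp D).
Hypothesis mu1 : forall X, mu [set X] = 0.
Variables (v : position d R) (hv : nonneg_shift v D).
Local Notation rk := (rank v).
Local Notation above := (above D v).
Local Notation tail := (tail mu D v).
Variables (g : marked d R -> R) (K : R).
Hypotheses (mg : measurable_fun setT g) (gK : forall x, D x -> (0 <= g x <= K)%R).

Definition mass (t : R) : R := fine (\int[mu]_(x in above t) (g x)%:E).

Let mab t : measurable (above t) := measurable_aboveD bD v t.

Lemma massE t : \int[mu]_(x in above t) (g x)%:E = (mass t)%:E.
Proof. by have [] := bounded_integral mu (mab t) mg (fun x Vx => gK Vx.1). Qed.

Lemma mass_ge0 t : (0 <= mass t)%R.
Proof. by have [] := bounded_integral mu (mab t) mg (fun x Vx => gK Vx.1). Qed.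

Lemma mass_le t : (mass t <= K * tail t)%R.
Proof. by have [] := bounded_integral mu (mab t) mg (fun x Vx => gK Vx.1). Qed.

Lemma integral_above_split (f : marked d R -> R) s t : measurable_fun setT f ->
  (forall x, D x -> (0 <= f x)%R) -> (s <= t)%R ->
  \int[mu]_(x in above s) (f x)%:E = \int[mu]_(x in above t) (f x)%:E +
    \int[mu]_(x in above s `\` above t) (f x)%:E.
Proof.
move=> mf f0 st; have h : above s = above t `|` (above s `\` above t).
  by rewrite setDUK//; exact: sub_above.
rewrite {1}h ge0_integral_setU//.
- exact: measurableD.
- by rewrite -h; apply/measurable_EFinP; exact: measurable_funTS.
- by move=> x; rewrite -h => -[Dx _]; rewrite lee_fin f0.
- by apply/disj_setPS => x [h1 [_ h2]].
Qed.

Lemma massB s t : (s <= t)%R ->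
  \int[mu]_(x in above s `\` above t) (g x)%:E = (mass s - mass t)%:E.
Proof.
move=> st; have := integral_above_split mg (fun x Dx => (andP (gK Dx)).1) st.
rewrite !massE EFinB => ->; rewrite addeAC subee ?add0e//.
Qed.

Lemma mass_ni : {homo mass : s t / (s <= t)%R >-> (t <= s)%R}.
Proof.
move=> s t st; rewrite -subr_ge0 -lee_fin -massB//; apply: integral_ge0 => x [[Dx _] _].
by rewrite lee_fin; have /andP[] := gK Dx.
Qed.

Lemma massB_le s t : (s <= t)%R -> (mass s - mass t <= K * (tail s - tail t))%R.
Proof.
move=> st; have mst : measurable (above s `\` above t) by exact: measurableD.
have [_ _] := bounded_integral mu mst mg (fun x Vx => gK Vx.1.1).
rewrite massB// => /le_trans; apply; rewrite le_eqVlt; apply/orP; left; apply/eqP; congr (_ * _)%R.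
apply: EFin_inj; rewrite -fin_mu// EFinB -!tailE// measureD//.
  by rewrite (setIidr (sub_above st)).
by rewrite -ge0_fin_numE// fin_num_measure.
Qed.

Lemma measurable_mass_rank : measurable_fun setT (fun x => mass (rk x)).
Proof.
apply: (measurableT_comp (f := mass)); last exact: measurable_rank.
by apply: nonincreasing_measurable => //; exact: mass_ni.
Qed.

Variables (psi phi : R -> R) (L : R).
Hypothesis mphi : measurable_fun setT phi.
Hypothesis phiL : forall x, (0 <= x <= K * fine (mu D))%R -> (0 <= phi x <= L)%R.
Hypothesis phi_lip : forall x y, (0 <= y)%R -> (y <= x)%R -> (x <= K * fine (mu D))%R ->
  (`|phi x - phi y| <= L * (x - y))%R.
Hypothesis psi_derive : forall x y, (0 <= y)%R -> (y <= x)%R -> (x <= K * fine (mu D))%R ->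
  (`|psi x - psi y - phi y * (x - y)| <= L * (x - y) ^+ 2)%R.

(** Here [phi] plays the derivative of [psi]. Between two ranks [phi] of the mass changes by at most
    a first order term, so the increments of both sides agree up to the square of the increment of
    [tail], and [quadratic_defect] concludes. *)
Lemma integral_mass t :
  \int[mu]_(x in above t) (phi (mass (rk x)) * g x)%:E = (psi (mass t) - psi 0)%:E.
Proof.
(* [K] is known to be nonnegative only through a point of [D], hence the separate case. *)
have [D0|/set0P[X0 DX0]] := eqVneq D set0.
  rewrite (_ : above t = set0) ?integral_set0; last by rewrite /above D0 set0I.
  rewrite /mass (_ : above t = set0) ?integral_set0 ?subrr//.
  by rewrite /above D0 set0I.
have K0' : (0 <= K)%R by have /andP[/le_trans h /h] := gK DX0.
have bnd s : (0 <= mass s <= K * fine (mu D))%R.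
  by rewrite mass_ge0/=; apply: (le_trans (mass_le s)); rewrite ler_wpM2l// tail_le.
have L0 : (0 <= L)%R by have /andP[/le_trans h /h] := phiL (bnd 0%R).
pose p x := phi (mass (rk x)).
have mp : measurable_fun setT p by exact: (measurableT_comp mphi measurable_mass_rank).
have pL x : (0 <= p x <= L)%R by exact/phiL/bnd.
have mpg : measurable_fun setT (fun x => p x * g x)%R by exact: measurable_funM.
have pgK x : D x -> (0 <= p x * g x <= L * K)%R.
  move=> /gK/andP[g0 g1]; have /andP[p0 p1] := pL x.
  by rewrite mulr_ge0//= ler_pM.
pose I s := fine (\int[mu]_(x in above s) (p x * g x)%:E).
have IE s : \int[mu]_(x in above s) (p x * g x)%:E = (I s)%:E.
  by have [] := bounded_integral mu (mab s) mpg (fun x Vx => pgK x Vx.1).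
have I0 s : (0 <= I s)%R.
  by have [] := bounded_integral mu (mab s) mpg (fun x Vx => pgK x Vx.1).
have Ile s : (I s <= L * K * tail s)%R.
  by have [] := bounded_integral mu (mab s) mpg (fun x Vx => pgK x Vx.1).
have psi0 s : (`|psi (mass s) - psi 0| <= (L + L * (K * fine (mu D))) * (K * tail s))%R.
  have /andP[m0 m1] := bnd s; have := psi_derive (lexx 0%R) m0 m1.
  rewrite subr0 => h; have /andP[f0 f1] := phiL (bnd s).
  have /andP[q0 q1] : (0 <= phi 0 <= L)%R by apply: phiL; rewrite lexx mulr_ge0// fine_ge0.
  have -> : (psi (mass s) - psi 0 = (psi (mass s) - psi 0 - phi 0 * mass s) + phi 0 * mass s)%R by rewrite subrK.
  apply: (le_trans (ler_normD _ _)); rewrite addrC mulrDl; apply: lerD.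
    rewrite ger0_norm ?mulr_ge0//; apply: ler_pM => //; exact: mass_le.
  apply: (le_trans h); rewrite expr2 -mulrA ler_wpM2l// ler_pM//; exact: mass_le.
pose J s := (I s - (psi (mass s) - psi 0))%R.
suff J0 : J t = 0%R by rewrite IE; congr EFin; apply/eqP; rewrite -subr_eq0; apply/eqP.
(* The first summand controls the increments of [J], the second one its size. *)
pose C := (2 * L * K ^+ 2 + (L * K + (L + L * (K * fine (mu D))) * K))%R.
have mD0 : (0 <= fine (mu D))%R by rewrite fine_ge0.
have C2 : (0 <= L * K + (L + L * (K * fine (mu D))) * K)%R.
  by rewrite addr_ge0 ?mulr_ge0// addr_ge0// !mulr_ge0.
have C1 : (0 <= 2 * L * K ^+ 2)%R by rewrite !mulr_ge0// exprn_ge0.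
apply: (quadratic_defect (m := tail) (C := C)) => //.
- exact: tail_continuous.
- exact: tail_ni.
- exact: tail_small.
- exact: addr_ge0.
- by move=> s; exact: tail_ge0.
- move=> r s rs; have mE : measurable (above r `\` above s) by exact: measurableD.
  have := integral_above_split mpg (fun x Dx => (andP (pgK x Dx)).1) rs.
  rewrite !IE => /eqP.
  have [jE j0 _] := bounded_integral mu mE mpg (fun x Vx => pgK x Vx.1.1).
  move: jE j0; set j := fine _ => jE j0; rewrite jE -EFinD eqe => /eqP IJ.
  have /andP[s0 s1] := bnd s; have /andP[r0 r1] := bnd r.
  have ms := mass_ni rs; have /andP[ps0 ps1] := phiL (bnd s).
  pose l := (mass r - mass s)%R; have l0 : (0 <= l)%R by rewrite subr_ge0.
  have [up low] := le_integral_weight mu (p := p) (phi (mass s) + L * l) mE mp mg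
     (fun x _ => (andP (pL x)).1) (fun x Vx => (andP (gK Vx.1.1)).1).
  (* The lower estimate asks for a nonnegative constant. Truncating at 0 costs nothing because [p]
     is nonnegative. *)
  have [_ low'] := le_integral_weight mu (p := p) (Num.max 0 (phi (mass s) - L * l))%R mE mp mg
     (fun x _ => (andP (pL x)).1) (fun x Vx => (andP (gK Vx.1.1)).1).
  have near x : (above r `\` above s) x -> (`|p x - phi (mass s)| <= L * l)%R.
    move=> [[Dx /= rx] nx]; have xs : (rk x <= s)%R by rewrite leNgt; apply/negP => sx; exact: nx.
    apply: (le_trans (phi_lip s0 (mass_ni xs) _)); first by have /andP[] := bnd (rk x).
    by rewrite ler_wpM2l// lerB// mass_ni// ltW.
  have {up low} up : (j <= (phi (mass s) + L * l) * l)%R.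
    rewrite -lee_fin -jE EFinM -massB//; apply: up => x /near.
    by rewrite ler_norml => /andP[_]; rewrite lerBlDl.
  have {low'}low : (Num.max 0 (phi (mass s) - L * l) * l <= j)%R.
    rewrite -lee_fin -jE EFinM -massB//; apply: low'; first by rewrite le_max lexx.
    move=> x Vx; rewrite ge_max; have /andP[-> _] := pL x => /=.
    by move: (near x Vx); rewrite ler_norml => /andP[+ _]; lra.
  have {}low : ((phi (mass s) - L * l) * l <= j)%R.
    by apply: le_trans low; rewrite ler_wpM2r// le_max lexx orbT.
  have := psi_derive s0 ms r1; rewrite -/l => hpsi.
  have -> : (J r - J s = (j - phi (mass s) * l) - (psi (mass r) - psi (mass s) - phi (mass s) * l))%R.
    by rewrite /J IJ; ring.
  have hl : (L * l ^+ 2 <= L * (K ^+ 2 * (tail r - tail s) ^+ 2))%R.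
    rewrite ler_wpM2l// -exprMn; apply: ler_pM => //; exact: massB_le.
  apply: (@le_trans _ _ (2 * (L * l ^+ 2))%R).
    rewrite mulr2n mulrDl mul1r; apply: (le_trans (ler_normB _ _)); apply: lerD => //.
    by rewrite ler_norml; apply/andP; split; lra.
  apply: (@le_trans _ _ (2 * L * K ^+ 2 * (tail r - tail s) ^+ 2)%R).
    have -> : (2 * L * K ^+ 2 * (tail r - tail s) ^+ 2 = 2 * (L * (K ^+ 2 * (tail r - tail s) ^+ 2)))%R by ring.
    by rewrite ler_wpM2l.
  by rewrite ler_wpM2r ?sqr_ge0// lerDl.
- move=> s; rewrite /J; apply: (le_trans (ler_normB _ _)).
  rewrite ger0_norm//.
  apply: (le_trans (lerD (Ile s) (psi0 s))).
  by rewrite mulrA -mulrDl ler_wpM2r ?tail_ge0// lerDr.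
Qed.

End chain_rule.

Lemma expR_lip (R : realType) (M x y : R) : 0 <= y -> y <= x -> x <= M ->
  `|expR x - expR y| <= expR M * (x - y) /\
  `|expR x - expR y - expR y * (x - y)| <= expR M * (x - y) ^+ 2.
Proof.
move=> y0 yx xM; have xy0 : 0 <= x - y by rewrite subr_ge0.
have eM : expR x <= expR M by rewrite ler_expR.
have xE : expR x = expR y * expR (x - y) by rewrite -expRD addrC subrK.
have yE : expR y = expR x * expR (y - x) by rewrite -expRD addrC subrK.
have h1 : expR x - expR y <= expR x * (x - y).
  have := expR_ge1Dx (y - x); rewrite -(ler_pM2l (expR_gt0 x)) -yE; lra.
have h2 : 0 <= expR x - expR y by rewrite subr_ge0 ler_expR.
split.
  by rewrite ger0_norm//; apply: (le_trans h1); rewrite ler_wpM2r.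
have h3 : expR y * (x - y) <= expR x - expR y.
  have := expR_ge1Dx (x - y); rewrite -(ler_pM2l (expR_gt0 y)) -xE; lra.
rewrite ger0_norm ?subr_ge0//.
have h4 : expR x - expR y - expR y * (x - y) <= (expR x - expR y) * (x - y).
  by rewrite mulrBl lerB//; exact: h1.
apply: (le_trans h4); rewrite expr2 mulrA ler_wpM2r//.
by apply: (le_trans h1); rewrite ler_wpM2r.
Qed.

(** * Removal of the first point *)

Section first_point.
Local Open Scope ereal_scope.
Variables (R : realType) (d : nat) (mu : {finite_measure set (marked d R) -> \bar R}).
Variables (D : set (marked d R)) (bD : Sbp D).
Hypothesis mu1 : forall X, mu [set X] = 0.
Variables (v : position d R) (hv : nonneg_shift v D).
Local Notation config := (config R d).
Local Notation rk := (rank v).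
Local Notation above := (above D v).
Local Notation LP := (LP mu).

Let mab t : measurable (above t) := measurable_aboveD bD v t.

(** A configuration of [D] is finite, so it lies strictly above [t] exactly when it has no point
    below some rational [q > t]. *)
Lemma measurable_config_above :
  measurable [set p : R * config | config_in (above p.1) p.2].
Proof.
rewrite (_ : mkset _ = (setT `*` config_in D) `&` \bigcup_(q : rat)
  (`]-oo, ratr q[%classic `*` void (D `&` [set X | (rk X < ratr q)%R]))).
  apply: measurableI; first by apply: measurableX => //; exact: measurable_config_in bD.1.
  apply: countable_bigcupT_measurable => // q; apply: measurableX; first exact: measurable_itv.
  by apply: measurable_void; apply: measurableI; [exact: bD.1|exact: measurable_below].
apply/seteqP; split => -[t w] /=.
  move=> h; split; first by split => // x /h[].
  have wD : pts w `&` D = pts w by apply/seteqP; split => [x []//|x wx]; split => //; have [] := h x wx.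
  have fw : finite_set (pts w) by rewrite -wD; exact: finite_configD bD w.
  have [|q [tq hq]] := @finite_set_le_lt _ _ rk _ t fw; first by move=> x /h[].
  exists q => //; split; first by rewrite /= in_itv.
  apply/seteqP; split => // x [/hq qx [_ /=]]; rewrite ltNge; move=> /negP; apply; exact: ltW.
move=> [[_ wD] [q _ [/=]]]; rewrite in_itv/= => tq /seteqP[h _] x wx; split; first exact: wD.
rewrite /= ltNge; apply/negP => xt; apply: (h x); split => //; split; first exact: wD.
exact: le_lt_trans xt tq.
Qed.

(** The chain rule for the exponential, applied to the mass of [B] above a rank. With [B] the
    complement of a set, it is [first_point] for the indicator of the void event of that set. *)
Lemma expR_tail t (B : set (marked d R)) : measurable B ->
  (expR (fine (mu (above t `&` B))))%:E =
  1 + \int[mu]_(x in above t) (expR (fine (mu (above (rk x) `&` B))) * \1_B x)%:E.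
Proof.
move=> mB; pose g : marked d R -> R := \1_B.
have mg : measurable_fun setT g by exact: measurable_indic.
have gK x : D x -> (0 <= g x <= 1)%R by rewrite /g indicE ler0n lern1 leq_b1.
have mE s : mass mu D v g s = fine (mu (above s `&` B)).
  by rewrite /mass (_ : integral _ _ _ = mu (above s `&` B))// integral_indic// setIC.
have mD0 : (0 <= fine (mu D))%R by rewrite fine_ge0.
have := @integral_mass _ _ mu D bD mu1 v hv g 1 mg gK expR expR (expR (fine (mu D))).
rewrite mul1r => h.
transitivity (1 + (expR (mass mu D v g t) - expR 0)%:E : \bar R).
  by rewrite mE expR0 -EFinD addrC subrK.
congr (_ + _); rewrite -h; first by apply: eq_integral => x _; rewrite mE.
- exact: measurable_expR.
- by move=> x /andP[x0 xM]; rewrite expR_ge0 ler_expR.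
- by move=> x y y0 yx xM; have [] := expR_lip y0 yx xM.
- by move=> x y y0 yx xM; have [] := expR_lip y0 yx xM.
Qed.

(** Both sides are integrals of [h] against measures, equal on void events by [expR_tail]. The
    measure on the right is a Dirac mass at the empty configuration plus the image of pairs made of
    a point and a configuration strictly after it. *)
Lemma first_point t (h : config -> \bar R) : measurable_fun setT h -> (forall w, 0 <= h w) ->
  \int[LP]_(w in config_in (above t)) h w = h (config_empty R d) +
  \int[mu]_(x in above t) \int[LP]_(w in config_in (above (rk x))) h (add_point (w, x)).
Proof.
move=> mh h0; have mc s := measurable_config_in (mab s).
pose S := [set p : marked d R * config | above t p.1 /\ config_in (above (rk p.1)) p.2].
have mS : measurable S.
  rewrite (_ : S = (above t `*` setT) `&`
     ((fun p : marked d R * config => (rk p.1, p.2)) @^-1` [set p | config_in (above p.1) p.2])).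
    apply: measurableI; first exact: measurableX.
    rewrite -[X in measurable X]setTI; apply: (measurable_fun_pair _ _) => //; last exact: measurable_config_above.
    by apply: (measurableT_comp (f := rk)); [exact: measurable_rank|exact: measurable_fst].
  by apply/seteqP; split => -[x w] /= [] => [? ?|[? _] ?]; split.
pose add (p : marked d R * config) : config := add_point (p.2, p.1).
have madd : measurable_fun setT add.
  apply: (measurableT_comp (@measurable_add_point R d)).
  by apply/measurable_fun_pair; [exact: measurable_snd|exact: measurable_fst].
have mha : measurable_fun setT (h \o add) by exact: (measurableT_comp mh madd).
pose mm := [the {measure set (marked d R * config) -> \bar R} of mrestr (mu \x LP) mS].
pose M1 := [the {measure set config -> \bar R} of mrestr LP (mc t)].
pose M2 := [the {measure set config -> \bar R} of measure_add
   [the {measure set config -> \bar R} of \d_(config_empty R d : config)] (image_measure mm madd)].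
have M12 E : measurable E -> M1 E = M2 E.
  apply: measure_eq_void; last first.
    have -> : M1 setT = LP (config_in (above t)) by rewrite /= /mrestr setTI.
    by rewrite -ge0_fin_numE// fin_num_measure.
  move=> A [mA _]; have mAC := measurableC mA.
  have vc s : void A `&` config_in (above s) = void (A `|` ~` above s) :> set config.
    by rewrite config_inE /void; apply/seteqP; split => w /=; rewrite setIUr setU_eq0.
  have mAs s : measurable (A `|` ~` above s) by apply: measurableU => //; exact: measurableC.
  have cAs s : ~` (A `|` ~` above s) = above s `&` ~` A by rewrite setCU setCK setIC.
  transitivity (LP (void A `&` config_in (above t))); first by [].
  rewrite vc LP_void// cAs expR_tail//.
  transitivity (\d_(config_empty R d : config) (void A) +
     (mu \x LP) ((add @^-1` void A) `&` S)); last exact/esym/measure_addE.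
  congr (_ + _).
    by rewrite /dirac/= indicE mem_set// /void /= set0I.
  transitivity (\int[mu]_x LP (xsection ((add @^-1` void A) `&` S) x)); last by [].
  rewrite [LHS]integral_mkcond; apply: eq_integral => x _; rewrite /patch; case: ifPn => Vx.
    move/set_mem: Vx => Vx; rewrite indicE in_setC; case: (boolP (x \in A)) => Ax /=.
      rewrite mulr0 (_ : xsection _ _ = set0) ?measure0//; apply/seteqP; split => // w /xsectionP[].
      by move=> /void_add_point[_]; have := set_mem Ax.
    rewrite mulr1 -cAs -LP_void// -vc; congr (LP _); apply/seteqP; split => w /=.
      by move=> [Aw wV]; apply/xsectionP; split => //; apply/void_add_point; split => //; by move: Ax; rewrite (notin_setE).
    by move=> /xsectionP[/void_add_point[Aw _] [_ wV]].
  rewrite (_ : xsection _ _ = set0) ?measure0//; apply/seteqP; split => // w /xsectionP[_ [Vx' _]].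
  by move/negP: Vx; apply; exact: mem_set.
rewrite -ge0_integral_restrict//.
transitivity (\int[M2]_w h w); first by apply: eq_measure_integral => E mE _; exact: M12.
rewrite [LHS]ge0_integral_measure_add//; congr (_ + _).
  by rewrite [LHS]integral_dirac// diracE mem_set// mul1e.
rewrite [LHS]ge0_integral_image//.
transitivity (\int[mu \x LP]_(p in S) (h \o add) p).
  by apply: (ge0_integral_restrict (mu \x LP) mS (f := h \o add)) => // p; exact: h0.
rewrite [LHS]integral_mkcond.
pose hS : marked d R * config -> \bar R := (h \o add) \_ S.
have mr : measurable_fun setT hS.
  by apply/(measurable_restrictT (h \o add) mS); exact: measurable_funTS.
have r0 p : 0 <= hS p by rewrite /hS /patch; case: ifP => // _; exact: h0.
rewrite [LHS](@fubini_tonelli1 _ _ _ _ _ mu LP hS mr r0).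
rewrite [RHS]integral_mkcond; apply: eq_integral => x _; rewrite /fubini_F /hS [RHS]/patch; case: ifPn => Vx.
  rewrite [RHS]integral_mkcond; apply: eq_integral => w _; rewrite /patch.
  congr (if _ then _ else _); apply/idP/idP => /set_mem.
    by move=> [_ ?]; exact: mem_set.
  by move=> ?; apply: mem_set; split => //; exact: set_mem.
apply: integral0_eq => w _; rewrite /patch ifN//; apply/negP => /set_mem[Vx' _].
by move/negP: Vx; apply; exact: mem_set.
Qed.

End first_point.

(** * Jointly measurable Boltzmann weights *)

Section energy.
Variables (R : realType) (d : nat) (H : hamiltonian_family R d) (hH : is_hamiltonian H).
Variables (b : R) (b0 : 0 <= b).
Hypothesis H_le : forall (X : marked d R) (w : config R d), ~ pts w X ->
  (expeR (- H [set X] (config_single X) w) <= b%:E)%E.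
Variables (D : set (marked d R)) (bD : Sbp D).
Variables (v : position d R) (hv : nonneg_shift v D).
Local Notation config := (config R d).
Local Notation rk := (rank v).
Local Notation above := (above D v).
Implicit Types (w g : config) (x : marked d R).

Definition upper (q : R) : set (marked d R) := D `&` [set X | q <= rk X].

Lemma Sbp_upper q : Sbp (upper q).
Proof. by rewrite /upper setIC; apply: SbpI => //; exact: measurable_atleast. Qed.

Lemma finite_marked_measurable (Y : set (marked d R)) : finite_set Y -> measurable Y.
Proof.
move=> /finite_seqP[s ->]; elim: s => [|x s ms].
  by rewrite (_ : [set` [::]] = set0)//; apply/seteqP; split.
have -> : [set` x :: s] = [set x] `|` [set` s].
  apply/seteqP; split => y /=; first by rewrite inE => /orP[/eqP ->|]; [left|right].
  by move=> [->|ys]; rewrite inE ?eqxx ?ys ?orbT.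
by apply: measurableU => //; exact: measurable_marked1.
Qed.

Lemma Sbp_setD_config g : Sbp (D `\` pts g).
Proof.
have -> : D `\` pts g = D `\` (pts g `&` D).
  apply/seteqP; split => x [Dx gx]; split => //; first by move=> [].
    by move=> gx'; apply: gx.
apply: (SbpS bD); last by move=> x [].
apply: measurableD; first exact: bD.1.
by apply: finite_marked_measurable; exact: finite_configD bD g.
Qed.

(** Additivity is applied with the empty configuration in the difference of the two sets, where it
    has energy 0. *)
Lemma hamiltonian_sub (A B : set (marked d R)) w g : Sbp A -> Sbp B -> A `<=` B ->
  pts w `<=` A -> pts g `&` B = set0 -> H B w g = H A w g.
Proof.
move=> bA bB AB wA gB; have [_ _ h0 hU] := hH.
have bBA : Sbp (B `\` A) by apply: (SbpS bB); [apply: measurableD; [exact: bB.1|exact: bA.1]|move=> x []].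
have gBA : config_in (~` (B `\` A)) g by move=> x gx [Bx _]; have : (pts g `&` B) x by []; rewrite gB.
have := hU A (B `\` A) w (config_empty R d) g bA bBA.
rewrite setDUK// setDIK => /(_ erefl wA (@sub0set _ _)).
have -> : config_union w (config_empty R d) = w by apply: config_ext; rewrite /= setU0.
have -> : config_union g (config_empty R d) = g by apply: config_ext; rewrite /= setU0.
by move=> ->; rewrite ?h0 ?adde0// => x gx Bx; have : (pts g `&` B) x by []; rewrite gB.
Qed.

(** Taking real values loses nothing: Hamiltonians exclude the energy [-oo], and an energy [+oo]
    gives the factor 0. *)
Definition boltz (y : \bar R) : R := fine (expeR (- y)).

Lemma boltz_ge0 y : 0 <= boltz y.
Proof. by apply: fine_ge0; exact: expeR_ge0. Qed.

Lemma boltzE y : (-oo < y)%E -> (boltz y)%:E = expeR (- y).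
Proof. by case: y. Qed.

Lemma boltzD y z : (-oo < y)%E -> (-oo < z)%E -> boltz (y + z)%E = boltz y * boltz z.
Proof.
case: y => [r| |]// _; case: z => [s| |]// _; rewrite /boltz /= ?mul0r ?mulr0//.
by rewrite opprD expRD.
Qed.

Lemma measurable_boltz : measurable_fun setT boltz.
Proof.
rewrite (_ : boltz = fun y => if y \is a fin_num then expR (- fine y) else 0); last first.
  by apply/funext; case=> [r| |].
apply: measurable_fun_ifT => //.
  apply: (measurable_fun_bool true); rewrite (_ : _ @^-1` _ = [set x | x \is a fin_num]); last by apply/seteqP; split.
  exact: emeasurable_fin_num.
apply: (measurableT_comp (f := fun r : R => expR (- r))); last exact: fine_measurable.
by apply: measurableT_comp => //; exact: measurable_expR.
Qed.

(* The configurations of D for which the order interval spanned by w is free of points of g. *)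
Definition separated w g : Prop :=
  exists q : rat, pts w `<=` upper (ratr q) /\ pts g `&` upper (ratr q) = set0.

(* By [hamiltonian_sub] the energy of w given g does not depend on the ambient set; [D `\` pts g] is an admissible one. *)
Definition weight w g : R :=
  if `[< separated w g >] then boltz (H (D `\` pts g) w g) else 0.

Lemma weight_ge0 w g : 0 <= weight w g.
Proof. by rewrite /weight; case: ifP => // _; exact: boltz_ge0. Qed.

Lemma weightE A w g : Sbp A -> pts w `<=` A -> pts g `&` A = set0 -> separated w g ->
  weight w g = boltz (H A w g).
Proof.
move=> bA wA gA sw; rewrite /weight asboolT//; have [q [wD _]] := sw.
have bAD : Sbp (A `&` D) by apply: SbpI => //; exact: bA.1.
have wAD : pts w `<=` A `&` D by move=> x wx; split; [exact: wA|have [] := wD x wx].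
congr boltz; rewrite (@hamiltonian_sub (A `&` D) A)//.
rewrite (@hamiltonian_sub (A `&` D) (D `\` pts g))//.
- exact: Sbp_setD_config.
- by move=> x [Ax Dx]; split => // gx; have : (pts g `&` A) x by []; rewrite gA.
- by apply/seteqP; split => // x [gx [_ ngx]].
Qed.

(** A Hamiltonian is measurable only for a fixed set. The rationals that witness separation give
    countably many sets [upper (ratr q)], and on each piece [weight] is the Boltzmann factor of that
    fixed set. *)
Lemma measurable_weight : measurable_fun setT (fun p : config * config => weight p.1 p.2).
Proof.
have [mH _ _ _] := hH.
pose T (q : rat) : set (config * config) := config_in (upper (ratr q)) `*` config_in (~` upper (ratr q)).
have mT q : measurable (T q).
  by apply: measurableX; apply: measurable_config_in; [|apply: measurableC]; exact: (Sbp_upper _).1.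
have sT p : separated p.1 p.2 <-> exists q, T q p.
  by split=> -[q [h1 h2]]; exists q; split => //; [exact/disjoints_subset|exact/disjoints_subset].
move=> _ Y mY; rewrite setTI.
rewrite (_ : _ @^-1` Y = (\bigcup_(q : rat) (T q `&` (fun p => boltz (H (upper (ratr q)) p.1 p.2)) @^-1` Y)) `|`
  (~` (\bigcup_(q : rat) T q) `&` [set p | Y 0])).
  apply: measurableU.
    apply: countable_bigcupT_measurable => // q.
    have := measurable_comp measurableT (@subsetT _ _) measurable_boltz (mH _ (Sbp_upper (ratr q))).
    by move=> /(_ (mT q) _ mY).
  apply: measurableI.
    by apply: measurableC; apply: countable_bigcupT_measurable.
  have [Y0|Y0] := pselect (Y 0).
    by rewrite (_ : mkset _ = setT)//; apply/seteqP; split.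
  by rewrite (_ : mkset _ = set0)//; apply/seteqP; split.
have wT q p : T q p -> weight p.1 p.2 = boltz (H (upper (ratr q)) p.1 p.2).
  move=> [h1 h2]; apply: weightE => //; first exact: Sbp_upper.
    exact/disjoints_subset.
  by exists q; split => //; exact/disjoints_subset.
apply/seteqP; split => p /=.
  have [sp|sp] := pselect (separated p.1 p.2).
    by have [q Tq] := (sT p).1 sp; rewrite (wT q)// => Yw; left; exists q.
  rewrite /weight asboolF// => Y0; right; split => // -[q _ Tq]; apply: sp.
  by apply/sT; exists q.
move=> [[q _ [Tq]]|[nT Y0]]; first by rewrite (wT q).
by rewrite /weight asboolF// => /sT[q Tq]; apply: nT; exists q.
Qed.

Lemma separated_upper w g t : pts w `<=` upper t -> pts g `&` upper t = set0 -> separated w g.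
Proof.
move=> wt gt; have [|q qt hq] := @finite_set_lt _ _ rk _ t (finite_configD bD g).
  move=> x [gx Dx]; rewrite ltNge; apply/negP => tx.
  by have : (pts g `&` upper t) x by []; rewrite gt.
exists q; split; first by move=> x /wt[Dx /= tx]; split => //=; exact: le_trans (ltW qt) tx.
apply/seteqP; split => // x [gx [Dx /= qx]]; have := hq x (conj gx Dx).
by rewrite ltNge qx.
Qed.

Lemma separated_above w g t : pts w `<=` above t -> pts g `&` above t = set0 -> separated w g.
Proof.
move=> wt gt; have fw : finite_set (pts w).
  apply: (sub_finite_set _ (finite_configD bD w)) => x wx; split => //.
  by have [] := wt x wx.
have [|q qt hq] := @finite_set_le_lt _ _ rk _ t fw; first by move=> x /wt[].
exists q; split; first by move=> x wx; split; [have [] := wt x wx|exact: ltW (hq _ wx)].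
apply/seteqP; split => // x [gx [Dx /= qx]]; have : (pts g `&` above t) x.
  by split => //; split => //=; exact: lt_le_trans qx.
by rewrite gt.
Qed.

Lemma weight_empty g : weight (config_empty R d) g = 1.
Proof.
have [_ _ h0 _] := hH.
have s0 := @Sbp0 R d.
rewrite (weightE s0)//.
- have g0 : config_in (~` set0) g by move=> x _ [].
  by rewrite (h0 _ _ s0 g0) /boltz oppe0 expeR0.
- by rewrite setI0.
(* The sum exceeds the rank of every point of [g] in [D]. A rational threshold above all of them
   separates the empty configuration from [g]. *)
have [|q _ hq] := @finite_set_lt _ _ rk _ (\sum_(x <- points D v g) (rk x + 1)) (finite_configD bD g).
  move=> x /(mem_points bD v) xp; rewrite (big_rem _ xp)/=.
  by rewrite -addrA ltrDl ltr_pwDl// sumr_ge0// => y _; rewrite addr_ge0// rank_ge0.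
exists q; split; first by [].
apply/seteqP; split => // x [gx [Dx /= qx]]; have := hq x (conj gx Dx).
by rewrite ltNge qx.
Qed.

Lemma upper_diff x : D x -> upper (rk x) = above (rk x) `|` [set x].
Proof.
move=> Dx; apply/seteqP; split => y /=.
  move=> [Dy /=]; rewrite le_eqVlt => /orP[/eqP e|xy]; last by left.
  by right; apply: (rank_inj hv).
by move=> [[Dy /= xy]|->]; split => //=; exact: ltW.
Qed.

(** With [x] as lowest point, additivity gives [w] a boundary condition that includes [x], while [x]
    itself sees [g] alone. This is the factorisation that an exploration in increasing order
    needs. *)
Lemma weight_add x w g : D x -> pts w `<=` above (rk x) -> pts g `&` upper (rk x) = set0 ->
  weight (add_point (w, x)) g = weight w (add_point (g, x)) * weight (csingle x) g.
Proof.
move=> Dx wx gx; have [_ hH1 h0 hU] := hH.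
have bV : Sbp (above (rk x)) by apply: (SbpS bD) => [|y []//]; exact: measurable_aboveD.
have bx : Sbp [set x] by apply: (SbpS bD) => [|y ->//]; exact: measurable_marked1.
have Vx : above (rk x) `&` [set x] = set0.
  by apply/seteqP; split => // y [[_ /= h] yx]; move: h; rewrite yx ltxx.
have gU : config_in (~` (above (rk x) `|` [set x])) g by rewrite -upper_diff//; exact/disjoints_subset.
have gxV : pts (add_point (g, x)) `&` above (rk x) = set0.
  rewrite /= setIUl (setIC [set x]) Vx setU0; apply/disjoints_subset => y /gU h hy.
  by apply: h; left.
have gx0 : pts g `&` [set x] = set0.
  by apply/disjoints_subset => y /gU h hy; apply: h; right.
have wU : pts (add_point (w, x)) `<=` upper (rk x).
  by rewrite upper_diff//; apply: setSU.
rewrite (@weightE (upper (rk x)) (add_point (w, x)))//; last 2 first.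
- exact: Sbp_upper.
- exact: separated_upper wU gx.
rewrite {1}upper_diff// (hU _ _ w (csingle x) g bV bx Vx wx _ gU)//.
rewrite boltzD.
- rewrite (@weightE (above (rk x)))//; last exact: separated_above wx gxV.
  rewrite (@weightE [set x] (csingle x))//.
  by apply: (separated_upper _ gx) => y -> /=; split => /=.
- by apply: hH1 => //; exact/disjoints_subset.
- by apply: hH1 => //; exact/disjoints_subset.
Qed.

(** Here [x] may lie anywhere among the points of [w]. Additivity is used in the other order: [x] is
    added last, given both [g] and [w], and the bound on a single point applies. *)
Lemma weight_add_le x w g : ~ pts w x -> weight (add_point (w, x)) g <= b * weight w g.
Proof.
move=> wx; have [_ hH1 h0 hU] := hH.
rewrite {1}/weight; case: ifPn => [/asboolP sw|_]; last by rewrite mulr_ge0// weight_ge0.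
have [q [wq gq]] := sw.
have bq := Sbp_upper (ratr q).
rewrite -(_ : weight (add_point (w, x)) g = boltz _); last by rewrite /weight asboolT.
rewrite (@weightE (upper (ratr q)))//.
have xq : upper (ratr q) x by apply: wq; right.
have bx : Sbp [set x] by apply: (SbpS bD) => [|y ->]; [exact: measurable_marked1|have [] := xq].
have bqx : Sbp (upper (ratr q) `\` [set x]).
  by apply: (SbpS bq); [apply: measurableD; [exact: bq.1|exact: bx.1]|move=> y []].
have wqx : pts w `<=` upper (ratr q) `\` [set x].
  by move=> y wy; split; [apply: wq; left|move=> yx; apply: wx; rewrite -yx].
have gx : ~ pts g x by move=> gx; have : (pts g `&` upper (ratr q)) x by []; rewrite gq.
have qE : [set x] `|` (upper (ratr q) `\` [set x]) = upper (ratr q).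
  by rewrite setDUK// => y ->.
have gin : config_in (~` upper (ratr q)) g by exact/disjoints_subset.
have -> : add_point (w, x) = config_union (csingle x) w by apply: config_ext; rewrite /= setUC.
have gq' : pts g `&` (upper (ratr q) `\` [set x]) = set0.
  by apply/disjoints_subset => y /gin h [].
have gw : ~ pts (config_union g w) x by move=> [].
have gwx : config_in (~` [set x]) (config_union g w : config) by move=> y hy yx; apply: gw; rewrite -yx.
rewrite -{1}qE (hU _ _ (csingle x) w g bx bqx)//; last 2 first.
- by rewrite setDIK.
- by rewrite qE.
rewrite boltzD.
- rewrite -(@weightE _ w)//; last by exists q; split => // y wy; apply: wq; left.
  rewrite ler_wpM2r ?weight_ge0// -lee_fin boltzE; first exact: H_le.
  exact: hH1.
- exact: hH1.
- by apply: hH1 => //; exact/disjoints_subset.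
Qed.

Lemma weight_le w g : weight w g <= prodp D v (fun=> b) w.
Proof.
have [sw|sw] := pselect (separated w g); last first.
  by rewrite /weight asboolF//; exact: prodp_ge0.
have [q [wq _]] := sw.
have h s : uniq s -> weight (config_seq s) g <= b ^+ size s.
  elim: s => [_|x s ih /= /andP[xs us]].
    by rewrite expr0 (_ : config_seq [::] = config_empty R d) ?weight_empty//; apply: config_ext; apply/seteqP; split.
  rewrite (_ : config_seq (x :: s) = add_point (config_seq s, x)); last first.
    apply: config_ext; apply/seteqP; split => y /=.
      by rewrite inE => /orP[/eqP ->|]; [right|left].
    by move=> [ys|->]; rewrite inE ?eqxx// ys orbT.
  apply: (le_trans (weight_add_le _ _)); first by apply/negP.
  by rewrite exprS ler_wpM2l// ih.
have {1}-> : w = config_seq (points D v w).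
  apply: config_ext; apply/seteqP; split => y /=.
    by move=> wy; apply/(mem_points bD); split => //; have [] := wq y wy.
  by move=> /(mem_points bD)[].
apply: (le_trans (h _ _)); first exact: points_uniq.
by rewrite /prodp big_const_seq count_predT iter_mulr mulr1.
Qed.

End energy.

(** The logarithmic estimate rests on [ln s - ln r <= s / r - 1], used in both directions. *)
Lemma inv_ln_lip (R : realType) (x y : R) : 0 <= y -> y <= x ->
  `|(1 + x)^-1 - (1 + y)^-1| <= x - y /\
  `|ln (1 + x) - ln (1 + y) - (1 + y)^-1 * (x - y)| <= (x - y) ^+ 2.
Proof.
move=> y0 yx; have x0 := le_trans y0 yx; have xy0 : 0 <= x - y by rewrite subr_ge0.
have [X0 Y0] : 0 < 1 + x /\ 0 < 1 + y by split; lra.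
have e : (1 + y)^-1 - (1 + x)^-1 = (x - y) * ((1 + x)^-1 * (1 + y)^-1).
  by field; rewrite !gt_eqF.
have ix : (1 + x)^-1 <= 1 by rewrite invf_le1//; lra.
have iy : (1 + y)^-1 <= 1 by rewrite invf_le1//; lra.
have ix0 : 0 <= (1 + x)^-1 by rewrite invr_ge0 ltW.
have iy0 : 0 <= (1 + y)^-1 by rewrite invr_ge0 ltW.
have h1 : 0 <= (1 + y)^-1 - (1 + x)^-1 <= x - y.
  rewrite e mulr_ge0 ?mulr_ge0//= ler_piMr// mulr_ile1//.
split; first by rewrite distrC ger0_norm; have /andP[] := h1.
have lnB (s r : R) : 0 < s -> 0 < r -> ln s - ln r <= s / r - 1.
  move=> s0 r0; rewrite -ln_div ?posrE//.
  have := @le_ln1Dx R (s / r - 1); rewrite [1 + _]addrC subrK; apply.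
  by have := divr_gt0 s0 r0; lra.
have up : ln (1 + x) - ln (1 + y) <= (1 + y)^-1 * (x - y).
  apply: (le_trans (lnB _ _ X0 Y0)); rewrite le_eqVlt; apply/orP; left; apply/eqP.
  by field; rewrite gt_eqF.
have low : (1 + x)^-1 * (x - y) <= ln (1 + x) - ln (1 + y).
  have -> : (1 + x)^-1 * (x - y) = 1 - (1 + y) / (1 + x) by field; rewrite gt_eqF.
  have := lnB _ _ Y0 X0; lra.
have h2 : ((1 + y)^-1 - (1 + x)^-1) * (x - y) <= (x - y) ^+ 2.
  by rewrite expr2 ler_wpM2r//; have /andP[] := h1.
rewrite ler_norml; apply/andP; split; last by apply: (le_trans _ (sqr_ge0 _)); lra.
rewrite mulrBl in h2; lra.
Qed.

Lemma measurable_curried d0 d1 d2 d3 (T0 : measurableType d0) (T1 : measurableType d1)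
  (T2 : measurableType d2) (T3 : measurableType d3) (F : T1 -> T2 -> T3) (f : T0 -> T1) (g : T0 -> T2) :
  measurable_fun setT (fun p : T1 * T2 => F p.1 p.2) ->
  measurable_fun setT f -> measurable_fun setT g -> measurable_fun setT (fun x => F (f x) (g x)).
Proof.
move=> mF mf mg; have mfg : measurable_fun setT (fun x => (f x, g x)) by exact/measurable_fun_pair.
exact: (measurableT_comp mF mfg).
Qed.

(** * Partition functions above a level *)

Section partition_function.
Variables (R : realType) (d : nat) (H : hamiltonian_family R d) (hH : is_hamiltonian H).
Variables (b : R) (b0 : 0 <= b).
Hypothesis H_le : forall (X : marked d R) (w : config R d), ~ pts w X ->
  (expeR (- H [set X] (config_single X) w) <= b%:E)%E.
Variables (mu : {finite_measure set (marked d R) -> \bar R}).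
Variables (D : set (marked d R)) (bD : Sbp D).
Hypotheses (muD : mu (~` D) = 0%E) (mu1 : forall X, mu [set X] = 0%E).
Variables (v : position d R) (hv : nonneg_shift v D).
Local Notation config := (config R d).
Local Notation rk := (rank v).
Local Notation above := (above D v).
Local Notation upper := (upper D v).
Local Notation weight := (weight H D v).
Local Notation LP := (LP mu).
Implicit Types (w g : config) (x : marked d R) (t : R).

Let mab t : measurable (above t) := measurable_aboveD bD v t.
Let mc t : measurable (config_in (above t)) := measurable_config_in (mab t).
Let mW g : measurable_fun setT (fun w : config => weight w g).
Proof.
exact: (measurableT_comp (measurable_weight hH bD v) (measurable_pairr g)).
Qed.
Let mWE g : measurable_fun setT (fun w : config => (weight w g)%:E).
Proof. exact/measurable_EFinP. Qed.
Let W0 w g : (0 <= (weight w g)%:E)%E.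
Proof. by rewrite lee_fin weight_ge0. Qed.

(** The partition function against the unnormalised measure; [Zgb_part] relates it to the one of the
    specification by the factor [exp(- tail t)]. Without this factor its integral equation has
    constant term 1. *)
Definition part t g : R := fine (\int[LP]_(w in config_in (above t)) (weight w g)%:E).

(** [weight_le] bounds the weight by [b] to the number of points, whose integral is given by
    [LP_prod]. *)
Lemma integral_weight t g :
  (\int[LP]_(w in config_in (above t)) (weight w g)%:E = (part t g)%:E)%E /\
  0 <= part t g <= expR (b * fine (mu setT)).
Proof.
have mp : measurable_fun setT (fun w : config => (prodp D v (fun=> b) w)%:E).
  by apply/measurable_EFinP; exact: measurable_prodp.
have le : (\int[LP]_(w in config_in (above t)) (weight w g)%:E <= (expR (b * fine (mu setT)))%:E)%E.
  have <- : (\int[LP]_w (prodp D v (fun=> b) w)%:E = (expR (b * fine (mu setT)))%:E)%E.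
    apply: (LP_prod bD muD mu1 hv) => //.
    by rewrite integral_cst// [X in (_ * X)%E]fin_mu// -EFinM.
  apply: (@le_trans _ _ (\int[LP]_w (weight w g)%:E)%E).
    by apply: ge0_subset_integral => //; exact: subsetT.
  apply: ge0_le_integral => // w _; rewrite lee_fin.
  exact: weight_le.
have fin : (\int[LP]_(w in config_in (above t)) (weight w g)%:E)%E \is a fin_num.
  rewrite ge0_fin_numE; last exact: integral_ge0.
  by apply: le_lt_trans le _; rewrite ltry.
split; first by rewrite fineK.
by rewrite fine_ge0 ?integral_ge0//= -lee_fin fineK.
Qed.

Lemma part_ge0 t g : 0 <= part t g.
Proof. by have [_ /andP[]] := integral_weight t g. Qed.

Lemma part_le t g : part t g <= expR (b * fine (mu setT)).
Proof. by have [_ /andP[]] := integral_weight t g. Qed.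

Lemma partE t g : (\int[LP]_(w in config_in (above t)) (weight w g)%:E = (part t g)%:E)%E.
Proof. by have [] := integral_weight t g. Qed.

Lemma measurable_part : measurable_fun setT (fun p : R * config => part p.1 p.2).
Proof.
pose S := [set p : (R * config) * config | config_in (above p.1.1) p.2].
have mS : measurable S.
  rewrite (_ : S = (fun p : (R * config) * config => (p.1.1, p.2)) @^-1` [set p | config_in (above p.1) p.2]); last by apply/seteqP; split.
  rewrite -[X in measurable X]setTI; apply: (measurable_fun_pair _ _) => //; last exact: measurable_config_above.
  by apply: (measurableT_comp (f := fst)); [exact: measurable_fst|exact: measurable_fst].
pose f (p : (R * config) * config) : \bar R := (weight p.2 p.1.2 * \1_S p)%:E.
have mf : measurable_fun setT f.
  apply/measurable_EFinP; apply: measurable_funM; last exact: measurable_indic.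
  apply: (measurable_curried (F := weight) (measurable_weight hH bD v)); first exact: measurable_snd.
  by apply: (measurableT_comp (f := snd)); [exact: measurable_snd|exact: measurable_fst].
have f0 p : (0 <= f p)%E by rewrite lee_fin mulr_ge0 ?weight_ge0.
rewrite (_ : (fun _ => _) = fun p : R * config => fine (\int[LP]_w f (p, w))%E).
  apply: (measurableT_comp (f := fine)); first exact: fine_measurable.
  exact: (measurable_integral_snd LP mf f0).
apply/funext => -[t g]; congr fine; rewrite [LHS]integral_mkcond; apply: eq_integral => w _.
rewrite /patch /f /= indicE; case: ifPn => wt.
  by rewrite mem_set ?mulr1//; exact: set_mem.
by rewrite memNset ?mulr0// => wS; move/negP: wt; apply; exact: mem_set.
Qed.

(** The contribution of the configurations whose lowest point is [x]. At almost every point it is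
    the derivative of [part] in the level variable. *)
Definition insertion x g : R := weight (csingle x) g * part (rk x) (add_point (g, x)).

Lemma insertion_ge0 x g : 0 <= insertion x g.
Proof. by rewrite mulr_ge0 ?weight_ge0 ?part_ge0. Qed.

Lemma measurable_insertion : measurable_fun setT (fun p : marked d R * config => insertion p.1 p.2).
Proof.
apply: measurable_funM.
  apply: (measurable_curried (F := weight) (measurable_weight hH bD v)); last exact: measurable_snd.
  exact: (measurableT_comp (@measurable_csingle R d) measurable_fst).
apply: (measurable_curried (F := part) measurable_part).
  by apply: (measurableT_comp (f := rk)); [exact: measurable_rank|exact: measurable_fst].
apply: (measurableT_comp (@measurable_add_point R d)); apply/measurable_fun_pair.
  exact: measurable_snd.
exact: measurable_fst.
Qed.

Lemma integral_insertion x g : D x -> pts g `&` upper (rk x) = set0 ->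
  (\int[LP]_(w in config_in (above (rk x))) (weight (add_point (w, x)) g)%:E = (insertion x g)%:E)%E.
Proof.
move=> Dx gx; rewrite /insertion EFinM -partE -ge0_integralZl_EFin//; last 2 first.
- exact: measurable_funTS.
- exact: weight_ge0.
apply: eq_integral => w /set_mem wx.
by rewrite -EFinM (weight_add hH bD hv Dx wx gx) mulrC.
Qed.

(** If [x] is not separated from [g], the left side is 0 by the convention in [weight]. Otherwise
    [weight_add_le] bounds the integrand of [integral_insertion]. *)
Lemma insertion_le x g : D x -> insertion x g <= b * part (rk x) g.
Proof.
move=> Dx; have [sx|sx] := pselect (separated D v (csingle x) g); last first.
  by rewrite /insertion /weight asboolF// mul0r mulr_ge0// part_ge0.
have [q [xq gq]] := sx; have [_ /= qx] := xq x erefl.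
have gx : pts g `&` upper (rk x) = set0.
  apply/seteqP; split => // y [gy [Dy /= xy]]; have : (pts g `&` upper (ratr q)) y.
    by split => //; split => //=; exact: le_trans qx xy.
  by rewrite gq.
rewrite -lee_fin [X in (_ <= X)%E]EFinM -integral_insertion// -partE -ge0_integralZl_EFin//; last exact: measurable_funTS.
have ma : measurable_fun setT (fun w => (weight (add_point (w, x)) g)%:E).
  apply/measurable_EFinP; apply: (measurableT_comp (mW g)).
  exact: (measurableT_comp (@measurable_add_point R d) (measurable_pairr x)).
apply: ge0_le_integral => //.
- exact: measurable_funTS.
- by apply: measurable_funTS; exact: measurable_funeM.
- move=> w wx; rewrite -EFinM lee_fin; apply: (weight_add_le hH b0 H_le bD).
  by move=> /wx[_ /=]; rewrite ltxx.
Qed.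

Lemma insertion_bound x g : D x -> 0 <= insertion x g <= b * expR (b * fine (mu setT)).
Proof.
move=> Dx; rewrite insertion_ge0/=; apply: (le_trans (insertion_le g Dx)).
by rewrite ler_wpM2l// part_le.
Qed.

Let mI g : measurable_fun setT (fun x => insertion x g).
Proof. exact: (measurableT_comp measurable_insertion (measurable_pairr g)). Qed.

Lemma part_insertion t g : pts g `&` above t = set0 ->
  (part t g)%:E = (1 + \int[mu]_(x in above t) (insertion x g)%:E)%E.
Proof.
move=> gt; rewrite -partE (first_point bD mu1 hv)//.
rewrite weight_empty//; congr (_ + _)%E; apply: eq_integral => x /set_mem[Dx /= tx].
rewrite integral_insertion//; apply/seteqP; split => // y [gy [Dy /= xy]].
have : (pts g `&` above t) y by split => //; split => //=; exact: lt_le_trans tx xy.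
by rewrite gt.
Qed.

Lemma mass_insertion t g : pts g `&` above t = set0 ->
  mass mu D v (insertion ^~ g) t = part t g - 1.
Proof.
move=> gt; apply: EFin_inj; rewrite -(massE mu bD v (mI g) (fun x => @insertion_bound x g)).
by rewrite EFinB (part_insertion gt) addeAC subee// add0e.
Qed.

Lemma part_ge1 t g : pts g `&` above t = set0 -> 1 <= part t g.
Proof.
move=> gt; rewrite -subr_ge0 -mass_insertion//.
exact: (mass_ge0 mu bD v (mI g) (fun x => @insertion_bound x g)).
Qed.

(** The logarithmic derivative of [part] in the level variable, up to a null set. Its bound [b] is
    what keeps the thinning probabilities at most 1. *)
Definition ratio x g : R := insertion x g / part (rk x) g.

Lemma ratio_bound x g : D x -> 0 <= ratio x g <= b.
Proof.
move=> Dx; rewrite divr_ge0 ?insertion_ge0 ?part_ge0//=.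
have := part_ge0 (rk x) g; rewrite le_eqVlt => /orP[/eqP e|p0].
  by rewrite /ratio -e invr0 mulr0.
by rewrite ler_pdivrMr// insertion_le.
Qed.

(** Inversion takes the value 0 at 0 by convention; on positive numbers it is the exponential of
    minus the logarithm. *)
Lemma measurable_inv_ge0 : measurable_fun setT (fun y : R => (Num.max y 0)^-1).
Proof.
rewrite (_ : (fun y => _) = fun y => if 0 < y then expR (- ln y) else 0).
  apply: measurable_fun_ifT => //.
    apply: (measurable_fun_bool true); rewrite setTI (_ : _ @^-1` _ = `]0, +oo[%classic)//.
    by apply/seteqP; split => x /=; rewrite in_itv/= andbT.
  by apply: measurableT_comp; [exact: measurable_expR|apply: measurableT_comp => //; exact: measurable_ln].
apply/funext => y; rewrite maxC /Num.max; case: ifP => [y0|]; last by rewrite invr0.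
by rewrite expRN lnK.
Qed.

Lemma measurable_ratio : measurable_fun setT (fun p : marked d R * config => ratio p.1 p.2).
Proof.
rewrite (_ : (fun _ => _) = fun p : marked d R * config => insertion p.1 p.2 * (Num.max (part (rk p.1) p.2) 0)^-1).
  apply: measurable_funM; first exact: measurable_insertion.
  apply: (measurableT_comp measurable_inv_ge0).
  apply: (measurable_curried (F := part) measurable_part); last exact: measurable_snd.
  by apply: (measurableT_comp (f := rk)); [exact: measurable_rank|exact: measurable_fst].
by apply/funext => p; rewrite max_l// part_ge0.
Qed.

(** The mass of [insertion] above a level is [part - 1], so the chain rule is applied to
    [ln (1 + y)]. Mass 0 corresponds to [ln 1 = 0], hence no boundary term at infinity. *)
Lemma integral_ratio t g : pts g `&` above t = set0 ->
  (\int[mu]_(x in above t) (ratio x g)%:E = (ln (part t g))%:E)%E.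
Proof.
move=> gt; pose phi (y : R) := (Num.max (1 + y) 0)^-1.
have phiE y : 0 <= y -> phi y = (1 + y)^-1 by move=> y0; rewrite /phi max_l// addr_ge0.
have := @integral_mass _ _ mu D bD mu1 v hv (insertion ^~ g) _ (mI g) (fun x => @insertion_bound x g)
  (fun y => ln (1 + y)) phi 1 _ _ _ _ t.
rewrite mass_insertion// addr0 ln1 subr0 addrC subrK => <-.
- apply: eq_integral => x /set_mem[Dx /= tx]; have gx : pts g `&` above (rk x) = set0.
    apply/seteqP; split => // y [gy [Dy /= xy]]; have : (pts g `&` above t) y.
      by split => //; split => //=; exact: lt_trans tx xy.
    by rewrite gt.
  rewrite mass_insertion// phiE ?subr_ge0 ?part_ge1// addrC subrK /ratio mulrC//.
- apply: (measurableT_comp measurable_inv_ge0); exact: measurable_funD.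
- move=> y /andP[y0 _]; rewrite phiE// invr_ge0 addr_ge0//= invf_le1 ?ltr_wpDr// lerDl//.
- by move=> x y y0 yx _; rewrite !phiE ?(le_trans y0 yx)// mul1r; have [] := inv_ln_lip y0 yx.
- by move=> x y y0 yx _; rewrite !phiE// mul1r; have [] := inv_ln_lip y0 yx.
Qed.

End partition_function.

(** * The Gibbs density as a product along the exploration *)

Section gibbs_weights.
Variables (R : realType) (d : nat) (H : hamiltonian_family R d) (hH : is_hamiltonian H).
Variables (b : R) (b0 : 0 <= b).
Hypothesis H_le : forall (X : marked d R) (w : config R d), ~ pts w X ->
  (expeR (- H [set X] (config_single X) w) <= b%:E)%E.
Variables (mu : {finite_measure set (marked d R) -> \bar R}).
Variables (D : set (marked d R)) (bD : Sbp D).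
Hypotheses (muD : mu (~` D) = 0%E) (mu1 : forall X, mu [set X] = 0%E).
Variables (v : position d R) (hv : nonneg_shift v D).
Local Notation config := (config R d).
Local Notation rk := (rank v).
Local Notation above := (above D v).
Local Notation weight := (weight H D v).
Local Notation part := (part H mu D v).
Local Notation ratio := (ratio H mu D v).
Implicit Types (w g : config) (x : marked d R) (t : R).

Let mab t : measurable (above t) := measurable_aboveD bD v t.

(* The boundary condition seen by x when the configuration w is explored in increasing order. *)
Definition past w g x : config := cunion (g, below D v (rk x) w).

Lemma measurable_past : measurable_fun setT (fun p : (config * config) * marked d R => past p.1.1 p.1.2 p.2).
Proof.
have m1 : measurable_fun setT (fun p : (config * config) * marked d R => p.1.2).
  by apply: (measurableT_comp (f := snd)); [exact: measurable_snd|exact: measurable_fst].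
have m2 : measurable_fun setT (fun p : (config * config) * marked d R => p.1.1).
  by apply: (measurableT_comp (f := fst)); [exact: measurable_fst|exact: measurable_fst].
apply: (measurable_curried (F := fun g w => cunion (g, w)) (f := fun p : (config * config) * marked d R => p.1.2)) => //.
  apply: eq_measurable_fun (@measurable_cunion R d) => -[w1 w2] _.
  by [].
apply: (measurable_curried (F := below D v) (measurable_below_fun bD v)) => //.
by apply: (measurableT_comp (f := rk)); [exact: measurable_rank|exact: measurable_snd].
Qed.

Lemma measurable_ratio_past w g : measurable_fun setT (fun x => ratio x (past w g x)).
Proof.
apply: (measurable_curried (F := ratio) (measurable_ratio hH b0 H_le bD muD mu1 hv)) => //.
exact: (measurableT_comp measurable_past (measurable_pairl (w, g))).
Qed.

Lemma ratio_past_bound w g x : D x -> 0 <= ratio x (past w g x) <= b.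
Proof. by move=> Dx; exact: ratio_bound. Qed.

(** By induction on the first point [x] of [s]. Up to [x] the past is [g], and the integrated ratio
    is a difference of logarithms of partition functions. After [x] the boundary condition is [g]
    with [x], whose partition function cancels against the one inside [ratio x g]. *)
Lemma gibbs_weight s t g : (forall X, X \in s -> above t X) ->
  sorted (fun X Y => rk X < rk Y) s -> pts g `&` above t = set0 ->
  exists I : R, [/\ (\int[mu]_(x in above t) (ratio x (past (config_seq s) g x))%:E = I%:E)%E,
    0 <= I <= b * fine (mu setT) &
    expR (- I) * \prod_(X <- s) ratio X (past (config_seq s) g X) =
    weight (config_seq s) g / part t g].
Proof.
move=> hs ss gt.
have [Ie I0 Ile] := bounded_integral mu (mab t) (measurable_ratio_past (config_seq s) g)
  (fun x Vx => @ratio_past_bound (config_seq s) g x Vx.1).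
eexists; split; first exact: Ie.
  rewrite I0/=; apply: (le_trans Ile); rewrite ler_wpM2l// -lee_fin -!fin_mu//.
  by apply: le_measure; [exact: mem_set|exact: mem_set|exact: subsetT].
move: Ie I0 Ile; set I := fine _ => Ie _ _.
elim: s t g hs ss gt @I Ie => [|x s ih] t g hs ss gt I Ie.
  have e0 : config_seq [::] = config_empty R d :> config.
    by apply: config_ext; apply/seteqP; split.
  rewrite big_nil mulr1 e0 weight_empty// div1r.
  have p0 : 0 < part t g by apply: lt_le_trans (part_ge1 hH b0 H_le bD muD mu1 hv gt).
  suff -> : I = ln (part t g) by rewrite expRN lnK.
  apply: EFin_inj; rewrite -Ie -(integral_ratio hH b0 H_le bD muD mu1 hv gt).
  apply: eq_integral => x _; congr (ratio x _)%:E; apply: config_ext.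
  by rewrite /past e0 /= set0I setU0.
have [Dx /= tx] : above t x by apply: hs; rewrite mem_head.
pose g' := add_point (g, x).
have gx : pts g `&` above (rk x) = set0.
  apply/seteqP; split => // y [gy [Dy /= xy]]; have : (pts g `&` above t) y.
    by split => //; split => //=; exact: lt_trans tx xy.
  by rewrite gt.
have gu : pts g `&` upper D v (rk x) = set0.
  apply/seteqP; split => // y [gy [Dy /= xy]]; have : (pts g `&` above t) y.
    by split => //; split => //=; exact: lt_le_trans tx xy.
  by rewrite gt.
have gx' : pts g' `&` above (rk x) = set0.
  apply/seteqP; split => // y [[gy|->] [Dy /= xy]]; last by rewrite ltxx in xy.
  by have : (pts g `&` above (rk x)) y by []; rewrite gx.
have trr : transitive (fun X Y : marked d R => rk X < rk Y) by move=> Y X Z; exact: lt_trans.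
have xs : all (fun y => rk x < rk y) s by exact: (order_path_min trr ss).
have hs' X : X \in s -> above (rk x) X.
  by move=> Xs; split; [have [] : above t X by apply: hs; rewrite inE Xs orbT|exact: (allP xs)].
(* An exploration strictly after [x] cannot distinguish [x] as a point of the configuration from [x]
   as a point of the boundary condition. *)
have past_gt y : rk x < rk y -> past (config_seq (x :: s)) g y = past (config_seq s) g' y.
  move=> xy; apply: config_ext => /=; apply/seteqP; split => z.
    move=> [gz|[/= zs [Dz zy]]]; first by left; left.
    by move: zs; rewrite inE => /orP[/eqP ->|zs]; [left; right|right].
  move=> [[gz|->]|[/= zs [Dz zy]]]; [by left|right|right].
    by split; [rewrite /= mem_head|split].
  by split; [rewrite /= inE zs orbT|split].
have past_le y : rk y <= rk x -> past (config_seq (x :: s)) g y = g.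
  move=> yx; apply: config_ext => /=; apply/seteqP; split => z; last by left.
  move=> [//|[/= zs [Dz zy]]]; exfalso.
  move: zs; rewrite inE => /orP[/eqP zx|zs].
    by move: zy; rewrite /= zx ltNge yx.
  by have := lt_trans (lt_le_trans zy yx) (allP xs z zs); rewrite ltxx.
have [Ie' _ _] := bounded_integral mu (mab (rk x)) (measurable_ratio_past (config_seq s) g')
  (fun y Vy => @ratio_past_bound (config_seq s) g' y Vy.1).
have := ih (rk x) g' hs' (path_sorted ss) gx' Ie'.
move: Ie'; set I' := fine _ => Ie' hI'.
have split1 := integral_above_split mu bD v (measurable_ratio_past (config_seq (x :: s)) g)
  (fun y Dy => (andP (@ratio_past_bound (config_seq (x :: s)) g y Dy)).1) (ltW tx).
have mr : measurable_fun setT (fun y => ratio y g).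
  exact: (measurableT_comp (measurable_ratio hH b0 H_le bD muD mu1 hv) (measurable_pairr g)).
have split2 := integral_above_split mu bD v mr
  (fun y Dy => (andP (ratio_bound hH b0 H_le bD muD mu1 hv g Dy)).1) (ltW tx).
have IE : I = I' + (ln (part t g) - ln (part (rk x) g)).
  apply: EFin_inj; rewrite -Ie [LHS]split1 EFinD; congr (_ + _)%E.
    by rewrite -Ie'; apply: eq_integral => y /set_mem[_ /= xy]; rewrite past_gt.
  transitivity (\int[mu]_(y in above t `\` above (rk x)) (ratio y g)%:E)%E.
    apply: eq_integral => y /set_mem[[Dy _] ny]; rewrite past_le// leNgt; apply/negP => xy.
    exact: ny.
  move: split2; rewrite !(integral_ratio hH b0 H_le bD muD mu1 hv)// EFinB => ->.
  by rewrite addeAC subee ?add0e.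
have pt : 0 < part t g by apply: lt_le_trans (part_ge1 hH b0 H_le bD muD mu1 hv gt).
have px : 0 < part (rk x) g by apply: lt_le_trans (part_ge1 hH b0 H_le bD muD mu1 hv gx).
have px' : 0 < part (rk x) g' by apply: lt_le_trans (part_ge1 hH b0 H_le bD muD mu1 hv gx').
have wE : weight (config_seq (x :: s)) g = weight (config_seq s) g' * weight (csingle x) g.
  rewrite -(weight_add hH bD hv Dx _ gu)//; congr (weight _ g).
  apply: config_ext => /=; apply/seteqP; split => y /=.
    by rewrite inE => /orP[/eqP ->|]; [right|left].
  by move=> [ys|->]; rewrite inE ?eqxx// ys orbT.
have eI : expR (- I) = expR (- I') * (part (rk x) g / part t g).
  by rewrite IE opprD expRD opprB -ln_div ?posrE// lnK// posrE divr_gt0.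
rewrite big_cons past_le// wE eI.
rewrite (eq_big_seq (fun X => ratio X (past (config_seq s) g' X))); last first.
  by move=> X /hs'[_ /= xX]; rewrite past_gt.
move: hI'; rewrite -/g' /ratio /insertion -/g'.
set P := \prod_(_ <- _) _; set W := weight (config_seq s) g'; set W1 := weight _ g => hI'.
have -> : expR (- I') * (part (rk x) g / part t g) * (W1 * part (rk x) g' / part (rk x) g * P) =
  (expR (- I') * P) * (W1 * part (rk x) g' / part t g) by field; rewrite !gt_eqF.
by rewrite hI'; field; rewrite !gt_eqF.
Qed.

End gibbs_weights.

(** * The level variable and Lebesgue differentiation *)

Section levels.
Variables (R : realType) (d : nat) (mu : {finite_measure set (marked d R) -> \bar R}).
Variables (D : set (marked d R)) (bD : Sbp D).
Hypotheses (muD : mu (~` D) = 0%E) (mu1 : forall X, mu [set X] = 0%E).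
Variables (v : position d R) (hv : nonneg_shift v D).
Local Notation rk := (rank v).
Local Notation above := (above D v).
Local Notation tail := (tail mu D v).
Local Notation leb := (@lebesgue_measure R).

(** The mass of the points explored after [x]. It decreases along the exploration and, unlike the
    rank, it is distributed as Lebesgue measure on an interval. *)
Definition level (x : marked d R) : R := tail (rk x).

Let c : R := fine (mu D).

Lemma measurable_level : measurable_fun setT level.
Proof.
apply: (measurableT_comp (f := tail)); last exact: measurable_rank.
by apply: nonincreasing_measurable => //; exact: tail_ni.
Qed.

Lemma level_ge0 x : 0 <= level x. Proof. exact: tail_ge0. Qed.
Lemma level_le x : level x <= c. Proof. exact: tail_le. Qed.

Let tc : continuous tail. Proof. exact: tail_continuous. Qed.
Let tn : {homo tail : s t / s <= t >-> t <= s}. Proof. exact: tail_ni. Qed.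
Let ts e : 0 < e -> exists t, tail t < e. Proof. exact: tail_small. Qed.
Let t0 t : 0 <= tail t. Proof. exact: tail_ge0. Qed.

Let ex_le u : u <= c -> exists t, u <= tail t.
Proof. by move=> uc; exists (-1); rewrite tail_neg. Qed.

Lemma level_lt u : 0 < u -> u <= c -> D `&` [set x | level x < u] = above (ginv tail u).
Proof.
move=> u0 uc; have hu := ex_le uc; apply/seteqP; split => x [Dx /= hx]; split => //=.
  by rewrite ltNge; apply/negP => /tn; rewrite (m_ginv tc tn ts u0 hu) leNgt hx.
rewrite ltNge; apply/negP => ux.
by have := sup_upper_bound (ginv_has_sup tn ts u0 hu) ux; rewrite leNgt hx.
Qed.

(** The analogue of the uniform law of a continuous distribution function: by [level_lt] the two
    measures agree on half-lines, because [tail] takes the value [u] at its generalised inverse. *)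
Lemma pushforward_level (N : set R) : measurable N ->
  mu (level @^-1` N) = leb (N `&` `[0, c]).
Proof.
have c0 : 0 <= c by exact: fine_ge0.
have mi : measurable (`[0, c]%classic : set (measurableTypeR R)) by exact: measurable_itv.
have ml : measurable_fun setT (level : marked d R -> measurableTypeR R) by exact: measurable_level.
pose m1 := image_measure mu ml.
pose m2 := [the {measure set (measurableTypeR R) -> \bar R} of mrestr leb mi].
move=> mN; suff : m1 N = m2 N by [].
refine (@measure_unique _ _ (measurableTypeR R) (@RGenInftyO.G R) (fun n : nat => `]-oo, n%:R[%classic)
  (RGenInftyO.measurableE R) _ _ _ m1 m2 _ _ N mN).
- move=> _ _ [x ->] [y ->]; exists (Num.min x y); apply/seteqP; split => z /=; rewrite !in_itv/= lt_min.
    by move=> [-> ->].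
  by move=> /andP.
- by move=> n; exists n%:R.
- apply/seteqP; split => // x0 _; pose x : R := x0; exists (Num.bound `|x|) => //=; rewrite in_itv/=.
  exact: (le_lt_trans (ler_norm x) (archi_boundP (normr_ge0 x))).
- move=> _ [u ->]; rewrite /m1 /m2.
  transitivity (mu (D `&` [set x | level x < u])).
    apply: (measure_cond bD.1 muD).
    + have := measurable_level measurableT (measurable_itv `]-oo, u[); rewrite setTI; apply.
    + apply: measurableI; first exact: bD.1.
      have := measurable_level measurableT (measurable_itv `]-oo, u[); rewrite setTI => /(_ _ _) h.
      by rewrite (_ : mkset _ = level @^-1` `]-oo, u[)//; apply/seteqP; split => x /=; rewrite in_itv.
    + by apply/seteqP; split => x /=; rewrite in_itv/= => -[]; [move=> ? ?; split|move=> [? ?]; split].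
  rewrite /= /mrestr; have [u0|u0] := leP u 0.
    rewrite (_ : _ `&` _ = set0); last first.
      by apply/seteqP; split => // x [_ /= /lt_le_trans/(_ u0)]; rewrite ltNge level_ge0.
    rewrite (_ : _ `&` _ = set0) ?measure0//.
    apply/seteqP; split => // x /=; rewrite !in_itv/= => -[xu /andP[x0 _]].
    by have := lt_le_trans xu (le_trans u0 x0); rewrite ltxx.
  have [uc|uc] := leP u c.
    rewrite level_lt// tailE// (m_ginv tc tn ts u0 (ex_le uc)).
    rewrite (_ : _ `&` _ = `[0, u[%classic).
      by rewrite lebesgue_measure_itv/= lte_fin u0 oppr0 adde0.
    apply/seteqP; split => x /=; rewrite !in_itv/=; first by move=> [-> /andP[->]].
    by move=> /andP[x0 xu]; rewrite x0 xu (le_trans (ltW xu) uc).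
  rewrite (_ : _ `&` _ = D); last first.
    by apply/seteqP; split => [x []//|x Dx]; split => //=; exact: le_lt_trans (level_le x) uc.
  rewrite (_ : _ `&` _ = `[0, c]%classic).
    rewrite lebesgue_measure_itv/= lte_fin; case: ltP => [_|c0'].
      by rewrite oppr0 adde0 -fin_mu//; exact: bD.1.
    rewrite fin_mu; last exact: bD.1.
    by congr EFin; apply/eqP; rewrite eq_le c0' c0.
  apply/seteqP; split => x /=; rewrite !in_itv/=; first by move=> [].
  by move=> /andP[x0 xc]; rewrite x0 xc (le_lt_trans xc uc).
- move=> n; have mn : measurable (level @^-1` `]-oo, n%:R[).
    by rewrite -[X in measurable X]setTI; apply: measurable_level => //; exact: measurable_itv.
  have -> : m1 `]-oo, n%:R[%classic = (fine (mu (level @^-1` `]-oo, n%:R[)))%:E by exact: fin_mu mn.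
  exact: ltry.
Qed.

Variables (G : marked d R -> R) (K : R).
Hypotheses (mG : measurable_fun setT G) (GK : forall x, D x -> 0 <= G x <= K).

(** Small levels are late ranks, so at the level of [x] this is, up to a null set, the integral of
    [G] over the points after [x]. *)
Definition cumulative (u : R) : R :=
  fine (\int[mu]_(x in D `&` [set x | (level x <= u)%R]) (G x)%:E)%E.

(** [G] read as a function of the level. The indicator of [D] is there because a level may be
    inverted to a number that is the rank of no point of [D], and [G] is bounded on [D] only. *)
Let gl (u : R) : R :=
  (if (0 < u) && (u <= c) then G (unrank v (ginv tail u)) * \1_D (unrank v (ginv tail u)) else 0).

Let mginv : measurable_fun (`]0, c]%classic : set R) (ginv tail).
Proof.
apply: (measurability (@RGenCInfty.G R)) => [|/= _ [_] [r] -> <-].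
  exact: RGenCInfty.measurableE.
apply: is_interval_measurable => s t /= [s1 s2] [t1 t2] u /andP[su ut].
move: s1 t1 s2 t2; rewrite /= !in_itv/= !andbT => /andP[s0 sc] /andP[_ tc'] rs rt.
have uc := le_trans ut tc'; have u0 := lt_le_trans s0 su.
by split; [apply/andP|exact: le_trans rt (le_ginv tn ts u0 ut (ex_le tc'))].
Qed.

Let mgl : measurable_fun setT gl.
Proof.
have mE : measurable (`]0, c]%classic : set R) by exact: measurable_itv.
pose f (u : R) := G (unrank v (ginv tail u)) * \1_D (unrank v (ginv tail u)).
have mf : measurable_fun (`]0, c]%classic : set R) f.
  have mu_ : measurable_fun (`]0, c]%classic : set R) (unrank v \o ginv tail).
    by apply: (measurable_comp measurableT (@subsetT _ _) (measurable_unrank v) mginv).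
  have mGD : measurable_fun setT (fun x => G x * \1_D x).
    by apply: measurable_funM => //; apply: measurable_indic; exact: bD.1.
  exact: (measurable_comp measurableT (@subsetT _ _) mGD mu_).
have := (measurable_restrictT f mE).1 mf; congr (measurable_fun _ _).
apply/funext => u; rewrite /patch /gl; congr (if _ then _ else _).
by apply/idP/idP; [move/set_mem; rewrite /= in_itv|move=> h; apply/mem_set; rewrite /= in_itv].
Qed.

Let gl_bound u : 0 <= gl u <= `|K|.
Proof.
rewrite /gl; case: ifP => _; last by rewrite lexx normr_ge0.
rewrite indicE; case: (boolP (_ \in D)) => [/set_mem Dx|_]; last by rewrite mulr0 lexx normr_ge0.
by rewrite mulr1; have /andP[-> h] := GK Dx; exact: le_trans h (ler_norm K).
Qed.

(** On a flat stretch of [tail] the generalised inverse need not return the rank. Such a stretch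
    contains a rational, so these countably many levels cover all bad ones, together with level
    0. *)
Let null_levels : set R := \bigcup_(q in [set: rat]) [set 0; tail (ratr q)].

Let null_levels0 : measurable null_levels /\ leb null_levels = 0%E.
Proof.
have cN : countable null_levels.
  apply: bigcup_countable => [|q _]; first exact: countableP.
  exact/finite_set_countable/finite_set2.
by split; [exact: countable_measurable|exact: countable_lebesgue_measure0].
Qed.

Let glE x : D x -> ~ null_levels (level x) -> 0 < level x /\ gl (level x) = G x.
Proof.
move=> Dx nx; have l0 : 0 < level x.
  by rewrite lt_neqAle level_ge0 andbT; apply/eqP => e; apply: nx; exists 0 => //; left.
split => //; have lc := level_le x; have hu := ex_le lc.
rewrite /gl l0 lc /= (_ : ginv tail (level x) = rk x); last first.
  apply/eqP; rewrite eq_le (sup_upper_bound (ginv_has_sup tn ts l0 hu))//= andbT.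
  rewrite leNgt; apply/negP => lt; have [q /itvP hq] := rat_in_itvoo lt.
  have h1 : level x <= tail (ratr q) by apply: (lt_ginv tc tn ts l0 hu); rewrite hq.
  have h2 : tail (ratr q) <= level x by apply: tn; rewrite hq.
  by apply: nx; exists q => //; right; apply/eqP; rewrite eq_le h1 h2.
by rewrite (rankK hv Dx) indicE mem_set// mulr1.
Qed.

(** After the change of variable to levels, [cumulative] is an indefinite Lebesgue integral of [gl].
    The exceptional levels pull back to a [mu]-null set of points by [pushforward_level]. *)
Lemma cumulative_derive : exists B, [/\ measurable B, mu B = 0%E &
  forall x, D x -> ~ B x -> 0 < level x /\ is_derive (level x) 1 cumulative (G x)].
Proof.
have mE : measurable (`[0, c]%classic : set (measurableTypeR R)) by exact: measurable_itv.
have [mN N0] := null_levels0.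
have ml N : measurable N -> measurable (level @^-1` N).
  by move=> mN'; rewrite -[X in measurable X]setTI; exact: measurable_level.
have nullP N : measurable N -> leb N = 0%E -> mu (level @^-1` N) = 0%E.
  move=> mN' hN; rewrite pushforward_level//.
  by apply: (subset_measure0 (mu := leb) _ _ _ hN) => //; exact: measurableI.
have cE : cumulative = fun u => (\int[leb]_(t in [set` `]-oo, u]]) (gl t))%R.
  apply/funext => u; rewrite /cumulative /Rintegral; congr fine.
  have mi : measurable_fun setT (fun t : R => (\1_(`]-oo, u]%classic) t)%:E : \bar R).
    by apply/measurable_EFinP; exact: measurable_indic.
  have mgi : measurable_fun setT (fun t : R => (gl t)%:E * (\1_(`]-oo, u]%classic) t)%:E)%E.
    by apply: emeasurable_funM => //; exact/measurable_EFinP.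
  have gi0 t : (0 <= (gl t)%:E * (\1_(`]-oo, u]%classic) t)%:E)%E.
    by rewrite -EFinM lee_fin mulr_ge0//; have /andP[] := gl_bound t.
  have mDu : measurable (D `&` [set x | level x <= u]).
    apply: measurableI; first exact: bD.1.
    rewrite (_ : mkset _ = level @^-1` `]-oo, u]); first by apply: ml; exact: measurable_itv.
    by apply/seteqP; split => x /=; rewrite in_itv.
  rewrite [LHS]integral_mkcond.
  transitivity (\int[mu]_x ((gl (level x))%:E * (\1_(`]-oo, u]%classic) (level x))%:E))%E.
    apply: (@integral_cond _ _ _ mu (D `&` ~` (level @^-1` null_levels))).
    - by apply: measurableI; [exact: bD.1|apply: measurableC; exact: ml].
    - rewrite setCI setCK; apply/eqP; rewrite eq_le measure_ge0 andbT.
      apply: (le_trans (measureU2 _ _ _)); [by apply: measurableC; exact: bD.1|exact: ml|].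
      by rewrite [X in (X + _)%E]muD add0e [leLHS]nullP.
    - apply/(measurable_restrictT (fun x => (G x)%:E) mDu).
      by apply/measurable_EFinP; exact: measurable_funTS.
    - exact: (measurableT_comp mgi measurable_level).
    - by move=> x; rewrite /patch; case: ifPn => // /set_mem[Dx _]; rewrite lee_fin; have /andP[] := GK Dx.
    - by move=> x; exact: gi0.
    - move=> x [Dx nx]; have [_ ->] := glE Dx nx; rewrite /patch indicE.
      case: (boolP (level x <= u)) => h.
        by rewrite !mem_set ?mule1//= in_itv.
      by rewrite !memNset ?mule0//= ?in_itv/= => [|[_ h']]; [apply/negP|rewrite h' in h].
  have ml' : measurable_fun setT (level : marked d R -> measurableTypeR R) by exact: measurable_level.
  rewrite -[LHS](@ge0_integral_image _ _ _ (measurableTypeR R) _ mu level ml' _ mgi gi0).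
  transitivity (\int[mrestr leb mE]_t ((gl t)%:E * (\1_(`]-oo, u]%classic) t)%:E))%E.
    apply: eq_measure_integral => N mN' _; exact: pushforward_level.
  rewrite ge0_integral_restrict// integral_mkcond [RHS]integral_mkcond; apply: eq_integral => t _.
  rewrite /patch !indicE; case: (boolP (t \in `]-oo, u]%classic)) => ht; rewrite ?mule1 ?mule0 ?if_same//.
  case: ifPn => // tE; rewrite /gl ifF//; apply/negP => /andP[t0' tc'].
  by move/negP: tE; apply; apply/mem_set; rewrite /= in_itv/= (ltW t0').
pose kk : \bar R := `|K|%:E; have kk0 : (0 <= kk)%E by rewrite lee_fin.
have leb0c : (lebesgue_measure (`[0%R, c]%classic : set R) < +oo)%E.
  by rewrite lebesgue_measure_itv/=; case: ifP => // _; rewrite ltry.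
have fin u : leb.-integrable `]-oo, u] (EFin \o gl).
  apply/integrableP; split; first by apply/measurable_EFinP; exact: measurable_funTS.
  have hk : (\int[leb]_(t in `[0%R, c]) (cst kk) t < +oo)%E.
    rewrite integral_cst// lte_mul_pinfty// ?lee_fin//.
  apply: le_lt_trans hk; rewrite [leLHS]integral_mkcond [leRHS]integral_mkcond; apply: ge0_le_integral => //.
  - by move=> t _; rewrite /patch; case: ifP => //= _; rewrite lee_fin.
  - apply/(measurable_restrictT (fun t => `|(gl t)%:E|%E) (measurable_itv _)).
    by apply: measurableT_comp => //; apply/measurable_EFinP; exact: measurable_funTS.
  - by apply/(measurable_restrictT (cst kk) mE); exact: measurable_cst.
  - move=> t _; have /andP[g0 g1] := gl_bound t; rewrite /patch.
    case: (boolP (t \in `[0, c]%classic)) => tE.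
      by case: ifP => _; rewrite /= ?lee_fin// ger0_norm.
    have gt : gl t = 0.
      rewrite /gl ifF//; apply/negP => /andP[t0' tc'].
      by move/negP: tE; apply; apply/mem_set; rewrite /= in_itv/= (ltW t0').
    by case: ifP => //= _; rewrite gt normr0.
have locf : locally_integrable [set: R] gl.
  split => //; first exact: openT.
  move=> C CT cC; have mC := compact_measurable cC.
  have hk : (\int[leb]_(t in C) (cst kk) t < +oo)%E.
    by rewrite integral_cst// lte_mul_pinfty// compact_finite_measure.
  apply: le_lt_trans hk.
    apply: ge0_le_integral => //.
    - by apply/measurable_EFinP; apply: measurableT_comp => //; exact: measurable_funTS.
    - by move=> t _; have /andP[g0 g1] := gl_bound t; rewrite /= lee_fin ger0_norm.
have [N [mN' hN0 hN]] := FTC1Ny fin locf.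
exists (level @^-1` (N `|` null_levels)); split.
- by apply: ml; exact: measurableU.
- apply: nullP; first exact: measurableU.
  apply/eqP; rewrite eq_le measure_ge0 andbT.
  by apply: (le_trans (measureU2 _ _ _)) => //; rewrite [X in (X + _)%E]hN0 add0e [leLHS]N0.
- move=> x Dx nx; have [l0 gx] := glE Dx (fun h => nx (or_intror h)); split => //.
  have [h1 h2] : derivable cumulative (level x) 1 /\ derive1 cumulative (level x) = gl (level x).
    by apply: contrapT => h; apply: nx; left; apply: hN => /=; rewrite -cE.
  by apply: DeriveDef => //; rewrite -derive1E h2.
Qed.

End levels.

(** The set of convergence is measurable by the Cauchy criterion with countably many parameters, and
    off this set [lim] is a fixed default value. *)
Lemma measurable_lim d (T : measurableType d) (R : realType) (u : nat -> T -> R) :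
  (forall n, measurable_fun setT (u n)) -> measurable_fun setT (fun x => lim (u ^~ x @ \oo)).
Proof.
move=> mu; pose C := \bigcap_(k : nat) \bigcup_(N : nat) \bigcap_(n : nat)
  [set x | (N <= n)%N -> `|u N x - u n x| < k.+1%:R^-1].
have CP x : C x <-> cvg (u ^~ x @ \oo).
  split => [Cx|cx].
    apply: cauchy_cvg; apply: cauchy_exP => e e0; have [k ke] := ltr_add_invr e0.
    have [N _ hN] := Cx k I; exists (u N x); exists N => // n /= Nn.
    rewrite /ball /=; apply: lt_trans (hN n I Nn) _.
    by move: ke; rewrite add0r.
  move=> k _; have e0 : 0 < k.+1%:R^-1 / 2 :> R by rewrite divr_gt0.
  move/cvgrPdist_lt: cx => /(_ _ e0)[N _ hN]; exists N => // n _ Nn.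
  have h1 := hN N (leqnn N); have h2 := hN n Nn.
  rewrite -(subrK (lim (u ^~ x @ \oo)) (u N x)) -addrA; apply: (le_lt_trans (ler_normD _ _)).
  by rewrite [ltRHS]splitr ltrD// distrC.
have mC : measurable C.
  apply: bigcapT_measurable => k; apply: bigcupT_measurable => N; apply: bigcapT_measurable => n.
  have [Nn|Nn] := leqP N n; last by rewrite (_ : mkset _ = setT)//; apply/seteqP; split.
  have mf : measurable_fun setT (fun x => `|u N x - u n x|).
    by apply: measurableT_comp => //; exact: measurable_funB.
  have := mf measurableT _ (measurable_itv `]-oo, k.+1%:R^-1[); rewrite setTI.
  congr measurable; apply/seteqP; split => x /=; first by rewrite in_itv/=.
  by rewrite in_itv/=; apply.
apply: (measurable_fun_cvg (h := fun n x => if x \in C then u n x else point)) => [n|x _].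
  apply: measurable_fun_ifT => //; apply: (measurable_fun_bool true); rewrite setTI.
  by rewrite (_ : _ @^-1` _ = C)//; apply/seteqP; split => x; [exact: set_mem|exact: mem_set].
case: (boolP (x \in C)) => [/set_mem/CP//|/negP xC].
rewrite dvgP; first exact: cvg_cst.
by move=> cx; apply: xC; apply/mem_set/CP.
Qed.

(** * One-sided derivatives along the order as sequential limits *)

Section level_limits.
Variables (R : realType) (d : nat) (Q : set (mark R) -> \bar R).
Variables (mu : {finite_measure set (marked d R) -> \bar R}) (lam : R) (lam0 : 0 < lam).
Variables (D : set (marked d R)) (bD : Sbp D).
Hypotheses (muD : mu (~` D) = 0%E) (mu1 : forall X, mu [set X] = 0%E).
Hypothesis muE : forall A, mu A = (lam%:E * Qstar Q (A `&` D))%E.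
Variables (v : position d R) (hv : nonneg_shift v D).
Local Notation rk := (rank v).
Local Notation above := (above D v).
Local Notation tail := (tail mu D v).
Local Notation level := (level mu D v).

Lemma Qstar_mu A : measurable A -> A `<=` D -> Qstar Q A = (fine (mu A) / lam)%:E.
Proof.
move=> mA AD; have h : (lam%:E * Qstar Q A = (fine (mu A))%:E)%E.
  by rewrite -fin_mu// muE (setIidl AD).
have := congr1 (fun y => (lam^-1)%:E * y)%E h; rewrite muleA -EFinM mulVf ?gt_eqF// mul1e => ->.
by rewrite -EFinM mulrC.
Qed.

Lemma tailB s t : s <= t -> mu (above s `\` above t) = (tail s - tail t)%:E.
Proof.
move=> st; rewrite EFinB -!tailE// [LHS]measureD//.
- by rewrite (setIidr (sub_above st)).
- exact: measurable_aboveD.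
- exact: measurable_aboveD.
- by rewrite -ge0_fin_numE// fin_num_measure//; exact: measurable_aboveD.
Qed.

Lemma mu_upper t : (exists2 X, D X & rk X = t) -> mu (upper D v t) = (tail t)%:E.
Proof.
move=> [X DX <-]; rewrite -tailE//.
apply: (@measure_cond _ _ _ mu (~` [set X])).
- by apply: measurableC; exact: measurable_marked1.
- by rewrite setCK; exact: mu1.
- exact: (Sbp_upper bD v _).1.
- exact: measurable_aboveD.
- rewrite (upper_diff hv DX); apply/seteqP; split => Y.
    by move=> [[h|->] nX]; [split|case: nX].
  by move=> [h nX]; split => //; left.
Qed.

Lemma Qstar_prec_cc X Y : D X -> rk X <= rk Y ->
  Qstar Q (prec_cc v D X Y) = ((level X - level Y) / lam)%:E.
Proof.
move=> DX XY; have ccE : prec_cc v D X Y = upper D v (rk X) `\` above (rk Y).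
  apply/seteqP; split => W.
    by move=> [DW XW WY]; split => // -[_ /=]; rewrite ltNge; move/negP; apply.
  move=> [[DW XW] h]; split => //; rewrite /prec leNgt; apply/negP => YW; exact: h.
have mU : measurable (upper D v (rk X)) := (Sbp_upper bD v _).1.
have mV := measurable_aboveD bD v (rk Y).
have mcc : measurable (prec_cc v D X Y) by rewrite ccE; exact: measurableD.
rewrite (Qstar_mu mcc); last by move=> W [].
suff -> : mu (prec_cc v D X Y) = (level X - level Y)%:E by [].
rewrite -tailB; last exact: XY.
apply: (@measure_cond _ _ _ mu (~` [set X])) => //.
- by apply: measurableC; exact: measurable_marked1.
- by rewrite setCK; exact: mu1.
- by apply: measurableD; exact: measurable_aboveD.
- rewrite ccE (upper_diff hv DX); apply/seteqP; split => W [[h1 h2] h3]; split => //; split => //.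
    by case: h1.
  by left.
Qed.

(** The law of [level] gives positive mass to every such interval, while the complement of [D] is
    null. *)
Lemma level_dense s r : 0 <= s -> s < r -> r <= fine (mu D) -> exists2 Y, D Y & s < level Y < r.
Proof.
move=> s0 sr rD; apply: contrapT => h.
have : mu (level @^-1` `]s, r[) = 0%E.
  apply: (subset_measure0 (mu := mu) _ _ _ muD).
  - by rewrite -[X in measurable X]setTI; apply: measurable_level => //; exact: measurable_itv.
  - by apply: measurableC; exact: bD.1.
  - by move=> Y /=; rewrite in_itv/= => hY DY; apply: h; exists Y.
rewrite (pushforward_level bD muD mu1 hv)// (_ : _ `&` _ = `]s, r[%classic).
  rewrite lebesgue_measure_itv/= lte_fin sr -EFinB => /eqP; rewrite eqe subr_eq0 => /eqP e.
  by rewrite e ltxx in sr.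
apply/seteqP; split => x /=; rewrite !in_itv/=; first by move=> [].
by move=> /andP[sx xr]; rewrite sx xr (le_trans s0 (ltW sx)) (le_trans (ltW xr) rD).
Qed.

Variables (X : marked d R) (DX : D X).
Local Notation u := (level X).
Hypothesis u0 : 0 < u.
Variables (F : R -> R) (f : marked d R -> R).
Hypothesis F_nd : forall s t, 0 <= s -> s <= t -> t <= u -> F s <= F t.
Hypothesis F_cont : forall w, 0 < w -> w < u -> {for w, continuous F}.
Hypothesis fF : forall Y, D Y -> rk X <= rk Y -> f Y = F (level Y).

(** The difference quotient in the level variable: levels decrease along the order, whence [u - h],
    and [Qstar] is [mu] divided by [lam], whence the factor. *)
Definition slope (h : R) : R := lam * (F (u - h) - F u) / h.

Let diff_slope Y : D Y -> rk X <= rk Y -> level Y < u ->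
  diff_quotient Q v D f X Y = slope (u - level Y).
Proof.
move=> DY XY Yu; rewrite /diff_quotient Qstar_prec_cc//= !fF// /slope opprB addrCA subrr addr0.
by field; rewrite subr_eq0 !gt_eqF.
Qed.

Let near_right (e : R) Y : D Y -> rk X <= rk Y ->
  (0 < Qstar Q (prec_cc v D X Y) < e%:E)%E = (0 < u - level Y < lam * e).
Proof.
by move=> DY XY; rewrite Qstar_prec_cc// !lte_fin ltr_pdivlMr// mul0r ltr_pdivrMr// (mulrC e).
Qed.

Let slope_cont h : 0 < h -> h < u -> {for h, continuous slope}.
Proof.
move=> h0 hu; rewrite /slope; apply: cvgM.
  apply: cvgM; first exact: cvg_cst.
  apply: cvgB; last exact: cvg_cst.
  apply: (@cvg_comp _ _ _ (fun h => u - h) F); last by apply: F_cont; lra.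
  by apply: cvgB; [exact: cvg_cst|exact: cvg_id].
by apply: cvgV; [rewrite gt_eqF|exact: cvg_id].
Qed.

(** Starting at one half of [u] keeps [u - step n] in the open interval where [F] is known to be
    continuous. *)
Let step (n : nat) : R := u / n.+2%:R.

Let step_gt0 n : 0 < step n. Proof. by rewrite divr_gt0. Qed.

Let step_lt n : step n < u.
Proof. by rewrite ltr_pdivrMr// ltr_pMr// ltr1n. Qed.

Let cvg_step : step @ \oo --> 0.
Proof.
rewrite -(mulr0 u); apply: cvgM; first exact: cvg_cst.
have := @cvg_harmonic R; rewrite -cvg_shiftS => h; exact: h.
Qed.

Let ge_step (h : R) : 0 < h -> h <= step 0 -> exists n, step n.+1 <= h <= step n.
Proof.
move=> h0 hs; have y0 : 0 <= u / h by rewrite divr_ge0// ltW.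
(* With [k] the integer part of [u / h], the number [h] lies between [u / k.+1] and [u / k]; the
   index is then shifted by the 2 in [step]. *)
pose k := absz (Num.floor (u / h)).
have kE : (k%:R : R) = (Num.floor (u / h))%:~R by rewrite /k natr_absz ger0_norm// floor_ge0.
have k1 : k%:R <= u / h by rewrite kE floor_le_tmp.
have k2 : u / h < k.+1%:R by rewrite -natr1 kE -[X in _ + X]/(1%:~R) -intrD floorD1_gt.
have h2 : 2 <= u / h.
  by rewrite ler_pdivlMr//; move: hs; rewrite /step ler_pdivlMr// mulrC.
have k3 : (2 <= k)%N by rewrite -ltnS -(ltr_nat R); exact: le_lt_trans h2 k2.
have kk : ((k - 2).+2 = k)%N by lia.
exists (k - 2)%N; rewrite /step kk; apply/andP; split.
  by rewrite ler_pdivrMr// mulrC -ler_pdivrMr// ltW.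
by rewrite ler_pdivlMr ?ltr0n ?(ltn_trans _ k3)// mulrC -ler_pdivlMr.
Qed.

Lemma right_nbhs_filter : Filter (right_nbhs Q v D X).
Proof.
apply: filter_from_filter; first by exists 1; exact: ltr01.
move=> i j i0 j0; exists (Num.min i j); first by rewrite /mkset lt_min i0 j0.
move=> Y [DY XY /andP[h0 h1]]; split; split; rewrite // h0 /=; apply: (lt_le_trans h1).
  by rewrite lee_fin ge_min lexx.
by rewrite lee_fin ge_min lexx orbT.
Qed.

(** From left to right, every step is approximated by the level of a point of [D], by density and
    continuity. From right to left, monotonicity of [F] encloses the slope at [h] between the slopes
    at the two neighbouring steps, rescaled by ratios of consecutive steps, which tend to 1. *)
Lemma cvg_diff_quotient (l : R) :
  diff_quotient Q v D f X Y @[Y --> right_nbhs Q v D X] --> l <->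
  (fun n : nat => slope (u / n.+2%:R)) @ \oo --> l.
Proof.
have FF := right_nbhs_filter.
have uD : u <= fine (mu D) by exact: level_le.
split => hl.
  apply/cvgrPdist_lt => e e0; have e2 : 0 < e / 2 by rewrite divr_gt0.
  have /cvgrPdist_lt/(_ _ e2) : diff_quotient Q v D f X Y @[Y --> right_nbhs Q v D X] --> l by [].
  move=> [r /= r0 hr].
  have lr : 0 < lam * r by rewrite mulr_gt0.
  have /cvgrPdist_lt/(_ _ lr) := cvg_step; apply: filterS => n /=.
  rewrite sub0r normrN (gtr0_norm (step_gt0 n)) => nr.
  have /cvgrPdist_lt/(_ _ e2) := slope_cont (step_gt0 n) (step_lt n).
  move=> [del /= del0 hdel].
  pose s := u - step n; have s0 : 0 < s by rewrite subr_gt0.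
  have su : s < u by rewrite ltrBlDr ltrDl.
  (* The level of [Y] is chosen just above [u - step n], within the continuity radius and still
     below [u]. *)
  pose r1 := Num.min u (s + del).
  have sr1 : s < r1 by rewrite lt_min su ltrDl.
  have r1u : r1 <= fine (mu D) by rewrite ge_min uD.
  have [Y DY /andP[sY Yr]] := level_dense (ltW s0) sr1 r1u.
  move: Yr; rewrite lt_min => /andP[Yu Yd].
  have XY : rk X <= rk Y.
    by rewrite leNgt; apply/negP => /ltW/(tail_ni mu bD v); rewrite leNgt Yu.
  have h1 : `|l - slope (u - level Y)| < e / 2.
    rewrite -diff_slope//; apply: hr; split => //; rewrite near_right//.
    by rewrite subr_gt0 Yu /=; apply: lt_trans nr; rewrite ltrBlDr -ltrBlDl.
  have h2 : `|slope (step n) - slope (u - level Y)| < e / 2.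
    apply: hdel; rewrite /ball_ /= opprB addrA addrAC -/(step n).
    have -> : step n - u + level Y = level Y - s by rewrite /s opprB; ring.
    by rewrite gtr0_norm ?subr_gt0// ltrBlDl.
  rewrite -(subrK (slope (u - level Y)) l) -addrA; apply: (le_lt_trans (ler_normD _ _)).
  by rewrite [ltRHS]splitr ltrD// distrC.
apply/cvgrPdist_lt => e e0.
have hr (n : nat) : step n.+1 / step n = 1 - n.+3%:R^-1.
  have n3 : (n.+3%:R : R) = n.+2%:R + 1 by rewrite natr1.
  rewrite /step n3; have : (n.+2%:R : R) != 0 by rewrite pnatr_eq0.
  have : (n.+2%:R + 1 : R) != 0 by rewrite natr1 pnatr_eq0.
  move: (n.+2%:R : R) => m m1 m2; field; rewrite m1 m2 gt_eqF//.
have hr' (n : nat) : step n / step n.+1 = 1 + n.+2%:R^-1.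
  have n3 : (n.+3%:R : R) = n.+2%:R + 1 by rewrite natr1.
  rewrite /step n3; have : (n.+2%:R : R) != 0 by rewrite pnatr_eq0.
  have : (n.+2%:R + 1 : R) != 0 by rewrite natr1 pnatr_eq0.
  move: (n.+2%:R : R) => m m1 m2; field; rewrite m1 m2 gt_eqF//.
pose a n := slope (step n).
have hh : (fun n => @harmonic R n.+1) @ \oo --> 0 by have := @cvg_harmonic R; rewrite -cvg_shiftS.
have hh' : (fun n => @harmonic R n.+2) @ \oo --> 0 by move: hh; rewrite -cvg_shiftS.
have cb : (fun n => a n.+1 * (step n.+1 / step n)) @ \oo --> l.
  rewrite -[l in X in _ --> X](mulr1 l); apply: cvgM; first by move: hl; rewrite -cvg_shiftS.
  have h1 : (fun n : nat => 1 - n.+3%:R^-1 : R) @ \oo --> 1 - (0 : R).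
    by apply: cvgB; [exact: cvg_cst|exact: hh'].
  by under eq_fun do rewrite hr; rewrite subr0 in h1; exact: h1.
have cc : (fun n => a n * (step n / step n.+1)) @ \oo --> l.
  rewrite -[l in X in _ --> X](mulr1 l); apply: cvgM; first exact: hl.
  have h1 : (fun n : nat => 1 + n.+2%:R^-1 : R) @ \oo --> 1 + (0 : R).
    by apply: cvgD; [exact: cvg_cst|exact: hh].
  by under eq_fun do rewrite hr'; rewrite addr0 in h1; exact: h1.
move/cvgrPdist_lt: cb => /(_ _ e0)[N1 _ hN1]; move/cvgrPdist_lt: cc => /(_ _ e0)[N2 _ hN2].
pose N := maxn N1 N2.
exists (step N / lam) => /=; first by rewrite divr_gt0.
move=> Y [DY XY]; rewrite near_right// => /andP[h0 hN].
rewrite diff_slope//; last by rewrite -subr_gt0.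
move: h0 hN; rewrite mulrCA divff ?gt_eqF// mulr1; set h := u - level Y => h0 hN.
have step_ni (i j : nat) : (i <= j)%N -> step j <= step i.
  by move=> ij; rewrite ler_pM2l// lef_pV2 ?posrE// ler_nat !ltnS.
have [n /andP[n1 n2]] : exists n, step n.+1 <= h <= step n.
  by apply: ge_step => //; apply: le_trans (ltW hN) _; exact: step_ni.
have Nn : (N <= n)%N.
  by rewrite leqNgt; apply/negP => nN; have := le_lt_trans (le_trans (step_ni _ _ nN) n1) hN; rewrite ltxx.
have hu : h <= u by rewrite gerBl level_ge0.
(* The slope is minus [lam * A h / h] with [A] nondecreasing; the numerator and the denominator are
   bounded by their values at the steps around [h]. *)
pose A t := F u - F (u - t).
have A_nd s t : 0 <= s -> s <= t -> t <= u -> A s <= A t.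
  by move=> s0 st tu; rewrite lerB// F_nd//; lra.
have A_ge0 t : 0 <= t -> t <= u -> 0 <= A t.
  by move=> t0 tu; rewrite subr_ge0 F_nd//; lra.
have sA t : slope t = - (lam * A t / t) by rewrite /slope /A; ring.
have up : slope h <= a n.+1 * (step n.+1 / step n).
  have -> : a n.+1 * (step n.+1 / step n) = - (lam * A (step n.+1) / step n).
    by rewrite /a sA; field; rewrite !gt_eqF.
  rewrite sA lerN2; apply: ler_pM.
  - by rewrite mulr_ge0 ?A_ge0// ltW.
  - by rewrite invr_ge0 ltW.
  - by rewrite ler_pM2l// A_nd// ltW.
  - by rewrite lef_pV2 ?posrE.
have low : a n * (step n / step n.+1) <= slope h.
  have -> : a n * (step n / step n.+1) = - (lam * A (step n) / step n.+1).
    by rewrite /a sA; field; rewrite !gt_eqF.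
  rewrite sA lerN2; apply: ler_pM.
  - by rewrite mulr_ge0 ?A_ge0// ltW.
  - by rewrite invr_ge0 ltW.
  - by rewrite ler_pM2l// A_nd// ltW.
  - by rewrite lef_pV2 ?posrE.
have := hN1 n (leq_trans (leq_maxl _ _) Nn); have := hN2 n (leq_trans (leq_maxr _ _) Nn).
move: up low; move: (a n.+1 * _) (a n * _) (slope h) => p1 p2 p3 up low.
rewrite !ltr_norml => /andP[q1 q2] /andP[q3 q4]; apply/andP; split; lra.
Qed.

End level_limits.

(** [lim] is a choice among the limits, so equal sets of limits give the same value even without
    convergence. *)
Lemma eq_lim (R : realType) (F G : set_system R) : (forall l : R, F --> l <-> G --> l) -> lim F = lim G.
Proof. by move=> h; congr get; apply/funext => l; apply/propext. Qed.

(** * The thinning probability as a limit of slopes *)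

Section thinning_probability.
Variables (R : realType) (d : nat) (Q : set (mark R) -> \bar R).
Variables (H : hamiltonian_family R d) (hH : is_hamiltonian H).
Variables (b : R) (b0 : 0 <= b).
Hypothesis H_le : forall (X : marked d R) (w : config R d), ~ pts w X ->
  (expeR (- H [set X] (config_single X) w) <= b%:E)%E.
Variables (mu : {finite_measure set (marked d R) -> \bar R}) (lam : R) (lam0 : 0 < lam).
Variables (D : set (marked d R)) (bD : Sbp D).
Hypotheses (muD : mu (~` D) = 0%E) (mu1 : forall X, mu [set X] = 0%E).
Hypothesis muE : forall A, mu A = (lam%:E * Qstar Q (A `&` D))%E.
Variables (v : position d R) (hv : nonneg_shift v D).
Local Notation config := (config R d).
Local Notation rk := (rank v).
Local Notation above := (above D v).
Local Notation tail := (tail mu D v).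
Local Notation level := (level mu D v).
Local Notation part := (part H mu D v).
Local Notation insertion := (insertion H mu D v).
Local Notation ratio := (ratio H mu D v).
Implicit Types (w g : config) (x X Y : marked d R).

Let mI g : measurable_fun setT (fun x => insertion x g).
Proof.
exact: (measurableT_comp (measurable_insertion hH mu bD v) (measurable_pairr g)).
Qed.

Let IK g x : D x -> 0 <= insertion x g <= b * expR (b * fine (mu setT)).
Proof. exact: insertion_bound. Qed.

Let K : R := b * expR (b * fine (mu setT)).
Let K0 : 0 <= K. Proof. by rewrite mulr_ge0// expR_ge0. Qed.

Let ml : measurable_fun setT level. Proof. exact: measurable_level. Qed.

Let mlevel (N : set R) : measurable N -> measurable (level @^-1` N).
Proof. by move=> mN; rewrite -[X in measurable X]setTI; exact: ml. Qed.

Local Notation cum g := (cumulative mu D v (insertion ^~ g)).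

Let mle t : measurable (D `&` [set x | level x <= t]).
Proof.
apply: measurableI; first exact: bD.1.
rewrite (_ : mkset _ = level @^-1` `]-oo, t]); first by apply: mlevel; exact: measurable_itv.
by apply/seteqP; split => x /=; rewrite in_itv.
Qed.

Lemma cumE g t : (\int[mu]_(x in D `&` [set x | (level x <= t)%R]) (insertion x g)%:E = (cum g t)%:E)%E.
Proof. by have [] := bounded_integral mu (mle t) (mI g) (fun x Vx => @IK g x Vx.1). Qed.

Lemma cum_ge0 g t : 0 <= cum g t.
Proof. by have [] := bounded_integral mu (mle t) (mI g) (fun x Vx => @IK g x Vx.1). Qed.

(** [insertion] is at most [K] on [D], and the points whose level is in an interval have mass equal
    to its length. *)
Lemma cumB g s t : 0 <= s -> s <= t -> t <= fine (mu D) -> 0 <= cum g t - cum g s <= K * (t - s).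
Proof.
move=> s0 st tD; pose E := D `&` [set x | s < level x <= t].
have mE : measurable E.
  apply: measurableI; first exact: bD.1.
  rewrite (_ : mkset _ = level @^-1` `]s, t]); first by apply: mlevel; exact: measurable_itv.
  by apply/seteqP; split => x /=; rewrite in_itv.
have [h1 h2 h3] := bounded_integral mu mE (mI g) (fun x Vx => @IK g x Vx.1).
have tE : D `&` [set x | level x <= t] = (D `&` [set x | level x <= s]) `|` E.
  apply/seteqP; split => x /=.
    move=> [Dx xt]; have [xs|sx] := leP (level x) s; first by left.
    by right; split => //=; rewrite sx.
  by move=> [[Dx xs]|[Dx /andP[sx xt]]]; split => //; exact: le_trans st.
have e : (cum g t)%:E = ((cum g s)%:E + (fine (\int[mu]_(x in E) (insertion x g)%:E))%:E)%E.
  rewrite -cumE tE ge0_integral_setU//.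
  - by rewrite cumE -h1.
  - by rewrite -tE; apply/measurable_EFinP; exact: measurable_funTS.
  - by move=> x; rewrite -tE => -[Dx _]; rewrite lee_fin; have /andP[] := IK g Dx.
  - by apply/disj_setPS => x [[_ /= h] [_ /andP[h' _]]]; move: (lt_le_trans h' h); rewrite ltxx.
move: e; rewrite -EFinD => -[->]; rewrite addrC addKr h2 /=; apply: (le_trans h3).
rewrite ler_wpM2l// -lee_fin -fin_mu//.
have -> : mu E = lebesgue_measure ((`]s, t]%classic : set R) `&` `[0, fine (mu D)]).
  rewrite -(pushforward_level bD muD mu1 hv); last exact: measurable_itv.
  apply: (measure_cond bD.1 muD) => //; first by apply: mlevel; exact: measurable_itv.
  by apply/seteqP; split => x /=; rewrite in_itv/=; [move=> [[]]|move=> []].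
rewrite (_ : _ `&` _ = `]s, t]%classic).
  by rewrite lebesgue_measure_itv/= lte_fin; case: ifP => [_|/negbT]; rewrite ?EFinB// lee_fin subr_ge0.
apply/seteqP; split => x /=; rewrite !in_itv/=; first by move=> [].
by move=> /andP[sx xt]; rewrite sx xt (le_trans s0 (ltW sx)) (le_trans xt tD).
Qed.

(** Lying above the rank of [Y] and having at most its level are the same condition, except for the
    points that share the level of [Y], which form a null set. *)
Lemma part_cum g Y : D Y -> pts g `&` above (rk Y) = set0 -> part (rk Y) g = 1 + cum g (level Y).
Proof.
move=> DY gY; apply: EFin_inj; rewrite (part_insertion hH b0 H_le bD muD mu1 hv gY) EFinD; congr (_ + _)%E.
rewrite -cumE [LHS]integral_mkcond [RHS]integral_mkcond.
have mV := measurable_aboveD bD v (rk Y).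
have mS : measurable ([set level Y] : set R) by exact: measurable_set1.
apply: (@integral_cond _ _ _ mu (~` (level @^-1` [set level Y]))).
- by apply: measurableC; exact: mlevel.
- rewrite setCK; apply: etrans (pushforward_level bD muD mu1 hv mS) _.
  apply: (subset_measure0 (mu := @lebesgue_measure R) _ _ _ (lebesgue_measure_set1 (level Y))) => //.
  by apply: measurableI => //; exact: measurable_itv.
- by apply/(measurable_restrictT (fun x => (insertion x g)%:E) mV); apply/measurable_EFinP; exact: measurable_funTS.
- by apply/(measurable_restrictT (fun x => (insertion x g)%:E) (mle _)); apply/measurable_EFinP; exact: measurable_funTS.
- by move=> x; rewrite /patch; case: ifP => // _; rewrite lee_fin (insertion_ge0 hH b0 H_le bD muD mu1 hv).
- by move=> x; rewrite /patch; case: ifP => // _; rewrite lee_fin (insertion_ge0 hH b0 H_le bD muD mu1 hv).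
- move=> x nx; rewrite /patch; congr (if _ then _ else _); apply/idP/idP => /set_mem[Dx /= h]; apply: mem_set; split => //=.
    by apply: tail_ni => //; exact: ltW.
  rewrite ltNge; apply/negP => xY; apply: nx => /=; apply/eqP; rewrite eq_le h /=.
  exact: tail_ni.
Qed.

Definition log_part g (t : R) : R := ln (1 + cum g t).

Lemma log_part_nd g s t : 0 <= s -> s <= t -> t <= fine (mu D) -> log_part g s <= log_part g t.
Proof.
move=> s0 st tD; have /andP[h _] := cumB g s0 st tD.
have h1 := cum_ge0 g s; have h2 := cum_ge0 g t.
by rewrite ler_ln ?posrE; lra.
Qed.

Lemma log_part_cont g t : 0 < t -> t < fine (mu D) -> {for t, continuous (log_part g)}.
Proof.
move=> t0 tD; suff h : {for t, continuous (@ln R \o (fun s : R => 1 + cum g s))} by exact: h.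
apply: continuous_comp; last by apply: continuous_ln; have := cum_ge0 g t; lra.
apply: cvgD; first exact: cvg_cst.
apply/cvgrPdist_lt => e e0.
exists (Num.min (Num.min t (fine (mu D) - t)) (e / (K + 1))) => /=.
  by rewrite !lt_min t0 subr_gt0 tD divr_gt0// ltr_wpDl.
move=> s /=; rewrite !lt_min => /andP[/andP[h1 h2] h3].
have h4 : (K + 1) * `|t - s| < e by rewrite mulrC -ltr_pdivlMr// ltr_wpDl.
have s0 : 0 <= s by move: h1; rewrite ltr_norml => /andP[_]; lra.
have sD : s <= fine (mu D) by move: h2; rewrite ltr_norml => /andP[+ _]; lra.
apply: le_lt_trans h4; have [st|ts] := leP s t.
  have /andP[l1 l2] := cumB g s0 st (ltW tD).
  rewrite !ger0_norm ?subr_ge0//; last lra.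
  by apply: (le_trans l2); rewrite ler_wpM2r ?subr_ge0// lerDl.
have /andP[l1 l2] := cumB g (ltW t0) (ltW ts) sD.
rewrite distrC (distrC t) !ger0_norm ?subr_ge0 ?(ltW ts)//; last lra.
by apply: (le_trans l2); rewrite ler_wpM2r ?subr_ge0 ?(ltW ts)// lerDl.
Qed.

Definition slopes (n : nat) (p : marked d R * config) : R :=
  slope mu lam D v p.1 (log_part p.2) (level p.1 / n.+2%:R).

Lemma measurable_cum : measurable_fun setT (fun p : R * config => cum p.2 p.1).
Proof.
pose f (p : (R * config) * marked d R) : \bar R :=
  (insertion p.2 p.1.2 * (\1_D p.2 * \1_(`]-oo, 0]%classic) (level p.2 - p.1.1)))%:E.
have m1 : measurable_fun setT (fun p : (R * config) * marked d R => p.1.1).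
  by apply: (measurableT_comp (f := fst)); [exact: measurable_fst|exact: measurable_fst].
have m2 : measurable_fun setT (fun p : (R * config) * marked d R => p.1.2).
  by apply: (measurableT_comp (f := snd)); [exact: measurable_snd|exact: measurable_fst].
have mf : measurable_fun setT f.
  apply/measurable_EFinP; apply: measurable_funM.
    exact: (measurable_curried (F := insertion) (measurable_insertion hH mu bD v) measurable_snd m2).
  apply: measurable_funM.
    by apply: (measurableT_comp (f := (\1_D : marked d R -> R))); [apply: measurable_indic; exact: bD.1|exact: measurable_snd].
  apply: (measurableT_comp (f := \1_(`]-oo, 0]%classic) : R -> R)); first exact: measurable_indic.
  apply: measurable_funB => //.
  exact: (measurableT_comp ml measurable_snd).
have f0 p : (0 <= f p)%E.
  rewrite lee_fin; apply: mulr_ge0; first exact: (insertion_ge0 hH b0 H_le bD muD mu1 hv).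
  by apply: mulr_ge0; rewrite indicE.
rewrite (_ : (fun _ => _) = fun p : R * config => fine (\int[mu]_x f (p, x))%E).
  apply: (measurableT_comp (f := fine)); first exact: fine_measurable.
  exact: (measurable_integral_snd mu mf f0).
apply/funext => -[t g]; congr fine; rewrite [LHS]integral_mkcond; apply: eq_integral => x _.
rewrite /patch /f /=; have [[Dx xt]|h] := pselect ((D `&` [set x | level x <= t]) x).
  rewrite mem_set// !indicE (mem_set Dx) mem_set ?mulr1//=.
  by rewrite in_itv/= subr_le0.
rewrite memNset// !indicE; case: (boolP (x \in D)) => [/set_mem Dx|_]; last by rewrite mul0r mulr0.
by rewrite memNset ?mulr0//= in_itv/= subr_le0 => xt; exact: h.
Qed.

Let m_log_part : measurable_fun setT (fun p : R * config => log_part p.2 p.1).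
Proof.
by apply: measurableT_comp; [exact: measurable_ln|apply: measurable_funD => //; exact: measurable_cum].
Qed.

Let m_level_fst : measurable_fun setT (fun p : marked d R * config => level p.1).
Proof. by apply: (measurableT_comp ml); exact: measurable_fst. Qed.

Let measurable_inv : measurable_fun setT (fun p : marked d R * config => (level p.1)^-1).
Proof.
rewrite (_ : (fun _ => _) = fun p : marked d R * config => (Num.max (level p.1) 0)^-1).
  by apply: (measurableT_comp (@measurable_inv_ge0 R)).
by apply/funext => p; rewrite max_l// level_ge0.
Qed.

Lemma measurable_slopes n : measurable_fun setT (slopes n).
Proof.
have mL (c : R) : measurable_fun setT (fun p : marked d R * config => log_part p.2 (level p.1 - level p.1 / c)).
  apply: (measurable_curried (F := fun t g => log_part g t) m_log_part); last exact: measurable_snd.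
  by apply: measurable_funB => //; apply: measurable_funM.
have mL' : measurable_fun setT (fun p : marked d R * config => log_part p.2 (level p.1)).
  apply: (measurable_curried (F := fun t g => log_part g t) m_log_part) => //; exact: measurable_snd.
rewrite (_ : slopes n = fun p => lam * (log_part p.2 (level p.1 - level p.1 / n.+2%:R) - log_part p.2 (level p.1)) *
   (n.+2%:R * (level p.1)^-1)).
  by apply: measurable_funM; apply: measurable_funM => //; exact: measurable_funB.
by apply/funext => p; rewrite /slopes /slope invfM invrK [_^-1 * _]mulrC.
Qed.

Variables (a : R).

(* In the second case [right_nbhs] is not proper and every point is a limit. *)
Definition thin_prob (p : marked d R * config) : R :=
  - (1 / a) * (if 0 < level p.1 then lim (slopes n p @[n --> \oo]) else lim ([set: set R] : set_system R)).

Lemma measurable_thin_prob : measurable_fun setT thin_prob.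
Proof.
apply: measurable_funM => //; apply: measurable_fun_ifT => //.
  apply: (measurable_fun_bool true); rewrite setTI (_ : _ @^-1` _ = (fun p => level p.1) @^-1` `]0, +oo[).
    by rewrite -[X in measurable X]setTI; apply: m_level_fst => //; exact: measurable_itv.
  by apply/seteqP; split => p /=; rewrite in_itv/= andbT.
exact: (measurable_lim measurable_slopes).
Qed.

Section at_point.
Variables (g : config) (X : marked d R) (DX : D X) (f : marked d R -> R).
Hypothesis fF : forall Y, D Y -> rk X <= rk Y -> f Y = log_part g (level Y).

Let lim_iff : 0 < level X -> forall l : R,
  diff_quotient Q v D f X Y @[Y --> right_nbhs Q v D X] --> l <-> slopes n (X, g) @[n --> \oo] --> l.
Proof.
move=> l0 l; apply: (cvg_diff_quotient lam0 bD muD mu1 muE hv DX l0 _ _ fF).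
  by move=> s t s0 st tX; apply: log_part_nd => //; apply: le_trans tX (level_le _ _ _ _).
by move=> t t0 tX; apply: log_part_cont => //; apply: lt_le_trans tX (level_le _ _ _ _).
Qed.

Lemma derive_right_thin : - (1 / a) * derive_right Q v D f X = thin_prob (X, g).
Proof.
rewrite /thin_prob /derive_right; congr (_ * _); case: ifPn => l0.
  by apply: eq_lim; exact: lim_iff.
(* At level 0 no interval to the right of [X] has positive mass: the filter contains the empty set,
   every real number is a limit, and [thin_prob] makes the same choice among them. *)
have e0 : level X = 0 by apply/eqP; rewrite eq_le level_ge0 andbT leNgt.
apply: eq_lim => l; split => _ A _ //=.
exists 1; first exact: ltr01.
move=> Y [DY XY]; rewrite (Qstar_prec_cc lam0 bD mu1 muE hv DX XY) e0 lte_fin => /andP[+ _].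
by rewrite sub0r mulNr oppr_gt0 ltNge divr_ge0 ?level_ge0 ?ltW.
Qed.

Lemma thin_prob_derive : 0 < level X -> is_derive (level X) 1 (cum g) (insertion X g) ->
  derivable_right Q v D f X /\
  thin_prob (X, g) = lam / a * (insertion X g / (1 + cum g (level X))).
Proof.
move=> l0 dX; have c0 := cum_ge0 g (level X).
have p0 : 0 < 1 + cum g (level X) by lra.
have dL : is_derive (level X) 1 (log_part g) ((1 + cum g (level X))^-1 * (0 + insertion X g)).
  have d1 : is_derive (level X) 1 (cst 1 + cum g) (0 + insertion X g) by exact: is_deriveD.
  have d2 : is_derive ((cst 1 + cum g) (level X)) 1 (@ln R) (1 + cum g (level X))^-1 by exact: is_derive1_ln.
  have d3 : is_derive (level X) 1 (@ln R \o (cst 1 + cum g)) ((1 + cum g (level X))^-1 * (0 + insertion X g)).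
    exact: is_derive1_comp.
  exact: d3.
(* The sequence approaches the level from below, by increments [- h]. The resulting minus sign
   cancels the one in the definition of the probability. *)
have cv : slopes n (X, g) @[n --> \oo] --> - (lam * (insertion X g / (1 + cum g (level X)))).
  have [ex dv] := dL; have dv' : derive1 (log_part g) (level X) = insertion X g / (1 + cum g (level X)).
    by rewrite derive1E dv add0r mulrC.
  have cvd : cvg ((fun h => h^-1 *: (log_part g (h + level X) - log_part g (level X))) @ 0^').
    rewrite (_ : (fun h => _) = (fun h => h^-1 *: ((log_part g \o shift (level X)) (h *: 1) - log_part g (level X)))).
      exact: ex.
    by apply/funext => h; rewrite /= [h%:A]mulr1.
  have /cvgrPdist_lt hc : (fun h => h^-1 *: (log_part g (h + level X) - log_part g (level X))) @ 0^' -->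
    derive1 (log_part g) (level X) by exact: cvd.
  apply/cvgrPdist_lt => e e0; have e1 : 0 < e / lam by rewrite divr_gt0.
  have [r /= r0 hr] := hc _ e1.
  have cs : (fun n : nat => level X / n.+2%:R) @ \oo --> level X * 0.
    apply: cvgM; first exact: cvg_cst.
    have := @cvg_harmonic R; rewrite -cvg_shiftS => h; exact: h.
  rewrite mulr0 in cs; move/cvgrPdist_lt: cs => /(_ _ r0); apply: filterS => n /=.
  rewrite sub0r normrN => hn; set h := level X / n.+2%:R in hn *.
  have h0 : 0 < h by rewrite divr_gt0.
  have := hr (- h); rewrite /ball_ /= sub0r opprK => /(_ hn); rewrite oppr_eq0 gt_eqF// => /(_ isT).
  rewrite dv' /slopes /slope /= -/h => hd.
  have -> : - (lam * (insertion X g / (1 + cum g (level X)))) - lam * (log_part g (level X - h) - log_part g (level X)) / h =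
    - lam * ((insertion X g / (1 + cum g (level X))) - (- h)^-1 *: (log_part g (- h + level X) - log_part g (level X))).
    by rewrite /GRing.scale/= (addrC (- h)) invrN; field; rewrite !gt_eqF.
  by rewrite normrM normrN (gtr0_norm lam0) [ltLHS]mulrC -ltr_pdivlMr.
split; first by apply/cvg_ex; eexists; apply/lim_iff => //; exact: cv.
rewrite /thin_prob l0 (cvg_lim _ cv)//.
by set r := insertion X g / _; rewrite div1r mulNr mulrN opprK mulrCA mulrA.
Qed.

End at_point.

End thinning_probability.

(** * Comparison with the partition functions of the specification *)

Section specification.
Variables (R : realType) (d : nat) (Q : probability (mark R) R).
Variables (qs : {measure set (marked d R) -> \bar R}) (qsE : Qstar Q = qs).
Hypothesis qs_fin : forall A : set (marked d R), Sbp A -> (qs A < +oo)%E.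
Hypothesis qs1 : forall X, qs [set X] = 0%E.
Variables (H : hamiltonian_family R d) (hH : is_hamiltonian H).
Variables (lam a : R) (lam0 : 0 < lam) (a0 : 0 < a).
Hypothesis H_le : forall (X : marked d R) (w : config R d), ~ pts w X ->
  (expeR (- H [set X] (config_single X) w) <= (a / lam)%:E)%E.
Variables (D : set (marked d R)) (bD : Sbp D).
Variables (v : position d R) (hv : nonneg_shift v D).
Local Notation config := (config R d).
Local Notation rk := (rank v).
Local Notation above := (above D v).
Local Notation upper := (upper D v).
Local Notation mul := (intensity qs_fin bD (ltW lam0)).
Local Notation part := (part H mul D v).
Local Notation weight := (weight H D v).
Local Notation tail := (tail mul D v).
Local Notation level := (level mul D v).
Implicit Types (g w : config) (X Y : marked d R).

Let b0 : 0 <= a / lam. Proof. by rewrite divr_ge0// ltW. Qed.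
Let muD : mul (~` D) = 0%E. Proof. exact: intensity_null. Qed.
Let mu1 X : mul [set X] = 0%E. Proof. exact: intensity_diffuse. Qed.
Let muE A : mul A = (lam%:E * Qstar Q (A `&` D))%E. Proof. by rewrite qsE; exact: intensityE. Qed.

(** The sets [A] and [above t] differ by a null set, so the unnormalised measures they carry have
    the same void probabilities; the normalisation of the Poisson law gives the prefactor. The lemma
    serves the intervals that start at a point, with or without it, and the whole of [D]. *)
Lemma Zgb_part A t g : Sbp A -> A `<=` D -> above t `<=` A -> qs (A `\` above t) = 0%E ->
  pts g `&` A = set0 -> (forall w, pts w `<=` A -> separated D v w g) ->
  Zgb Q H lam A g = (expR (- tail t) * part t g)%:E.
Proof.
move=> bA AD VA q0 gA sA; have [_ hH1 _ _] := hH.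
have mV := measurable_aboveD bD v t; have mA := bA.1.
have mc := measurable_config_in mV; have mcA := measurable_config_in mA.
have gAc : config_in (~` A) g by exact/disjoints_subset.
have mAV : measurable (A `\` above t) by exact: measurableD.
have qAV B : measurable B -> qs (B `&` A) = qs (B `&` above t).
  move=> mB; apply: (@measure_cond _ _ _ qs (~` (A `\` above t))).
  - exact: measurableC.
  - by rewrite setCK.
  - exact: measurableI.
  - exact: measurableI.
  - apply/seteqP; split => x [[Bx Ax] nx]; split => //; split => //; last exact: VA.
    by apply: contrapT => Vx; apply: nx.
pose f : config -> \bar R := (fun w => (weight w g)%:E) \_ (config_in A).
have mW : measurable_fun setT (fun w : config => (weight w g)%:E).
  by apply/measurable_EFinP; exact: (measurableT_comp (measurable_weight hH bD v) (measurable_pairr g)).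
have mf : measurable_fun setT f.
  by apply/(measurable_restrictT (fun w => (weight w g)%:E) mcA); exact: measurable_funTS.
have f0 w : (0 <= f w)%E by rewrite /f /patch; case: ifP => // _; rewrite lee_fin weight_ge0.
have -> : Zgb Q H lam A g = (\int[Ppoi Q A lam]_w f w)%E.
  rewrite /Zgb integral_mkcond; apply: eq_integral => w _; rewrite /f /patch; case: ifPn => // /set_mem wA.
  by rewrite (weightE hH bD bA wA gA (sA w wA)) boltzE//; exact: hH1.
rewrite (integral_Ppoi qsE qs_fin qs1 bA (ltW lam0) mf f0) EFinM; congr (_ * _)%E.
  congr (expR _)%:E; congr (- _); apply: EFin_inj; rewrite -tailE//.
  have qA : qs A = qs (above t) by have := qAV setT measurableT; rewrite !setTI.
  rewrite muE qsE (setIidl (fun x (h : above t x) => h.1)) -qA EFinM fineK// ge0_fin_numE//.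
  exact: qs_fin.
pose m2 := [the {measure set config -> \bar R} of mrestr (LP mul) mc].
transitivity (\int[m2]_w f w)%E.
  apply: eq_measure_integral => E mE _; apply: measure_eq_void mE => //; last first.
    by rewrite -ge0_fin_numE// fin_num_measure.
  move=> B [mB _]; have mBC := measurableC mB.
  transitivity (LP mul (void B `&` config_in (above t))); last by [].
  have -> : void B `&` config_in (above t) = void (B `|` ~` above t) :> set config.
    by rewrite config_inE /void; apply/seteqP; split => w /=; rewrite setIUr setU_eq0.
  have mBV : measurable (B `|` ~` above t) by apply: measurableU => //; exact: measurableC.
  apply: etrans; first exact: (LP_void _ mB).
  apply/esym; apply: etrans; first exact: (LP_void _ mBV).
  congr (expR (fine _))%:E; rewrite setCU setCK muE qsE.
  transitivity (lam%:E * qs (~` B `&` A))%E; last exact/esym/intensityE.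
  by rewrite qAV// -setIA (setIidl (fun x (h : above t x) => h.1)).
rewrite ge0_integral_restrict// -(partE hH b0 H_le bD muD mu1 hv).
apply: eq_integral => w /set_mem wV; rewrite /f /patch mem_set// => x /wV; exact: VA.
Qed.

Let q_upper X : D X -> qs (upper (rk X) `\` above (rk X)) = 0%E.
Proof.
move=> DX; apply: (subset_measure0 (mu := qs) _ _ _ (qs1 X)).
- by apply: measurableD; [exact: (Sbp_upper bD v _).1|exact: measurable_aboveD].
- exact: measurable_marked1.
- by move=> Y [+ nY]; rewrite (upper_diff hv DX) => -[].
Qed.

Let above_upper X : above (rk X) `<=` upper (rk X).
Proof. by move=> Y [DY /= h]; split => //=; exact: ltW. Qed.

Lemma Zgb_upper X g : D X -> pts g `&` upper (rk X) = set0 ->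
  Zgb Q H lam (prec_ge v D X) g = (expR (- tail (rk X)) * part (rk X) g)%:E.
Proof.
move=> DX gX; apply: (@Zgb_part (upper (rk X))) => //.
- exact: Sbp_upper.
- by move=> Y [].
- exact: q_upper.
- by move=> w wX; exact: (separated_upper bD wX gX).
Qed.

Lemma Zgb_above X g : D X -> pts g `&` above (rk X) = set0 ->
  Zgb Q H lam (prec_gt v D X) g = (expR (- tail (rk X)) * part (rk X) g)%:E.
Proof.
move=> DX gX; have -> : prec_gt v D X = above (rk X).
  apply/seteqP; split => Y.
    move=> [YX nYX]; have : upper (rk X) Y by [].
    by rewrite (upper_diff hv DX) => -[].
  move=> h; split; first by have := above_upper h.
  by move=> YX; move: h => [_ /=]; rewrite YX ltxx.
apply: Zgb_part => //.
- by apply: (SbpS bD) => [|Y []//]; exact: measurable_aboveD.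
- by move=> Y [].
- by rewrite setDv measure0.
- by move=> w wX; exact: (separated_above bD wX gX).
Qed.

Lemma Zgb_full g : pts g `&` D = set0 -> Zgb Q H lam D g = (expR (- tail (-1)) * part (-1) g)%:E.
Proof.
(* Ranks are nonnegative, so everything in [D] lies above [-1]. *)
move=> gD; have VD : above (-1) = D by rewrite above_neg.
apply: Zgb_part => //.
- by rewrite VD.
- by rewrite VD setDv measure0.
- by move=> w wD; apply: (@separated_above _ _ _ bD _ w g (-1)); rewrite VD.
Qed.

(** The term with [Qstar] in the potential cancels the normalisation [exp(- tail)] of the Poisson
    law, which leaves the logarithm of [part]. *)
Lemma potential_log_part g w X Y : D X -> pts (config_union g w) `&` upper (rk X) = set0 ->
  D Y -> rk X <= rk Y -> potential Q H lam v D g w Y = log_part H mul D v (config_union g w) (level Y).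
Proof.
move=> DX gX DY XY; set gw : config := config_union g w.
have gY : pts gw `&` upper (rk Y) = set0.
  apply/seteqP; split => // Z [gZ [DZ /= YZ]]; have : (pts gw `&` upper (rk X)) Z.
    by split => //; split => //=; exact: le_trans YZ.
  by rewrite gX.
have gY' : pts gw `&` above (rk Y) = set0.
  by apply/seteqP; split => // Z [gZ VZ]; rewrite -gY; split => //; exact: above_upper.
have p0 : 0 < part (rk Y) gw by apply: lt_le_trans (part_ge1 hH b0 H_le bD muD mu1 hv gY').
have mU := (Sbp_upper bD v (rk Y)).1.
have QU : lam * fine (Qstar Q (prec_ge v D Y)) = tail (rk Y).
  have := Qstar_mu lam0 muE mU (fun Z (h : upper (rk Y) Z) => h.1).
  rewrite (mu_upper bD mu1 hv (ex_intro2 _ _ Y DY erefl)) => -> /=.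
  by rewrite mulrCA divff ?mulr1// gt_eqF.
rewrite /potential -/gw QU Zgb_upper// /=.
rewrite lnM ?posrE ?expR_gt0// expRK addrA subrr add0r /log_part.
by rewrite -(part_cum hH b0 H_le bD muD mu1 hv DY gY').
Qed.

Local Notation thin := (thin_prob H mul lam D v a).

Lemma p_single_thin g w X : D X -> pts (config_union g w) `&` upper (rk X) = set0 ->
  p_single Q H lam a v D g X w = thin (X, config_union g w).
Proof.
move=> DX gX; apply: (derive_right_thin hH b0 H_le lam0 bD muD mu1 muE hv) => // Y DY XY.
exact: potential_log_part gX DY XY.
Qed.

Lemma prec_lt_below X : prec_lt v D X = D `&` [set Y | rk Y < rk X].
Proof.
apply/seteqP; split => Y [DY h]; split => //=.
  by rewrite ltNge; apply/negP => XY; apply: h; split.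
by move=> [_]; rewrite /prec leNgt => /negP; exact.
Qed.

Lemma thin_null g : exists B, [/\ measurable B, qs B = 0%E & forall X, D X -> ~ B X ->
  0 < level X /\ is_derive (level X) 1 (cumulative mul D v (insertion H mul D v ^~ g)) (insertion H mul D v X g)].
Proof.
have mI : measurable_fun setT (fun x => insertion H mul D v x g).
  exact: (measurableT_comp (measurable_insertion hH mul bD v) (measurable_pairr g)).
have IK x : D x -> 0 <= insertion H mul D v x g <= (a / lam) * expR (a / lam * fine (mul setT)).
  exact: (insertion_bound hH b0 H_le bD muD mu1 hv).
have [B [mB B0 hB]] := cumulative_derive bD muD mu1 hv mI IK.
exists (B `&` D); split.
- by apply: measurableI => //; exact: bD.1.
- have := B0; rewrite muE qsE => /eqP; rewrite mule_eq0 eqe gt_eqF//=.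
  by move=> /eqP.
- by move=> X DX nB; apply: hB => // BX; apply: nB.
Qed.

(** The partition functions with and without [X] have the same prefactor [exp(- tail)], the point
    [X] being null, and it cancels in the quotient. *)
Lemma single_point_thinning g w : config_in (~` D) g -> config_in D w ->
  negligible (Qstar Q) [set X | [/\ D X, config_in (prec_lt v D X) w &
    ~ (derivable_right Q v D (potential Q H lam v D g w) X /\
       p_single Q H lam a v D g X w =
       lam / a * fine (expeR (- H [set X] (config_single X) (config_union g w))) *
       (fine (Zgb Q H lam (prec_gt v D X) (config_union (config_union g w) (config_single X))) /
        fine (Zgb Q H lam (prec_ge v D X) (config_union g w))))]].
Proof.
move=> gD wD; set gw : config := config_union g w.
have [B [mB B0 hB]] := thin_null gw.
exists B; split => //; first by rewrite qsE.
move=> X [DX wX h]; apply: contrapT => nB; apply: h.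
have [l0 dX] := hB X DX nB.
have gX : pts gw `&` upper (rk X) = set0.
  apply/seteqP; split => // Y [[gY|wY] [DY XY]]; first exact: gD gY DY.
  by have [_] := wX Y wY; apply; split.
have gX' : pts gw `&` above (rk X) = set0.
  by apply/seteqP; split => // Z [gZ VZ]; rewrite -gX; split => //; exact: above_upper.
have gxX : pts (add_point (gw, X)) `&` above (rk X) = set0.
  apply/seteqP; split => // Y [[gY VY|-> [_ /=]]]; last by rewrite ltxx.
  by rewrite -gX'; split.
have [dr ->] : derivable_right Q v D (potential Q H lam v D g w) X /\
  p_single Q H lam a v D g X w = lam / a * (insertion H mul D v X gw / part (rk X) gw).
  rewrite (p_single_thin DX gX) (part_cum hH b0 H_le bD muD mu1 hv DX gX').
  apply: (thin_prob_derive hH b0 H_le lam0 bD muD mu1 muE hv) => // Y DY XY.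
  exact: potential_log_part gX DY XY.
split => //; rewrite Zgb_upper// (Zgb_above DX gxX)/= /insertion.
have bX : Sbp [set X] by apply: (SbpS bD) => [|Y ->//]; exact: measurable_marked1.
have gX1 : pts gw `&` [set X] = set0.
  by apply/seteqP; split => // Y [gY YX]; rewrite -gX; split => //; rewrite YX; split => //=.
have sX : separated D v (csingle X) gw.
  by apply: (separated_upper bD (t := rk X)) => // Y ->; split => //=.
have wX1 : pts (csingle X) `<=` [set X] by [].
rewrite (weightE hH bD bX wX1 gX1 sX) /boltz -/gw.
have p0 : 0 < part (rk X) gw by apply: lt_le_trans (part_ge1 hH b0 H_le bD muD mu1 hv gX').
by field; rewrite !gt_eqF// expR_gt0.
Qed.

End specification.

(** * Total probability of a sequential selection *)

Section selections.
Variables (R : comPzRingType) (n : nat) (q : 'I_n -> {set 'I_n} -> R).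
Hypothesis q_past : forall (i : 'I_n) (J K : {set 'I_n}),
  (forall j : 'I_n, (j < i)%N -> (j \in J) = (j \in K)) -> q i J = q i K.

Let weight (i : 'I_n) (J : {set 'I_n}) : R := if i \in J then q i J else 1 - q i J.

Let prefix k : {set 'I_n} := [set i : 'I_n | (i < k)%N]%SET.

Let weight_past (i : 'I_n) (J K : {set 'I_n}) : (forall j : 'I_n, (j <= i)%N -> (j \in J) = (j \in K)) ->
  weight i J = weight i K.
Proof.
move=> h; rewrite /weight (h i (leqnn i)); congr (if _ then _ else 1 - _);
  by apply: q_past => j ji; apply: h; exact: ltnW.
Qed.

(* Indices are decided in increasing order, each with conditional probabilities summing to 1. *)
Lemma sum_selections : \sum_(J : {set 'I_n}) \prod_(i < n) (if i \in J then q i J else 1 - q i J) = 1.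
Proof.
suff h k : (k <= n)%N -> \sum_(J : {set 'I_n} | J \subset prefix k) \prod_(i in prefix k) weight i J = 1.
  rewrite -[RHS](h n (leqnn n)); apply: eq_big => [J|J _].
    by apply/esym/fintype.subsetP => i _; rewrite finset.inE ltn_ord.
  by apply: eq_bigl => i; rewrite finset.inE ltn_ord.
elim: k => [_|k ih kn].
  rewrite (big_pred1 finset.set0) => [|J].
    by rewrite big_pred0// => i; rewrite finset.inE.
  rewrite (_ : prefix 0 = finset.set0); last by apply/setP => i; rewrite !finset.inE.
  by rewrite finset.subset0.
pose o : 'I_n := Ordinal kn.
have oE (i : 'I_n) : (i == o) = (i == k :> nat) by [].
have pS i : (i \in prefix k.+1) = (i == o) || (i \in prefix k).
  by rewrite !finset.inE oE ltnS leq_eqVlt.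
have op : o \notin prefix k by rewrite finset.inE ltnn.
have prodS J : \prod_(i in prefix k.+1) weight i J = weight o J * \prod_(i in prefix k) weight i J.
  rewrite (bigD1 o) ?pS ?eqxx//=; congr (_ * _); apply: eq_bigl => i; rewrite pS.
  by case: eqVneq => [->|]; rewrite ?andbF ?andbT//= (negbTE op).
rewrite (bigID (fun J : {set 'I_n} => o \in J))/=.
rewrite (reindex_onto (fun J : {set 'I_n} => o |: J)%SET (fun J : {set 'I_n} => J :\ o)%SET); last first.
  by move=> J /andP[_ oJ]; rewrite finset.setD1K.
have e1 J : ((o |: J)%SET \subset prefix k.+1) && (o \in (o |: J)%SET) && (((o |: J) :\ o)%SET == J) = (J \subset prefix k).
  apply/andP/idP => [[/andP[/fintype.subsetP h _] /eqP e]|/fintype.subsetP h].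
    apply/fintype.subsetP => i iJ; have := h i; rewrite finset.in_setU1 iJ orbT pS => /(_ isT).
    by case: eqVneq => [io|//]; move: iJ; rewrite -e io finset.setD11.
  have oJ : o \notin J by apply/negP => /h; rewrite (negbTE op).
  split; last by apply/eqP; rewrite finset.setU1K.
  rewrite finset.setU11 andbT; apply/fintype.subsetP => i; rewrite finset.in_setU1 pS => /orP[->//|/h ->].
  by rewrite orbT.
have e2 (J : {set 'I_n}) : (J \subset prefix k.+1) && (o \notin J) = (J \subset prefix k).
  apply/andP/idP => [[h oJ]|h].
    apply/fintype.subsetP => i iJ; have := fintype.subsetP h i iJ.
    rewrite pS; case: eqVneq => // io; by rewrite -io iJ in oJ.
  split; first by apply/fintype.subsetP => i /(fintype.subsetP h i); rewrite pS => ->; rewrite orbT.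
  by apply/negP => /(fintype.subsetP h o); rewrite (negbTE op).
rewrite (eq_bigl _ _ e1) (eq_bigl _ _ e2) -big_split/=; apply: etrans (ih (ltnW kn)); apply: eq_bigr => J /fintype.subsetP hJ.
have oJ : o \notin J by apply/negP => /hJ; rewrite (negbTE op).
rewrite !prodS (eq_bigr (fun i => weight i J)) => [|i ip]; last first.
  apply: weight_past => j ji; rewrite finset.in_setU1; case: eqVneq => // jo.
  by move: ip; rewrite finset.inE ltnNge -[k]/(nat_of_ord o) -jo ji.
rewrite -mulrDl /weight finset.setU11 (negbTE oJ) (_ : q o (o |: J)%SET = q o J).
  by rewrite addrC subrK mul1r.
by apply: q_past => j jo; rewrite finset.in_setU1; case: eqVneq => // e; rewrite e ltnn in jo.
Qed.

End selections.

(** * Subconfigurations as sets of indices *)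

Section subconfigurations.
Variables (R : realType) (d : nat) (D : set (marked d R)) (bD : Sbp D).
Variables (v : position d R) (hv : nonneg_shift v D).
Local Notation config := (config R d).
Local Notation rk := (rank v).
Local Notation points := (points D v).
Local Notation kth := (kth D v).
Local Notation subconfig := (subconfig D v).
Local Notation split_pair := (split_pair D v).
Implicit Types (w g : config).

Let kthP w (i : 'I_(size (points w))) : pts w (kth i w) /\ D (kth i w).
Proof. by apply/(mem_points bD v); apply: mem_nth. Qed.

Let kth_inj w (i j : 'I_(size (points w))) : kth i w = kth j w -> i = j.
Proof.
move=> /eqP; rewrite nth_uniq ?points_uniq// => /eqP; exact: ord_inj.
Qed.

Lemma mem_subconfig w (J : {set 'I_(size (points w))}) (i : 'I_(size (points w))) :
  pts (subconfig J w) (kth i w) <-> i \in J.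
Proof.
split => [/= /fintype.imageP[j jJ /kth_inj ->//]|iJ].
by apply/fintype.imageP; exists i.
Qed.

Lemma subconfigP w (J : {set 'I_(size (points w))}) X :
  pts (subconfig J w) X -> exists2 i : 'I_(size (points w)), i \in J & X = kth i w.
Proof. by move=> /= /fintype.imageP[i iJ ->]; exists i. Qed.

Lemma pointsP w X : pts w X -> D X -> exists i : 'I_(size (points w)), X = kth i w.
Proof.
move=> wX DX; have /(nthP point)[k ks e] : X \in points w by apply/(mem_points bD v).
by exists (Ordinal ks).
Qed.

Lemma subconfig_sub w (J : {set 'I_(size (points w))}) X : pts (subconfig J w) X -> pts w X /\ D X.
Proof. by move=> /subconfigP[i _ ->]; exact: kthP. Qed.

Lemma subconfig_inj w : injective (fun J : {set 'I_(size (points w))} => subconfig J w).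
Proof.
move=> J K e; apply/setP => i; apply/idP/idP => /mem_subconfig h; apply/mem_subconfig.
  by have <- : subconfig J w = subconfig K w by exact: e.
by have -> : subconfig J w = subconfig K w by exact: e.
Qed.

Lemma subconfig_surj w w1 : config_in D w -> pts w1 `<=` pts w ->
  exists J : {set 'I_(size (points w))}, subconfig J w = w1.
Proof.
move=> wD w1w; exists [set i : 'I_(size (points w)) | `[< pts w1 (kth i w) >]]%SET.
apply: config_ext; apply/seteqP; split => X.
  by move=> /subconfigP[i]; rewrite finset.inE => /asboolP h ->.
move=> w1X; have wX := w1w X w1X; have [i e] := pointsP wX (wD X wX).
by rewrite e; apply/mem_subconfig; rewrite finset.inE; apply/asboolP; rewrite -e.
Qed.

Lemma subconfig_setC w (J : {set 'I_(size (points w))}) : config_in D w ->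
  pts (subconfig (~: J)%SET w) = pts w `\` pts (subconfig J w).
Proof.
move=> wD; apply/seteqP; split => X.
  move=> h; have [wX _] := subconfig_sub h; split => //.
  have [i iJ ->] := subconfigP h; move/mem_subconfig.
  by move: iJ; rewrite finset.in_setC => /negbTE ->.
move=> [wX nX]; have [i e] := pointsP wX (wD X wX).
rewrite e; apply/mem_subconfig; rewrite finset.in_setC; apply/negP => iJ.
by apply: nX; rewrite e; apply/mem_subconfig.
Qed.

Lemma cunion_split w (J : {set 'I_(size (points w))}) : config_in D w -> cunion (split_pair J w) = w.
Proof.
move=> wD; apply: config_ext.
transitivity (pts (subconfig J w) `|` pts (subconfig (~: J)%SET w)); first by [].
rewrite (subconfig_setC J wD).
by rewrite setDUK// => X /subconfig_sub[].
Qed.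

Lemma prod_subconfig (F : marked d R -> R) w (J : {set 'I_(size (points w))}) :
  \prod_(X <- points (subconfig J w)) F X = \prod_(i in J) F (kth i w).
Proof.
rewrite (perm_big [seq kth i w | i : 'I_(size (points w)) in J]) ?big_image//=.
apply: uniq_perm; first exact: points_uniq.
  by rewrite map_inj_uniq ?enum_uniq//; exact: kth_inj.
move=> X; apply/idP/idP => [/(mem_points bD v)[//]|h].
by apply/(mem_points bD v); split => //; have [] := @subconfig_sub w J X h.
Qed.

Lemma fsbig_points (F : marked d R -> R) w : config_in D w ->
  \big[*%R/1]_(X \in pts w) F X = \prod_(X <- points w) F X.
Proof.
move=> wD; rewrite (fsbig_seq _ _ (points_uniq D v w)) (_ : [set` points w] = pts w)//.
apply/esym/seteqP; split => X; first by move=> wX; apply/(mem_points bD v); split => //; exact: wD.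
by move=> /(mem_points bD v)[].
Qed.

Lemma fsbig_subconfig (F : config -> R) w (A : set (config * config)) : config_in D w ->
  \sum_(w1 \in [set w1 : config | pts w1 `<=` pts w /\ A (w1, w)]) F w1 =
  \sum_(J : {set 'I_(size (points w))}) \1_A (subconfig J w, w) * F (subconfig J w).
Proof.
move=> wD; rewrite (@reindex_fsbig _ _ _ _ _ (fun J : {set 'I_(size (points w))} => subconfig J w)
  [set J | A (subconfig J w, w)]); last first.
  split => [J /= AJ|J K _ _ e|w1 [w1w Aw]].
  - by split => // X /subconfig_sub[].
  - exact: subconfig_inj e.
  - by have [J e] := subconfig_surj wD w1w; exists J => //=; rewrite e.
rewrite fsbig_mkcond (fsbig_seq _ _ (index_enum_uniq _)).
have -> : [set` index_enum {set 'I_(size (points w))}] = setT.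
  by apply/seteqP; split => // J _; exact: mem_index_enum.
apply: eq_fsbigr => J _; rewrite /patch indicE; case: (boolP (J \in _)) => [/set_mem AJ|nJ].
  by rewrite mem_set// mul1r.
by rewrite memNset ?mul0r// => AJ; move/negP: nJ; apply; exact: mem_set.
Qed.

(** [p_joint] in terms of the kept and the discarded points. The single point probability [f] is
    arbitrary, so that both [thin_prob] and its closed form can be used. *)
Definition pair_prob (f : marked d R * config -> R) (g : config) (p : config * config) : R :=
  (\prod_(X <- points p.1) f (X, past D v p.1 g X)) *
  (\prod_(W <- points p.2) (1 - f (W, past D v p.1 g W))).

Lemma measurable_prod_past d' (T : measurableType d') (f : marked d R * config -> R) (c1 c2 c3 : T -> config) :
  measurable_fun setT f -> measurable_fun setT c1 -> measurable_fun setT c2 -> measurable_fun setT c3 ->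
  measurable_fun setT (fun t => \prod_(X <- points (c1 t)) f (X, past D v (c2 t) (c3 t) X)).
Proof.
move=> mf m1 m2 m3.
pose F (y : marked d R * (config * config)) : R := f (y.1, past D v y.2.1 y.2.2 y.1).
have mF : measurable_fun setT F.
  apply: (measurableT_comp mf); apply/measurable_fun_pair; first exact: measurable_fst.
  have ms : measurable_fun setT (fun y : marked d R * (config * config) => (y.2, y.1)).
    by apply/measurable_fun_pair; [exact: measurable_snd|exact: measurable_fst].
  exact: (measurableT_comp (measurable_past bD v) ms).
have mP := measurable_prod_points bD hv mF.
have mt : measurable_fun setT (fun t => (c1 t, (c2 t, c3 t))).
  by apply/measurable_fun_pair => //; exact/measurable_fun_pair.
exact: (measurableT_comp mP mt).
Qed.

Lemma measurable_pair_prob f : measurable_fun setT f ->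
  measurable_fun setT (fun p : config * (config * config) => pair_prob f p.1 p.2).
Proof.
move=> mf.
have m1 : measurable_fun setT (fun p : config * (config * config) => p.2.1).
  by apply: (measurableT_comp (f := fst)); [exact: measurable_fst|exact: measurable_snd].
have m2 : measurable_fun setT (fun p : config * (config * config) => p.2.2).
  by apply: (measurableT_comp (f := snd)); [exact: measurable_snd|exact: measurable_snd].
apply: measurable_funM; first exact: (measurable_prod_past mf m1 m1 measurable_fst).
have mf' : measurable_fun setT (fun x => 1 - f x) by exact: measurable_funB.
exact: (measurable_prod_past mf' m2 m1 measurable_fst).
Qed.

Lemma pair_prob_split f g w (J : {set 'I_(size (points w))}) :
  pair_prob f g (split_pair J w) = \prod_(i < size (points w))
    (if i \in J then f (kth i w, past D v (subconfig J w) g (kth i w))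
     else 1 - f (kth i w, past D v (subconfig J w) g (kth i w))).
Proof.
rewrite big_if /pair_prob /=; congr (_ * _); rewrite prod_subconfig//.
by apply: eq_bigl => i; rewrite finset.in_setC.
Qed.

(** The probability used at a point depends only on the kept points of smaller rank, that is on
    decisions at smaller indices, as [sum_selections] requires. *)
Lemma sum_pair_prob f g w :
  \sum_(J : {set 'I_(size (points w))}) pair_prob f g (split_pair J w) = 1.
Proof.
under eq_bigr do rewrite pair_prob_split.
apply: (sum_selections (q := fun i J => f (kth i w, past D v (subconfig J w) g (kth i w)))) => i J K JK.
congr (f (_, _)); apply: config_ext => /=; congr (_ `|` _); apply/seteqP; split => X [h [DX Xi]];
  (split; last by split); have [j jJ Xj] := subconfigP h; rewrite Xj; apply/mem_subconfig;
  (have ji : (j < i)%N by rewrite ltnNge; apply/negP; rewrite leq_eqVlt => /orP[/eqP/ord_inj e|ij];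
    move: Xi; rewrite /= Xj ?e ?ltxx// ltNge (ltW (kth_lt bD hv _))// ij ltn_ord);
  by move: (JK j ji) jJ => ->.
Qed.

Lemma pair_prob_bound f g p : (forall X g', D X -> 0 <= f (X, g') <= 1) -> 0 <= pair_prob f g p.
Proof.
move=> hf; apply: mulr_ge0.
  rewrite big_seq; apply: prodr_ge0 => X /(mem_points bD v)[_ DX].
  by have /andP[] := hf X (past D v p.1 g X) DX.
rewrite big_seq; apply: prodr_ge0 => X /(mem_points bD v)[_ DX].
by rewrite subr_ge0; have /andP[] := hf X (past D v p.1 g X) DX.
Qed.

Lemma measurable_split_sum (phi : config * config -> \bar R) : measurable_fun setT phi ->
  measurable_fun setT (fun w => \sum_(J : {set 'I_(size (points w))}) phi (split_pair J w))%E.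
Proof.
move=> mphi.
apply: (measurableT_comp (f := fun p : config * unit =>
  (\sum_(J : {set 'I_(size (points p.1))}) phi (split_pair J p.1))%E) _ (measurable_pairr tt)).
apply: (measurable_by_size bD (v := v)) => n.
apply: (eq_measurable_fun (fun p : config * unit => (\sum_(J : {set 'I_n}) phi (split_pair J p.1))%E)).
  by move=> p /set_mem[/= <- _].
apply: emeasurable_sum => J; apply: measurable_funTS.
apply: (measurableT_comp mphi).
have ms : measurable_fun setT (split_pair J) by apply: measurable_split_pair.
exact: (measurableT_comp ms measurable_fst).
Qed.

End subconfigurations.

(** * The thinning as an integral over kept and discarded points *)

Section coupling.
Variables (R : realType) (d : nat) (Q : probability (mark R) R).
Variables (qs : {measure set (marked d R) -> \bar R}) (qsE : Qstar Q = qs).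
Hypothesis qs_fin : forall A : set (marked d R), Sbp A -> (qs A < +oo)%E.
Hypothesis qs1 : forall X, qs [set X] = 0%E.
Variables (H : hamiltonian_family R d) (hH : is_hamiltonian H).
Variables (lam a : R) (lam0 : 0 < lam) (a0 : 0 < a).
Hypothesis H_le : forall (X : marked d R) (w : config R d), ~ pts w X ->
  (expeR (- H [set X] (config_single X) w) <= (a / lam)%:E)%E.
Variables (D : set (marked d R)) (bD : Sbp D).
Variables (v : position d R) (hv : nonneg_shift v D).
Local Notation config := (config R d).
Local Notation rk := (rank v).
Local Notation above := (above D v).
Local Notation upper := (upper D v).
Local Notation mul := (intensity qs_fin bD (ltW lam0)).
Local Notation mua := (intensity qs_fin bD (ltW a0)).
Local Notation LPa := (LP mua).
Local Notation LPl := (LP mul).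
Local Notation part := (part H mul D v).
Local Notation weight := (weight H D v).
Local Notation ratio := (ratio H mul D v).
Local Notation points := (points D v).
Local Notation subconfig := (subconfig D v).
Local Notation split_pair := (split_pair D v).
Local Notation past := (past D v).
Local Notation thin := (thin_prob H mul lam D v a).
Implicit Types (g w : config) (X Y : marked d R).

Let b0 : 0 <= a / lam. Proof. by rewrite divr_ge0// ltW. Qed.
Let muD : mul (~` D) = 0%E. Proof. exact: intensity_null. Qed.
Let mu1 X : mul [set X] = 0%E. Proof. exact: intensity_diffuse. Qed.
Let muaD : mua (~` D) = 0%E. Proof. exact: intensity_null. Qed.
Let mua1 X : mua [set X] = 0%E. Proof. exact: intensity_diffuse. Qed.

(** The closed form of the thinning probability. Its values at points of [D] are in [0, 1] without
    exception, so the computations use it, and [thin_keep_ae] exchanges it with [thin_prob]. *)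
Definition keep_prob (p : marked d R * config) : R := lam / a * ratio p.1 p.2.

Lemma measurable_keep_prob : measurable_fun setT keep_prob.
Proof. by apply: measurable_funM => //; exact: (measurable_ratio hH b0 H_le bD muD mu1 hv). Qed.

Lemma keep_prob_bound X g : D X -> 0 <= keep_prob (X, g) <= 1.
Proof.
move=> DX; have /andP[h1 h2] := ratio_bound hH b0 H_le bD muD mu1 hv g DX.
have c0 : 0 <= lam / a by rewrite divr_ge0// ltW.
rewrite /keep_prob /= mulr_ge0//=; apply: (le_trans (ler_wpM2l c0 h2)).
by have -> : lam / a * (a / lam) = 1 by field; rewrite !gt_eqF.
Qed.

Lemma integral_intensity (c : R) (c0 : 0 < c) (f : marked d R -> \bar R) :
  measurable_fun setT f -> (forall x, 0 <= f x)%E ->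
  (\int[intensity qs_fin bD (ltW c0)]_x f x = c%:E * \int[qs]_(x in D) f x)%E.
Proof.
move=> mf f0; rewrite -(ge0_integral_restrict qs bD.1)//.
exact: ge0_integral_mscale.
Qed.

Lemma past_upper g w X : pts g `&` D = set0 -> pts (past w g X) `&` upper (rk X) = set0.
Proof.
move=> gD; apply/seteqP; split => // Y [[gY|[/= _ [_ YX]]] [DY /= XY]].
  by have : (pts g `&` D) Y by []; rewrite gD.
by have := lt_le_trans YX XY; rewrite ltxx.
Qed.

Lemma p_joint_pair g w (J : {set 'I_(size (points w))}) : pts g `&` D = set0 -> config_in D w ->
  p_joint Q H lam a v D g (subconfig J w) w = pair_prob D v thin g (split_pair J w).
Proof.
move=> gD wD; have s1 : pts (subconfig J w) `<=` pts w by move=> X /(subconfig_sub bD)[].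
have pE X : D X -> p_single Q H lam a v D g X (config_restrict (subconfig J w) (prec_lt v D X)) =
    thin (X, past (subconfig J w) g X).
  move=> DX; rewrite prec_lt_below.
  by apply: (p_single_thin qsE qs_fin qs1 hH lam0 a0 H_le bD hv DX); exact: past_upper.
rewrite /p_joint asboolT// mul1r -(subconfig_setC bD J wD); congr (_ * _).
  rewrite (fsbig_points bD v); last by move=> X /s1; exact: wD.
  rewrite big_seq [RHS]big_seq; apply: eq_bigr => X /(mem_points bD v)[_ DX]; exact: pE.
rewrite (fsbig_points bD v); last by move=> X; rewrite (subconfig_setC bD J wD) => -[/wD].
rewrite big_seq [RHS]big_seq; apply: eq_bigr => X /(mem_points bD v)[_ DX]; by rewrite pE.
Qed.

Let good : set (marked d R * config) := [set p | thin p = keep_prob p].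

Let mthin : measurable_fun setT thin.
Proof. exact: (measurable_thin_prob hH b0 H_le lam bD muD mu1 hv a). Qed.

Let mgood : measurable good.
Proof.
have md : measurable_fun setT (fun p => thin p - keep_prob p).
  by apply: measurable_funB; [exact: mthin|exact: measurable_keep_prob].
have := md measurableT [set 0] (measurable_set1 0); rewrite setTI; congr measurable.
by apply/seteqP; split => p /= => [/eqP|->]; rewrite ?subrr// subr_eq0 => /eqP.
Qed.

(** Each boundary condition has a null exceptional set, but the past of [X] varies with [X]. As [w]
    has finitely many points in [D], this past equals [gq q] for some rational [q] slightly below
    the rank of [X]. *)
Let bad_null g w : pts g `&` D = set0 -> exists B, [/\ measurable B, qs B = 0%E &
  forall X, D X -> ~ B X -> good (X, past w g X)].
Proof.
move=> gD; pose gq (q : rat) : config := cunion (g, below D v (ratr q) w).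
have hB q := thin_null qsE qs_fin qs1 hH lam0 a0 H_le bD hv (gq q).
have [B hB'] := choice hB; exists (\bigcup_q B q); split.
- by apply: countable_bigcupT_measurable => // q; have [] := hB' q.
- apply/eqP; rewrite eq_le measure_ge0 andbT.
  (* The rationals are recoded by natural numbers in order to use a countable union indexed by them;
     a number without preimage gets the set attached to the rational 0. *)
  have [f f_inj] : exists f : rat -> nat, injective f.
    by exists (@choice.pickle rat); exact: (pcan_inj (@choice.pickleK rat)).
  pose C n : set (marked d R) := B (xget 0 [set q | f q = n]).
  have CP n : measurable (C n) /\ qs (C n) = 0%E by rewrite /C; have [] := hB' (xget 0 [set q | f q = n]).
  have sub : \bigcup_q B q `<=` \bigcup_n C n.
    move=> X [q _ BX]; exists (f q) => //; rewrite /C.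
    suff -> : xget 0 [set q' | f q' = f q] = q by [].
    by apply: f_inj; apply: (@xgetPex _ 0 [set q' | f q' = f q]); exists q.
  rewrite measure_negligible//.
    by apply: countable_bigcupT_measurable => // q; have [] := hB' q.
  apply: negligibleS sub _; apply: negligible_bigcup => n; exists (C n).
  by have [mC C0] := CP n; split.
- move=> X DX nX; have fw : finite_set (pts (below D v (rk X) w)).
    by apply: (sub_finite_set _ (finite_configD bD w)) => Y [wY [DY _]].
  have [|q qX hq] := @finite_set_lt _ _ rk _ (rk X) fw; first by move=> Y [_ []].
  have e : past w g X = gq q.
    apply: config_ext => /=; congr (_ `|` _); apply/seteqP; split => Y [wY [DY /= h]]; split => //; split => //=.
      by apply: hq; split => //; split.
    exact: lt_trans h qX.
  have [_ _ /(_ X DX)] := hB' q; case; first by move=> BX; apply: nX; exists q.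
  move=> l0 dX; have gX := past_upper w X gD.
  have gX' : pts (past w g X) `&` above (rk X) = set0.
    apply/seteqP; split => // Z [gZ [DZ /= XZ]].
    have : (pts (past w g X) `&` upper (rk X)) Z by split => //; split => //=; exact: ltW.
    by rewrite gX.
  have muE A : mul A = (lam%:E * Qstar Q (A `&` D))%E by rewrite qsE; exact: intensityE.
  rewrite /good /= e.
  have [_ ->] := thin_prob_derive hH b0 H_le lam0 bD muD mu1 muE hv a DX
     (f := fun Y => log_part H mul D v (gq q) (level mul D v Y)) (fun Y _ _ => erefl) l0 dX.
  by rewrite /keep_prob /ratio /= -e (part_cum hH b0 H_le bD muD mu1 hv DX gX').
Qed.

(** Only discarded points are tested. Their pasts are determined by the kept ones, so for fixed kept
    points this is a product functional of the other configuration. *)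
Let all_good g (p : config * config) : R :=
  \prod_(W <- points p.2) \1_good (W, past p.1 g W).

Let m_all_good g : measurable_fun setT (all_good g).
Proof.
have mi : measurable_fun setT (\1_good : marked d R * config -> R) by exact: measurable_indic.
exact: (measurable_prod_past bD hv mi measurable_snd measurable_fst (measurable_cst g)).
Qed.

Let all_good01 g p : 0 <= all_good g p <= 1.
Proof.
rewrite /all_good; elim: (points p.2) => [|X s /andP[h1 h2]]; first by rewrite big_nil ler01 lexx.
rewrite big_cons indicE; case: (_ \in _); rewrite ?mul1r ?h1// mul0r lexx ler01//.
Qed.

Let all_goodP g p : all_good g p = 1 -> forall X, pts p.2 X -> D X -> good (X, past p.1 g X).
Proof.
move=> h X pX DX; apply: contrapT => nX; move: h; rewrite /all_good.
have Xp : X \in points p.2 by apply/(mem_points bD v).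
rewrite (big_rem X)//= indicE memNset// mul0r => /eqP.
by rewrite eq_sym oner_eq0.
Qed.

(** For fixed kept points, [LP_prod] shows that almost surely all discarded points are good. [mecke]
    extends this to all splittings of almost every configuration at once. *)
Lemma thin_keep_ae g : pts g `&` D = set0 -> exists N : set config, [/\ measurable N, LPa N = 0%E &
  forall w, ~ N w -> config_in D w -> forall J : {set 'I_(size (points w))},
    pair_prob D v thin g (split_pair J w) = pair_prob D v keep_prob g (split_pair J w)].
Proof.
move=> gD; pose psi (p : config * config) : \bar R := (1 - all_good g p)%:E.
have mpsi : measurable_fun setT psi by apply/measurable_EFinP; exact: measurable_funB.
have psi0 p : (0 <= psi p)%E by rewrite lee_fin subr_ge0; have /andP[] := all_good01 g p.
have inner w1 : (\int[LPa]_w psi (w1, w) = 0)%E.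
  pose f X := \1_good (X, past w1 g X) : R.
  have mf : measurable_fun setT f.
    apply: (measurableT_comp (f := (\1_good : marked d R * config -> R))); first exact: measurable_indic.
    apply/measurable_fun_pair => //.
    exact: (measurableT_comp (measurable_past bD v) (measurable_pairl (w1, g))).
  have f0 X : 0 <= f X by rewrite /f indicE.
  have [B [mB B0 hB]] := bad_null w1 gD.
  have intf : (\int[mua]_x (f x)%:E = (fine (mua setT))%:E)%E.
    rewrite -fin_mu// -[RHS]mul1e -integral_cst//.
    apply: (@integral_cond _ _ _ mua (D `&` ~` B)) => //.
    - by apply: measurableI; [exact: bD.1|exact: measurableC].
    - rewrite setCI setCK; apply/eqP; rewrite eq_le measure_ge0 andbT.
      apply: (le_trans (measureU2 _ _ _)) => //; first by apply: measurableC; exact: bD.1.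
      rewrite [X in (X + _)%E]muaD add0e; apply: le_trans (_ : _ <= a%:E * 0)%E _; last by rewrite mule0.
      apply: (le_trans (_ : _ <= a%:E * qs (B `&` D))%E); first by rewrite -(intensityE qs_fin bD (ltW a0)).
      rewrite lee_pmul2l ?lte_fin// -B0; apply: le_measure; last exact: subIsetl.
        by apply/mem_set; apply: measurableI => //; exact: bD.1.
      exact/mem_set.
    - by apply/measurable_EFinP.
    - by move=> X [DX BX]; rewrite /f indicE mem_set//; exact: hB.
  have int1 := LP_prod bD muaD mua1 hv mf f0 intf.
  have mg1 : measurable_fun setT (fun w => (all_good g (w1, w))%:E).
    by apply/measurable_EFinP; exact: (measurableT_comp (m_all_good g) (measurable_pairl w1)).
  have mg2 : measurable_fun setT (fun w => psi (w1, w)) by exact: (measurableT_comp mpsi (measurable_pairl w1)).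
  have : (\int[LPa]_w ((all_good g (w1, w))%:E + psi (w1, w)) = (expR (fine (mua setT)))%:E)%E.
    rewrite -lebesgue_poissonT -[RHS]mul1e -[RHS](integral_cst LPa measurableT).
    by apply: eq_integral => w _; rewrite /psi -EFinD addrC subrK.
  rewrite ge0_integralD//; last by move=> w _; rewrite lee_fin; have /andP[] := all_good01 g (w1, w).
  rewrite [X in (X + _)%E]int1 => h; have := congr1 (fun y => y - (expR (fine (mua setT)))%:E)%E h.
  by rewrite addeAC subee// add0e.
have tot : (\int[LPa]_w (\sum_(J : {set 'I_(size (points w))}) psi (split_pair J w)) = 0)%E.
  apply: etrans (mecke bD muaD mua1 hv mpsi psi0) _.
  apply: etrans (@fubini_tonelli1 _ _ _ _ _ LPa LPa psi mpsi psi0) _.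
  by apply: integral0_eq => w1 _; exact: inner.
pose Z w := (\sum_(J : {set 'I_(size (points w))}) psi (split_pair J w))%E.
have mZ : measurable_fun setT Z by exact: measurable_split_sum.
have Z0 w : (0 <= Z w)%E by apply: sume_ge0 => J _; exact: psi0.
have [N [mN N0 hN]] : ae_eq LPa setT Z (cst 0%E).
  apply/ae_eq_integral_abs => //; rewrite -[RHS]tot; apply: eq_integral => w _.
  by rewrite gee0_abs.
exists N; split => // w nN wD J.
have Zw : Z w = 0%E by apply: contrapT => h; apply: nN; apply: hN => /= /(_ I).
have goodJ (K : {set 'I_(size (points w))}) X : pts (subconfig (~: K)%SET w) X -> D X ->
    good (X, past (subconfig K w) g X).
  apply: (all_goodP (p := split_pair K w)); apply/eqP; rewrite eq_le.
  have /andP[_ ->] := all_good01 g (split_pair K w); rewrite -subr_le0 -lee_fin.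
  apply: le_trans (_ : _ <= Z w)%E _; last by rewrite Zw.
  by rewrite /Z (bigD1 K)//= leeDl// sume_ge0.
have gJ X : pts w X -> D X -> good (X, past (subconfig J w) g X).
  move=> wX DX; have [i Xi] := pointsP bD v wX DX.
  have [iJ|iJ] := boolP (i \in J); last first.
    apply: goodJ => //; rewrite Xi; apply/mem_subconfig.
    by rewrite finset.in_setC.
  (* Moving [X] to the discarded side leaves its past unchanged, as the past consists of strictly
     smaller ranks; the case of discarded points then applies. *)
  pose K := (J :\ i)%SET.
  have -> : past (subconfig J w) g X = past (subconfig K w) g X.
    apply: config_ext => /=; congr (_ `|` _); apply/seteqP; split => Y [h [DY /= YX]]; split => //.
      have [j jJ Yj] := subconfigP h; rewrite Yj; apply/mem_subconfig.
      rewrite finset.in_setD1 jJ andbT; apply/eqP => ji; move: YX.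
      by rewrite /= Yj ji Xi ltxx.
    have [j jK Yj] := subconfigP h; rewrite Yj; apply/mem_subconfig.
    by move: jK; rewrite finset.in_setD1 => /andP[].
  apply: goodJ => //; rewrite Xi; apply/mem_subconfig.
  by rewrite finset.in_setC finset.in_setD1 eqxx.
rewrite /pair_prob; congr (_ * _); rewrite big_seq [RHS]big_seq; apply: eq_bigr => X /(mem_points bD v)[wX DX].
  by apply: gJ => //; have [] := subconfig_sub bD wX.
by congr (1 - _); apply: gJ => //; have [] := subconfig_sub bD wX.
Qed.

Let mass0 : R := expR (- (a * fine (qs D))).

(** [thin_keep_ae] replaces the derivative by its closed form. Then [mecke] turns the sum over kept
    subsets into a double integral in which the larger configuration is the union of both
    variables. *)
Lemma thinning_formula g A : pts g `&` D = set0 -> measurable A ->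
  Pthin Q H lam a v D g A = (mass0%:E *
    \int[LPa]_w1 \int[LPa]_w (\1_A (w1, cunion (w1, w)) * pair_prob D v keep_prob g (w1, w))%:E)%E.
Proof.
move=> gD mA.
pose phi (f : marked d R * config -> R) (p : config * config) : \bar R :=
  (\1_A (p.1, cunion p) * pair_prob D v f g p)%:E.
have mphi f : measurable_fun setT f -> measurable_fun setT (phi f).
  move=> mf; apply/measurable_EFinP; apply: measurable_funM.
    apply: (measurableT_comp (f := (\1_A : config * config -> R))); first exact: measurable_indic.
    by apply/measurable_fun_pair; [exact: measurable_fst|exact: measurable_cunion].
  exact: (measurableT_comp (measurable_pair_prob bD hv mf) (measurable_pairl g)).
have phi0 p : (0 <= phi keep_prob p)%E.
  rewrite lee_fin mulr_ge0// pair_prob_bound// => X g' DX; exact: keep_prob_bound.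
pose S f w : \bar R := (\sum_(J : {set 'I_(size (points w))}) phi f (split_pair J w))%E.
have mS f : measurable_fun setT f -> measurable_fun setT (S f) by move=> /mphi; exact: measurable_split_sum.
have mD := measurable_config_in bD.1.
have PD : Ppoi Q D a (~` config_in D) = 0%E.
  rewrite (PpoiE qsE qs_fin qs1 bD (ltW a0)); last exact: measurableC.
  by rewrite [X in (_ * X)%E](LP_config_in bD.1 muaD) mule0.
have [N [mN N0 hN]] := thin_keep_ae gD.
have PN : Ppoi Q D a N = 0%E.
  by rewrite (PpoiE qsE qs_fin qs1 bD (ltW a0))// [X in (_ * X)%E]N0 mule0.
have -> : Pthin Q H lam a v D g A = (\int[Ppoi Q D a]_(w in config_in D) S thin w)%E.
  apply: eq_integral => w /set_mem wD; rewrite /S /phi sumEFin; congr EFin.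
  apply: etrans (fsbig_subconfig bD v (fun w1 => p_joint Q H lam a v D g w1 w) A wD) _; apply: eq_bigr => J _.
  by rewrite (p_joint_pair J gD wD) (cunion_split bD J wD).
have -> : (\int[Ppoi Q D a]_(w in config_in D) S thin w = \int[Ppoi Q D a]_w S keep_prob w)%E.
  rewrite [LHS]integral_mkcond; apply: ae_eq_integral => //.
  - by apply/(measurable_restrictT (S thin) mD); apply: measurable_funTS; exact: mS.
  - by apply: mS; exact: measurable_keep_prob.
  exists (N `|` ~` config_in D); split.
  - by apply: measurableU => //; exact: measurableC.
  - apply/eqP; rewrite eq_le measure_ge0 andbT.
    apply: (le_trans (measureU2 _ _ _)) => //; first exact: measurableC.
    by rewrite [X in (X + _)%E]PN add0e [leLHS]PD.
  move=> w /= nw; apply: contrapT => h; apply: nw => _.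
  have wD : config_in D w by apply: contrapT => h'; apply: h; right.
  rewrite /patch mem_set// /S; apply: eq_bigr => J _; congr (_ * _)%:E.
  by apply: hN => // hw; apply: h; left.
rewrite (integral_Ppoi qsE qs_fin qs1 bD (ltW a0)); last 2 first.
- by apply: mS; exact: measurable_keep_prob.
- by move=> w; apply: sume_ge0 => J _; exact: phi0.
congr (_ * _)%E; have mk := mphi _ measurable_keep_prob.
apply: etrans (mecke bD muaD mua1 hv mk phi0) _.
exact: (@fubini_tonelli1 _ _ _ _ _ LPa LPa _ mk phi0).
Qed.

End coupling.

(** * Integration against a measure with density *)

Section density_integral.
Import HBNNSimple.
Local Open Scope ereal_scope.
Context d (T : measurableType d) (R : realType).
Variables (m : {measure set T -> \bar R}) (h : T -> R).
Hypotheses (mh : measurable_fun setT (EFin \o h)) (h0 : forall x, 0 <= (EFin \o h) x).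
Local Notation dm := (density_measure m mh h0).

Let nnsfun_density (f : {nnsfun T >-> R}) :
  \int[dm]_x (f x)%:E = \int[m]_x ((h x)%:E * (f x)%:E).
Proof.
have nn y x : 0 <= (y * \1_(f @^-1` [set y]) x)%:E by rewrite EFinM nnfun_muleindic_ge0.
have mf : measurable_fun setT f by [].
have mA y : measurable (f @^-1` [set y]).
  by rewrite -[X in measurable X]setTI; apply: mf => //; exact: measurable_set1.
have mi y : measurable_fun setT (fun x => (\1_(f @^-1` [set y]) x)%:E : \bar R).
  by apply/measurable_EFinP; exact: measurable_indic.
transitivity (\int[dm]_x \sum_(y \in range f) (y * \1_(f @^-1` [set y]) x)%:E).
  by apply: eq_integral => x _; rewrite fimfunE -fsumEFin.
transitivity (\int[m]_x \sum_(y \in range f) ((h x)%:E * (y * \1_(f @^-1` [set y]) x)%:E)); last first.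
  by apply: eq_integral => x _; rewrite [in RHS]fimfunE -fsumEFin// ge0_mule_fsumr.
have m1 y : measurable_fun setT (fun x => (y * \1_(f @^-1` [set y]) x)%:E : \bar R).
  by apply/measurable_EFinP; apply: measurable_funM => //; exact: measurable_indic.
rewrite [LHS]ge0_integral_fsum// [RHS]ge0_integral_fsum//; last 2 first.
- by move=> y; apply: emeasurable_funM => //; exact: mh.
- by move=> y x _; apply: mule_ge0 => //; exact: h0.
apply: eq_fsbigr => y /set_mem[z _ fz]; have y0 : (0 <= y)%R by rewrite -fz.
transitivity (y%:E * dm (f @^-1` [set y])).
  under eq_integral do rewrite EFinM.
  by rewrite ge0_integralZl_EFin// integral_indic// setIT.
transitivity (\int[m]_x (y%:E * ((h x)%:E * (\1_(f @^-1` [set y]) x)%:E))); last first.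
  by apply: eq_integral => x _; rewrite EFinM muleCA.
rewrite ge0_integralZl_EFin//; last 2 first.
- by move=> x _; apply: mule_ge0; [exact: h0|rewrite lee_fin indicE].
- by apply: emeasurable_funM => //; exact: mh.
congr (_ * _); apply: etrans (integral_mkcond _ _) _.
apply: eq_integral => x _; rewrite /patch indicE.
by case: (_ \in _); rewrite ?mule1 ?mule0.
Qed.

Lemma integral_density (k : T -> \bar R) : measurable_fun setT k -> (forall x, 0 <= k x) ->
  \int[dm]_x k x = \int[m]_x ((h x)%:E * k x).
Proof.
move=> mk k0; pose k_ := nnsfun_approx measurableT mk.
have cv x : (k_ n x)%:E @[n --> \oo] --> k x by exact: cvg_nnsfun_approx.
have nd x : nondecreasing_seq (fun n => k_ n x).
  by move=> i j ij; exact/lefP/nd_nnsfun_approx.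
have mk_ n : measurable_fun setT (fun x => (k_ n x)%:E) by apply/measurable_EFinP.
transitivity (limn (fun n => \int[dm]_x (k_ n x)%:E)).
  rewrite -monotone_convergence//.
  - by apply: eq_integral => x _; apply/esym/cvg_lim => //; exact: cv.
  - by move=> n x _; rewrite lee_fin.
  - by move=> x _ i j ij; rewrite lee_fin nd.
transitivity (limn (fun n => \int[m]_x ((h x)%:E * (k_ n x)%:E))).
  by congr (limn _); apply/funext => n; exact: nnsfun_density.
rewrite -monotone_convergence//.
- apply: eq_integral => x _; apply/cvg_lim => //.
  by first [apply: cvgeZl => //; exact: cv | apply: cvgeMl => //; exact: cv].
- by move=> n; apply: emeasurable_funM => //; exact: mh.
- by move=> n x _; apply: mule_ge0; [exact: h0|rewrite lee_fin].
- move=> x _ i j ij; rewrite -!EFinM lee_fin; apply: ler_wpM2l; last exact: nd.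
  by rewrite -lee_fin; exact: h0.
Qed.
End density_integral.

(** * Marginals, coupling and measurability in the boundary condition *)

Section marginals.
Variables (R : realType) (d : nat) (Q : probability (mark R) R).
Variables (qs : {measure set (marked d R) -> \bar R}) (qsE : Qstar Q = qs).
Hypothesis qs_fin : forall A : set (marked d R), Sbp A -> (qs A < +oo)%E.
Hypothesis qs1 : forall X, qs [set X] = 0%E.
Variables (H : hamiltonian_family R d) (hH : is_hamiltonian H).
Variables (lam a : R) (lam0 : 0 < lam) (a0 : 0 < a).
Hypothesis H_le : forall (X : marked d R) (w : config R d), ~ pts w X ->
  (expeR (- H [set X] (config_single X) w) <= (a / lam)%:E)%E.
Variables (D : set (marked d R)) (bD : Sbp D).
Variables (v : position d R) (hv : nonneg_shift v D).
Local Notation config := (config R d).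
Local Notation rk := (rank v).
Local Notation above := (above D v).
Local Notation upper := (upper D v).
Local Notation mul := (intensity qs_fin bD (ltW lam0)).
Local Notation mua := (intensity qs_fin bD (ltW a0)).
Local Notation LPa := (LP mua).
Local Notation LPl := (LP mul).
Local Notation part := (part H mul D v).
Local Notation weight := (weight H D v).
Local Notation ratio := (ratio H mul D v).
Local Notation points := (points D v).
Local Notation subconfig := (subconfig D v).
Local Notation split_pair := (split_pair D v).
Local Notation past := (past D v).
Local Notation thin := (thin_prob H mul lam D v a).
Local Notation keep := (keep_prob qs_fin H a lam0 bD v).
Implicit Types (g w : config) (X Y : marked d R).

Let b0 : 0 <= a / lam. Proof. by rewrite divr_ge0// ltW. Qed.
Let muD : mul (~` D) = 0%E. Proof. exact: intensity_null. Qed.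
Let mu1 X : mul [set X] = 0%E. Proof. exact: intensity_diffuse. Qed.
Let muaD : mua (~` D) = 0%E. Proof. exact: intensity_null. Qed.
Let mua1 X : mua [set X] = 0%E. Proof. exact: intensity_diffuse. Qed.
Let mkeep := measurable_keep_prob qs_fin qs1 hH lam0 a0 H_le bD hv.
Let mD : measurable (@config_in R d D). Proof. exact: measurable_config_in bD.1. Qed.
Let PD : LPa (~` config_in D) = 0%E. Proof. exact: LP_config_in bD.1 muaD. Qed.
Let PlD : LPl (~` config_in D) = 0%E. Proof. exact: LP_config_in bD.1 muD. Qed.

(** The two intensities are proportional, so the density is their ratio to the number of points; on
    void events this is an instance of [LP_prod]. *)
Lemma integral_change_intensity (k : config -> \bar R) :
  measurable_fun setT k -> (forall w, 0 <= k w)%E ->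
  (\int[LPa]_w ((prodp D v (fun=> lam / a) w)%:E * k w) = \int[LPl]_w k w)%E.
Proof.
pose c := lam / a; have c0 : 0 <= c by rewrite divr_ge0// ltW.
pose h w : R := prodp D v (fun=> c) w.
have mh : measurable_fun setT (EFin \o h) by apply/measurable_EFinP; exact: measurable_prodp.
have h0 w : (0 <= (EFin \o h) w)%E by rewrite lee_fin; apply: prodp_ge0.
have voidE A : measurable A -> density_measure LPa mh h0 (void A) = LPl (void A).
  move=> mA; pose f X : R := c * \1_(~` A) X.
  have mi : measurable_fun setT (\1_(~` A) : marked d R -> R) by apply: measurable_indic; exact: measurableC.
  have mf : measurable_fun setT f by apply: measurable_funM.
  have f0 X : 0 <= f X by rewrite mulr_ge0// indicE.
  have e : mul (~` A) = (c%:E * mua (~` A))%E.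
    transitivity (lam%:E * qs (~` A `&` D))%E; first exact: intensityE.
    transitivity (c%:E * (a%:E * qs (~` A `&` D)))%E; last by congr (_ * _)%E; exact/esym/intensityE.
    by rewrite muleA -EFinM divfK ?gt_eqF.
  have intf : (\int[mua]_x (f x)%:E = (fine (mul (~` A)))%:E)%E.
    rewrite -fin_mu; last exact: measurableC.
    rewrite e; under eq_integral do rewrite EFinM.
    rewrite ge0_integralZl_EFin//; last exact/measurable_EFinP.
    by rewrite integral_indic ?setIT//; exact: measurableC.
  transitivity (\int[LPa]_w (prodp D v f w)%:E)%E; last first.
    exact: etrans (LP_prod bD muaD mua1 hv mf f0 intf) (esym (LP_void _ mA)).
  transitivity (\int[LPa]_w ((EFin \o h) \_ (void A)) w)%E; first exact: integral_mkcond.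
  apply: (integral_cond mD PD).
  - by apply/(measurable_restrictT (EFin \o h) (measurable_void mA)); exact: measurable_funTS.
  - by apply/measurable_EFinP; exact: measurable_prodp.
  - by move=> w; rewrite /patch; case: ifP => // _; exact: h0.
  - by move=> w; rewrite lee_fin; exact: prodp_ge0.
  move=> w wD; rewrite /patch; case: ifPn => [/set_mem wA|/negP wA].
    congr EFin; rewrite /h /prodp big_seq [RHS]big_seq; apply: eq_bigr => X /(mem_points bD v)[wX DX].
    rewrite /f indicE mem_set ?mulr1// => AX.
    by have : (pts w `&` A) X by []; rewrite wA.
  have [X [wX AX]] : exists X, pts w X /\ A X.
    apply: contrapT => h'; apply: wA; apply/mem_set; apply/seteqP; split => // X [wX AX].
    by apply: h'; exists X.
  have Xp : X \in points w by apply/(mem_points bD v); split => //; exact: wD.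
  by rewrite /prodp (big_rem X)//= /f indicE memNset ?mulr0 ?mul0r// => h'; exact: h' AX.
have eqm E : measurable E -> density_measure LPa mh h0 E = LPl E.
  apply: measure_eq_void => [A bA|]; first exact: voidE bA.1.
  have -> : [set: config] = void set0 by rewrite void0.
  by rewrite (voidE _ measurable0) [ltLHS](LP_void _ measurable0) ltry.
move=> mk k0; apply: etrans (esym (integral_density LPa mh h0 mk k0)) _.
by apply: eq_measure_integral => E mE _; exact: eqm.
Qed.

Let mass0 : R := expR (- (a * fine (qs D))).

(** For fixed kept points the discarded ones integrate to [exp(m - I)], where [I] is the integrated
    ratio along the exploration. Together with the keeping probabilities, [gibbs_weight] yields the
    Gibbs density times a power of [lam / a], and this power changes the intensity from [a] to
    [lam]. *)
Lemma thinning_first g E : pts g `&` D = set0 -> measurable E ->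
  Pthin Q H lam a v D g (E `*` setT) = Pgb Q H lam D g E.
Proof.
move=> gD mE; have mES : measurable (E `*` [set: config]) by exact: measurableX.
apply: etrans (thinning_formula qsE qs_fin qs1 hH lam0 a0 H_le bD hv gD mES) _.
pose m := a * fine (qs D); pose pt := part (-1) g.
have VD : above (-1) = D by rewrite above_neg.
have gV : pts g `&` above (-1) = set0 by rewrite VD.
have pt0 : 0 < pt by apply: lt_le_trans (part_ge1 hH b0 H_le bD muD mu1 hv gV).
have mi : measurable_fun setT (\1_E : config -> R) by exact: measurable_indic.
have mwt : measurable_fun setT (fun w => weight w g).
  exact: (measurableT_comp (measurable_weight hH bD v) (measurable_pairr g)).
pose k w1 : \bar R := (\1_E w1 * (weight w1 g / pt))%:E.
have mk : measurable_fun setT k.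
  by apply/measurable_EFinP; apply: measurable_funM => //; apply: measurable_funM.
have k0 w : (0 <= k w)%E by rewrite lee_fin mulr_ge0 ?divr_ge0 ?weight_ge0 ?indicE// ltW.
pose pc w1 : R := prodp D v (fun=> lam / a) w1.
have pc0 w1 : 0 <= pc w1 by apply: prodp_ge0 => _; rewrite divr_ge0// ltW.
have mpc : measurable_fun setT (fun w => (pc w)%:E) by apply/measurable_EFinP; exact: measurable_prodp.
have inner w1 : config_in D w1 ->
    (\int[LPa]_w (\1_(E `*` setT) (w1, cunion (w1, w)) * pair_prob D v keep g (w1, w))%:E =
     (expR m)%:E * ((pc w1)%:E * k w1))%E.
  move=> w1D; pose s := points w1.
  have es : config_seq s = w1.
    apply: config_ext; apply/seteqP; split => X; first by move=> /(mem_points bD v)[].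
    by move=> wX; apply/(mem_points bD v); split => //; exact: w1D.
  have sV X : X \in s -> above (-1) X by rewrite VD => /(mem_points bD v)[].
  have ss : sorted (fun X Y => rk X < rk Y) s.
    by apply/(sortedP point) => i hi; apply: (kth_lt bD hv); rewrite ltnSn.
  have [I [intI _ wI]] := gibbs_weight hH b0 H_le bD muD mu1 hv sV ss gV.
  rewrite es in intI wI.
  (* [LP_prod] asks for a factor that is nonnegative everywhere, whereas the bound on [keep] is
     known on [D] only; hence the indicator. *)
  pose f X : R := \1_D X * (1 - keep (X, past w1 g X)).
  pose fr X : R := \1_D X * ratio X (past w1 g X).
  have mp : measurable_fun setT (fun X => (X, past w1 g X)).
    apply/measurable_fun_pair => //.
    exact: (measurableT_comp (measurable_past bD v) (measurable_pairl (w1, g))).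
  have mD1 : measurable_fun setT (\1_D : marked d R -> R) by exact: measurable_indic bD.1.
  have mfr : measurable_fun setT fr.
    apply: measurable_funM => //.
    exact: (measurableT_comp (f := fun p : marked d R * config => ratio p.1 p.2)
      (measurable_ratio hH b0 H_le bD muD mu1 hv) mp).
  have mf : measurable_fun setT f.
    by apply: measurable_funM => //; apply: measurable_funB => //; exact: (measurableT_comp mkeep mp).
  have f0 X : 0 <= f X.
    rewrite /f indicE; have [DX|DX] := pselect (D X); last by rewrite memNset// mul0r.
    rewrite mem_set// mul1r subr_ge0.
    by have /andP[] := keep_prob_bound qs_fin qs1 hH lam0 a0 H_le bD hv (past w1 g X) DX.
  have fr0 X : 0 <= fr X.
    rewrite /fr indicE; have [DX|DX] := pselect (D X); last by rewrite memNset// mul0r.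
    rewrite mem_set// mul1r.
    by have /andP[] := ratio_bound hH b0 H_le bD muD mu1 hv (past w1 g X) DX.
  have c0 : 0 <= lam / a by rewrite divr_ge0// ltW.
  have mEfr A : measurable_fun A (fun x => (fr x)%:E).
    by apply/measurable_EFinP; exact: measurable_funTS.
  have intr : (\int[mul]_x (fr x)%:E = I%:E)%E.
    rewrite -intI VD [RHS]integral_mkcond; apply: eq_integral => X _; rewrite /patch /fr indicE.
    by case: ifP; rewrite ?mul1r ?mul0r.
  have mEk : measurable_fun setT (fun x => (lam / a * fr x)%:E).
    by apply/measurable_EFinP; apply: measurable_funM.
  have intk : (\int[mua]_x (lam / a * fr x)%:E = I%:E)%E.
    apply: etrans (integral_intensity qs_fin bD a0 mEk _) _.
      by move=> X; rewrite lee_fin mulr_ge0.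
    under eq_integral do rewrite EFinM.
    rewrite ge0_integralZl_EFin; try by [exact: bD.1|exact: mEfr|exact: c0|move=> X _; rewrite lee_fin].
    rewrite muleA -EFinM [(a * _)%R]mulrC divfK ?gt_eqF// -intr.
    by apply/esym/(integral_intensity qs_fin bD lam0) => // X; rewrite lee_fin.
  have intf : (\int[mua]_x (f x)%:E = (m - I)%:E)%E.
    have : (\int[mua]_x ((f x)%:E + (lam / a * fr x)%:E) = m%:E)%E.
      transitivity (\int[mua]_x (\1_D x)%:E)%E.
        apply: eq_integral => X _; rewrite -EFinD /f /fr /keep_prob /=; congr EFin; ring.
      rewrite integral_indic ?setIT//; last exact: bD.1.
      apply: etrans (intensityE qs_fin bD (ltW a0) D) _.
      by rewrite setIid EFinM fineK// ge0_fin_numE// qs_fin.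
    rewrite ge0_integralD//; last 3 first.
    - by move=> X _; rewrite lee_fin.
    - exact/measurable_EFinP.
    - by move=> X _; rewrite lee_fin mulr_ge0.
    rewrite intk => h; have := congr1 (fun y => y - I%:E)%E h.
    by rewrite addeK// EFinB.
  have K1 : \prod_(X <- s) keep (X, past w1 g X) = pc w1 * \prod_(X <- s) ratio X (past w1 g X).
    by rewrite /pc /prodp -big_split.
  have K0 : 0 <= \1_E w1 * \prod_(X <- s) keep (X, past w1 g X).
    rewrite mulr_ge0 ?indicE// big_seq; apply: prodr_ge0 => X /(mem_points bD v)[_ DX].
    by have /andP[] := keep_prob_bound qs_fin qs1 hH lam0 a0 H_le bD hv (past w1 g X) DX.
  transitivity (\int[LPa]_w ((\1_E w1 * \prod_(X <- s) keep (X, past w1 g X))%:E * (prodp D v f w)%:E))%E.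
    apply: eq_integral => w _; rewrite /pair_prob -EFinM; congr EFin; rewrite -mulrA; congr (_ * (_ * _)).
      rewrite !indicE; congr (nat_of_bool _)%:R.
      by apply/idP/idP => /set_mem h; apply/mem_set; [case: h|split].
    rewrite /prodp big_seq [RHS]big_seq; apply: eq_bigr => X /(mem_points bD v)[_ DX].
    by rewrite /f indicE mem_set// mul1r.
  rewrite ge0_integralZl_EFin//; last 2 first.
  - by move=> w _; rewrite lee_fin; exact: prodp_ge0.
  - by apply/measurable_EFinP; exact: measurable_prodp.
  rewrite [X in (_ * X)%E](LP_prod bD muaD mua1 hv mf f0 intf) /k -!EFinM; congr EFin.
  by rewrite K1 expRD /pt -wI; ring.
transitivity ((expR (- m))%:E * \int[LPa]_w1 ((expR m)%:E * ((pc w1)%:E * k w1)))%E.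
  have ipos (w1 w : config) : (0 <= (\1_(E `*` setT) (w1, cunion (w1, w)) * pair_prob D v keep g (w1, w))%:E)%E.
    rewrite lee_fin mulr_ge0 ?indicE// pair_prob_bound// => X g' DX.
    exact: (keep_prob_bound qs_fin qs1 hH lam0 a0 H_le bD hv).
  congr (_ * _)%E; apply: (integral_cond mD PD) => //.
  - apply: (measurable_integral_snd LPa (f := fun p : config * config =>
      (\1_(E `*` setT) (p.1, cunion p) * pair_prob D v keep g p)%:E)); last by case.
    apply/measurable_EFinP; apply: measurable_funM.
      apply: (measurableT_comp (f := (\1_(E `*` setT) : config * config -> R))); first exact: measurable_indic.
      by apply/measurable_fun_pair; [exact: measurable_fst|exact: measurable_cunion].
    exact: (measurableT_comp (measurable_pair_prob bD hv mkeep) (measurable_pairl g)).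
  - by apply: emeasurable_funM => //; exact: emeasurable_funM.
  - by move=> w1; apply: integral_ge0 => w _; exact: ipos.
  - by move=> w; rewrite !mule_ge0// lee_fin// expR_ge0.
rewrite ge0_integralZl_EFin//; last 2 first.
- by move=> w _; rewrite mule_ge0// lee_fin.
- exact: emeasurable_funM.
rewrite muleA -EFinM -expRD addNr expR0 mul1e.
apply: etrans (integral_change_intensity mk k0) _; apply/esym.
rewrite /Pgb (Zgb_full qsE qs_fin qs1 hH lam0 a0 H_le bD hv gD) /=.
have tl : tail mul D v (-1) = lam * fine (qs D).
  rewrite tail_neg//; apply: EFin_inj; rewrite -fin_mu; last exact: bD.1.
  apply: etrans (intensityE qs_fin bD (ltW lam0) D) _.
  by rewrite setIid EFinM fineK// ge0_fin_numE// qs_fin.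
rewrite tl -/pt; set l := lam * _; set z := (_ * _)^-1.
have z0 : 0 <= z by rewrite invr_ge0 mulr_ge0 ?expR_ge0// ltW.
pose G w : \bar R := (\1_(config_in D `&` E) w * (weight w g * z))%:E.
have mG : measurable_fun setT G.
  apply/measurable_EFinP; apply: measurable_funM; last exact: measurable_funM.
  by apply: measurable_indic; exact: measurableI.
have G0 w : (0 <= G w)%E by rewrite lee_fin !mulr_ge0 ?weight_ge0 ?indicE.
transitivity (\int[Ppoi Q D lam]_w G w)%E.
  rewrite integral_mkcond; apply: eq_integral => w _; rewrite /patch /G indicE.
  case: ifPn => [/set_mem[wD wE]|nw]; last by rewrite mul0r.
  rewrite mul1r EFinM; congr (_ * _)%E; have [_ hH1 _ _] := hH.
  have sw : separated D v w g by apply: (@separated_above _ _ _ bD _ w g (-1)); rewrite VD.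
  rewrite (weightE hH bD bD wD gD sw) boltzE//; apply: hH1 => // X gX DX.
  by have : (pts g `&` D) X by []; rewrite gD.
rewrite (integral_Ppoi qsE qs_fin qs1 bD (ltW lam0) mG G0).
rewrite -ge0_integralZl_EFin; try by [exact: expR_ge0|exact: mG|move=> w _; exact: G0|exact: measurableT].
apply: (integral_cond mD PlD) => //.
- exact: emeasurable_funM.
- by move=> w; rewrite mule_ge0// lee_fin expR_ge0.
move=> w wD; rewrite /G /k -EFinM; congr EFin.
have -> : \1_(config_in D `&` E) w = \1_E w :> R.
  rewrite !indicE; congr (nat_of_bool _)%:R.
  by apply/idP/idP => /set_mem h; apply/mem_set; [case: h|split].
by rewrite /z -/l; field; rewrite !gt_eqF ?expR_gt0.
Qed.

(** [mecke] is read backwards: for a given union, the pair probabilities of all its splittings sum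
    to 1. *)
Lemma thinning_second g E : pts g `&` D = set0 -> measurable E ->
  Pthin Q H lam a v D g (setT `*` E) = Ppoi Q D a E.
Proof.
move=> gD mE; have mES : measurable ([set: config] `*` E) by exact: measurableX.
apply: etrans (thinning_formula qsE qs_fin qs1 hH lam0 a0 H_le bD hv gD mES) _.
pose phi (p : config * config) : \bar R := (\1_E (cunion p) * pair_prob D v keep g p)%:E.
have mphi : measurable_fun setT phi.
  apply/measurable_EFinP; apply: measurable_funM.
    apply: (measurableT_comp (f := (\1_E : config -> R))); first exact: measurable_indic.
    exact: measurable_cunion.
  exact: (measurableT_comp (measurable_pair_prob bD hv mkeep) (measurable_pairl g)).
have phi0 p : (0 <= phi p)%E.
  rewrite lee_fin mulr_ge0 ?indicE// pair_prob_bound// => X g' DX.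
  exact: (keep_prob_bound qs_fin qs1 hH lam0 a0 H_le bD hv).
rewrite (PpoiE qsE qs_fin qs1 bD (ltW a0) mE); congr (_ * _)%E.
transitivity (\int[LPa]_w (\sum_(J : {set 'I_(size (points w))}) phi (split_pair J w)))%E.
  apply/esym; apply: etrans (mecke bD muaD mua1 hv mphi phi0) _.
  apply: etrans (@fubini_tonelli1 _ _ _ _ _ LPa LPa phi mphi phi0) _.
  apply: eq_integral => w1 _; apply: eq_integral => w _; rewrite /phi; congr (_ * _)%:E.
  rewrite !indicE; congr (nat_of_bool _)%:R.
  by apply/idP/idP => /set_mem h; apply/mem_set; [split|case: h].
transitivity (\int[LPa]_w (\1_E w)%:E)%E; last by rewrite integral_indic ?setIT.
apply: (integral_cond mD PD).
- exact: measurable_split_sum.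
- by apply/measurable_EFinP; exact: measurable_indic.
- by move=> w; apply: sume_ge0 => J _; exact: phi0.
- by move=> w; rewrite lee_fin indicE.
move=> w wD; transitivity (\sum_(J : {set 'I_(size (points w))})
    (\1_E w * pair_prob D v keep g (split_pair J w))%:E)%E.
  by apply: eq_bigr => J _; rewrite /phi (cunion_split bD J wD).
by rewrite sumEFin -mulr_sumr (sum_pair_prob bD hv) mulr1.
Qed.

(** The law is built from the closed form: kept and discarded points have density [h] with respect
    to two independent unnormalised processes, and the union is taken as second component, so
    inclusion holds by construction. *)
Lemma thinning_coupling g : pts g `&` D = set0 ->
  exists P : probability (config * config)%type R,
    (forall A, measurable A -> P A = Pthin Q H lam a v D g A) /\
    is_thinning D P (Ppoi Q D a) (Pgb Q H lam D g).
Proof.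
move=> gD; pose h (p : config * config) : \bar R := (mass0 * pair_prob D v keep g p)%:E.
have mpp : measurable_fun setT (pair_prob D v keep g).
  exact: (measurableT_comp (measurable_pair_prob bD hv mkeep) (measurable_pairl g)).
have pp0 p : 0 <= pair_prob D v keep g p.
  by apply: pair_prob_bound => // X g' DX; exact: (keep_prob_bound qs_fin qs1 hH lam0 a0 H_le bD hv).
have mh : measurable_fun setT h by apply/measurable_EFinP; apply: measurable_funM.
have h0 p : (0 <= h p)%E by rewrite lee_fin mulr_ge0// expR_ge0.
pose F (p : config * config) : config * config := (p.1, cunion p).
have mF : measurable_fun setT F.
  by apply/measurable_fun_pair; [exact: measurable_fst|exact: measurable_cunion].
have mpre A : measurable A -> measurable (F @^-1` A).
  by move=> mA; rewrite -[X in measurable X]setTI; exact: mF.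
pose m0 := density_measure (LPa \x LPa)%E mh h0.
pose m1 := image_measure m0 mF.
have m1E A : measurable A -> m1 A = Pthin Q H lam a v D g A.
  move=> mA; apply: etrans _ (esym (thinning_formula qsE qs_fin qs1 hH lam0 a0 H_le bD hv gD mA)).
  pose phi (p : config * config) : \bar R := (\1_A (F p) * pair_prob D v keep g p)%:E.
  have mphi : measurable_fun setT phi.
    apply/measurable_EFinP; apply: measurable_funM => //.
    by apply: (measurableT_comp (f := (\1_A : config * config -> R))) => //; exact: measurable_indic.
  have phi0 p : (0 <= phi p)%E by rewrite lee_fin mulr_ge0 ?indicE.
  transitivity (\int[(LPa \x LPa)%E]_(p in F @^-1` A) h p)%E; first by [].
  transitivity (\int[(LPa \x LPa)%E]_p (mass0%:E * phi p))%E.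
    rewrite integral_mkcond; apply: eq_integral => p _; rewrite /patch /phi indicE.
    have -> : (p \in F @^-1` A) = (F p \in A) by apply/idP/idP => /set_mem ?; exact/mem_set.
    by case: ifP => _; rewrite ?mul1r ?mul0r ?mule0// -EFinM.
  rewrite ge0_integralZl_EFin//; last exact: expR_ge0.
  by congr (_ * _)%E; exact: (@fubini_tonelli1 _ _ _ _ _ LPa LPa phi mphi phi0).
have m11 : m1 setT = 1%E.
  by rewrite m1E// -setXTT thinning_second// probability_setT.
pose P := mkprobability m11.
have PE A : measurable A -> P A = Pthin Q H lam a v D g A by exact: m1E.
have P1 E : measurable E -> P (E `*` setT) = Pgb Q H lam D g E.
  by move=> mE; rewrite PE ?thinning_first//; exact: measurableX.
have P2 E : measurable E -> P (setT `*` E) = Ppoi Q D a E.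
  by move=> mE; rewrite PE ?thinning_second//; exact: measurableX.
have mCC : measurable (@config_in R d D `*` @config_in R d D) by exact: measurableX.
have PC : P (~` (config_in D `*` config_in D)) = 0%E.
  apply/eqP; rewrite eq_le measure_ge0 andbT.
  have mA : measurable ((~` @config_in R d D) `*` [set: config]) by apply: measurableX => //; exact: measurableC.
  have mB : measurable ([set: config] `*` (~` @config_in R d D)) by apply: measurableX => //; exact: measurableC.
  have sub : ~` (@config_in R d D `*` @config_in R d D) `<=`
      ((~` config_in D) `*` setT) `|` (setT `*` (~` config_in D)).
    move=> [w1 w2] /= h12; have [c1|c1] := pselect (config_in D w1); last by left.
    by right; split => // c2; apply: h12.
  apply: le_trans (_ : _ <= P (((~` config_in D) `*` setT) `|` (setT `*` (~` config_in D))))%E _.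
    by apply: le_measure sub; apply/mem_set; [exact: measurableC|exact: measurableU].
  apply: (le_trans (measureU2 P mA mB)).
  have z1 : P ((~` config_in D) `*` setT) = 0%E.
    by apply: etrans (P1 _ (measurableC mD)) _; rewrite /Pgb setICr integral_set0.
  have z2 : P (setT `*` (~` config_in D)) = 0%E.
    apply: etrans (P2 _ (measurableC mD)) _.
    rewrite (PpoiE qsE qs_fin qs1 bD (ltW a0)); last exact: measurableC.
    by rewrite [X in (_ * X)%E]PD mule0.
  by rewrite [X in (X + _)%E]z1 [X in (_ + X)%E]z2 adde0.
exists P; split; first exact: PE.
split => //.
  by rewrite -[X in P X]setCK probability_setC ?PC ?sube0//; exact: measurableC.
(* Inclusion is not visibly a measurable event. Inside [D] it means that the union has as many
   points as the second configuration, which is a countable combination of counting events. *)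
pose T := [set p : config * config | ncard (pts (cunion p) `&` D) = ncard (pts p.2 `&` D)].
have mT : measurable T.
  pose N k : set config := [set w : config | ncard (pts w `&` D) = k].
  pose B k : set (config * config) := ((@cunion R d) @^-1` N k) `&` (setT `*` N k).
  have mN k : measurable (N k) by exact: (measurable_ncard k bD).
  have mB k : measurable (B k).
    apply: measurableI; last exact: measurableX.
    by rewrite -[X in measurable X]setTI; exact: (@measurable_cunion R d measurableT _ (mN k)).
  have -> : T = \bigcup_k B k.
    apply/seteqP; split => [p pT|p [k _ [/= e1 [_ e2]]]]; last by rewrite /T /= e2; exact: e1.
    by exists (ncard (pts p.2 `&` D)).
  exact: bigcupT_measurable.
have mS : measurable ((config_in D `*` config_in D) `&` T) by exact: measurableI.
exists (~` ((config_in D `*` config_in D) `&` T)); split.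
- exact: measurableC.
- apply/eqP; rewrite eq_le measure_ge0 andbT -[leRHS]PC.
  apply: (@le_measure _ _ _ m0).
  - by apply/mem_set; apply: mpre; exact: measurableC.
  - by apply/mem_set; apply: mpre; exact: measurableC.
  move=> p /= hp hC; apply: hp; split => //; rewrite /T /=; congr (ncard (_ `&` _)).
  by rewrite setUA setUid.
- move=> [w1 w2] /= nsub [[c1 c2] eT]; apply: nsub => X wX; apply: contrapT => nX.
  have f2 := finite_configD bD w2.
  have nX' : ~ (pts w2 `&` D) X by case.
  have : (ncard ((pts w2 `&` D) `|` [set X]) <= ncard (pts (cunion (w1, w2)) `&` D))%N.
    apply: le_ncard; first exact: (finite_configD bD (cunion (w1, w2))).
    by move=> Y [[w2Y DY]|->]; split; [right|exact: DY|left|exact: c1].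
  by rewrite ncardU1// eT ltnn.
Qed.

Let config_inC g : config_in (~` D) g -> pts g `&` D = set0.
Proof. by move=> gD; apply/seteqP; split => // X [/gD]. Qed.

(** [thin_prob] is jointly measurable in the point and the boundary condition, and it agrees with
    [p_single] at every admissible [g], not only almost everywhere. *)
Lemma p_single_measurable X w : D X -> config_in (prec_lt v D X) w ->
  measurable_fun (config_in (~` D)) (fun g => p_single Q H lam a v D g X w).
Proof.
move=> DX wX; have mt := measurable_thin_prob hH b0 H_le lam bD muD mu1 hv a.
have mc : measurable_fun setT (fun g => (X, cunion (g, w))).
  apply/measurable_fun_pair => //.
  exact: (measurableT_comp (@measurable_cunion R d) (measurable_pairr w)).
have m : measurable_fun (config_in (~` D)) (fun g => thin (X, cunion (g, w))).
  by apply: measurable_funTS; exact: (measurableT_comp mt mc).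
apply: eq_measurable_fun m => g /set_mem gD.
apply/esym/(p_single_thin qsE qs_fin qs1 hH lam0 a0 H_le bD hv DX).
apply/seteqP; split => // Y [[gY|wY] [DY /= XY]]; first by have := gD Y gY.
have := wX Y wY; rewrite prec_lt_below => -[_ /= YX].
by have := lt_le_trans YX XY; rewrite ltxx.
Qed.

Lemma p_joint_measurable w1 w : config_in D w ->
  measurable_fun (config_in (~` D)) (fun g => p_joint Q H lam a v D g w1 w).
Proof.
move=> wD; have [s1|s1] := pselect (pts w1 `<=` pts w); last first.
  have m : measurable_fun (@config_in R d (~` D)) (cst (0 : R)) by [].
  by apply: eq_measurable_fun m => g _; rewrite /p_joint asboolF// !mul0r.
have [J eJ] := subconfig_surj bD v wD s1.
have mt := measurable_thin_prob hH b0 H_le lam bD muD mu1 hv a.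
have m : measurable_fun (config_in (~` D)) (fun g => pair_prob D v thin g (split_pair J w)).
  apply: measurable_funTS.
  exact: (measurableT_comp (measurable_pair_prob bD hv mt) (measurable_pairr (split_pair J w))).
apply: eq_measurable_fun m => g /set_mem/config_inC gD.
by rewrite -eJ (p_joint_pair qsE qs_fin qs1 hH lam0 a0 H_le bD hv J gD wD).
Qed.

(** The formula with the closed form holds for every admissible [g], although the null set discarded
    to reach it depends on [g]. Measurability is then that of iterated integrals. *)
Lemma Pthin_measurable A : measurable A ->
  measurable_fun (config_in (~` D)) (fun g => Pthin Q H lam a v D g A).
Proof.
move=> mA; pose phi (p : config * config * config) : \bar R :=
  (\1_A (p.1.2, cunion (p.1.2, p.2)) * pair_prob D v keep p.1.1 (p.1.2, p.2))%:E.
have m11 : measurable_fun setT (fun p : config * config * config => p.1.1).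
  by apply: (measurableT_comp (f := fst)); exact: measurable_fst.
have m12 : measurable_fun setT (fun p : config * config * config => p.1.2).
  by apply: (measurableT_comp (f := snd)); [exact: measurable_snd|exact: measurable_fst].
have m3 : measurable_fun setT (fun p : config * config * config => (p.1.2, p.2)).
  by apply/measurable_fun_pair => //; exact: measurable_snd.
have mphi : measurable_fun setT phi.
  apply/measurable_EFinP; apply: measurable_funM.
    apply: (measurableT_comp (f := (\1_A : config * config -> R))); first exact: measurable_indic.
    by apply/measurable_fun_pair => //; exact: (measurableT_comp (@measurable_cunion R d) m3).
  have m4 : measurable_fun setT (fun p : config * config * config => (p.1.1, (p.1.2, p.2))).
    exact/measurable_fun_pair.
  exact: (measurableT_comp (measurable_pair_prob bD hv mkeep) m4).
have phi0 p : (0 <= phi p)%E.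
  rewrite lee_fin mulr_ge0 ?indicE// pair_prob_bound// => X g' DX.
  exact: (keep_prob_bound qs_fin qs1 hH lam0 a0 H_le bD hv).
have mi := measurable_integral_snd LPa mphi phi0.
have mi0 p : (0 <= \int[LPa]_w phi (p, w))%E by apply: integral_ge0.
have mii := measurable_integral_snd LPa mi mi0.
have m : measurable_fun (config_in (~` D))
    (fun g => mass0%:E * \int[LPa]_w1 \int[LPa]_w phi (g, w1, w))%E.
  by apply: measurable_funTS; exact: emeasurable_funM.
apply: eq_measurable_fun m => g /set_mem/config_inC gD.
exact/esym/(thinning_formula qsE qs_fin qs1 hH lam0 a0 H_le bD hv gD mA).
Qed.

End marginals.

Theorem proposition4p1 (R : realType) (d : nat) (hd : (0 < d)%N)
  (Q : probability (mark R) R) (lam a : R) (hlam : 0 < lam) (ha : 0 < a)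
  (H : hamiltonian_family R d) (hH : is_hamiltonian H)
  (hHa : forall (X : marked d R) (w : config R d), ~ pts w X ->
     (lam%:E * expeR (- H [set X] (config_single X) w) <= a%:E)%E)
  (D : set (marked d R)) (hD : Sbp D)
  (v : position d R)
  (hv : forall X, D X -> forall i, 0 <= (tnth X.1 i : R) + tnth v i) :
  [/\ forall g w' : config R d, config_in (~` D) g -> config_in D w' ->
        negligible (Qstar Q) [set X | [/\ D X, config_in (prec_lt v D X) w' &
          ~ (derivable_right Q v D (potential Q H lam v D g w') X /\
             p_single Q H lam a v D g X w' =
             lam / a *
             fine (expeR (- H [set X] (config_single X) (config_union g w'))) *
             (fine (Zgb Q H lam (prec_gt v D X)
                      (config_union (config_union g w') (config_single X))) /
              fine (Zgb Q H lam (prec_ge v D X) (config_union g w'))))]],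
      forall g : config R d, config_in (~` D) g ->
        exists P : probability (config R d * config R d)%type R,
          (forall A, measurable A -> P A = Pthin Q H lam a v D g A) /\
          is_thinning D P (Ppoi Q D a) (Pgb Q H lam D g) &
      [/\ forall (X : marked d R) (w' : config R d),
            D X -> config_in (prec_lt v D X) w' ->
            measurable_fun (config_in (~` D))
              (fun g => p_single Q H lam a v D g X w'),
          forall w' w : config R d, config_in D w' -> config_in D w ->
            measurable_fun (config_in (~` D))
              (fun g => p_joint Q H lam a v D g w' w) &
          forall A : set (config R d * config R d), measurable A ->
            measurable_fun (config_in (~` D))
              (fun g => Pthin Q H lam a v D g A)]].

Proof.
have [qs [qsE qs_fin qs1']] := @Qstar_measure R d Q; have qs1 := qs1' hd.
have H_le (X : marked d R) (w : config R d) : ~ pts w X ->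
    (expeR (- H [set X] (config_single X) w) <= (a / lam)%:E)%E.
  move=> wX; have := hHa X w wX.
  have {1}-> : a = lam * (a / lam) by rewrite mulrC divfK ?gt_eqF.
  by rewrite EFinM lee_pmul2l ?lte_fin.
have inC (g : config R d) : config_in (~` D) g -> pts g `&` D = set0.
  by move=> gD; apply/seteqP; split => // X [/gD].
split.
- by move=> g w' gD wD; exact: (single_point_thinning qsE qs_fin qs1 hH hlam ha H_le hD hv gD wD).
- by move=> g /inC gD; exact: (thinning_coupling qsE qs_fin qs1 hH hlam ha H_le hD hv gD).
split.
- by move=> X w' DX wX; exact: (p_single_measurable qsE qs_fin qs1 hH hlam ha H_le hD hv DX wX).
- by move=> w' w _ wD; exact: (p_joint_measurable qsE qs_fin qs1 hH hlam ha H_le hD hv w' wD).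
- by move=> A mA; exact: (Pthin_measurable qsE qs_fin qs1 hH hlam ha H_le hD hv mA).
Qed.
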